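(* Let $p>1$, $p'=\frac p{p-1}$, and let $f,g,h,d$ satisfy the standing assumptions (H1)–(H4) listed in the context, with $\kappa=d^{\frac1{p-1}}h$. Put $$\ell_p:=\liminf_{\xi\to0^+}\frac{\kappa(\xi)^{p-1}}{\xi},\qquad L_p:=\limsup_{\xi\to0^+}\frac{\kappa(\xi)^{p-1}}{\xi}.$$ (1) If $\ell_p=+\infty$, then there exist no t.w.s.'s for any $c\in\mathbb R$. (2) If $\ell_p<+\infty$ and $c\in\mathbb R$ satisfies $$cg(0)-f(0)<p'[\ell_p(p-1)]^{\frac1p},$$ then there exist no t.w.s.'s having speed $c$. (3) If $L_p<+\infty$ and $c\in\mathbb R$ satisfies $$\inf_{\xi\in(0,1)}\frac1\xi\int_0^\xi(cg(\tau)-f(\tau))\,d\tau>p'(p-1)^{\frac1p}\left(\sup_{\xi\in(0,1)}\frac1\xi\int_0^\xi\frac{\kappa(\tau)}{\tau^{\frac1{p-1}}}\,d\tau\right)^{\frac1{p'}},$$ then there exists a t.w.s. having speed $c$, and it is unique up to shifts (i.e., up to translations $v(\cdot)\mapsto v(\cdot+z_0)$ of the wave profile).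
   Context: $\hat C[0,1]$ (resp. $\hat C(0,1)$) is the set of functions $\mu:[0,1]\to\mathbb R$ (resp. $\mu:(0,1)\to\mathbb R$) that are continuous except at a finite set $\mathcal D(\mu)\subset(0,1)$ of discontinuity points (of any type). Functions differing at finitely many points of $(0,1)$ are identified, and the coefficients are assumed to have no removable discontinuities. Standing assumptions: $p>1$ and (H1) $f,g,h\in\hat C[0,1]\cap L^\infty(0,1)$, $d\in\hat C(0,1)$; (H2) $\inf_{[a,b]}d>0$ and $\sup_{[a,b]}d<+\infty$ whenever $0<a<b<1$; (H3) $h(0)=h(1)=0$ and $\inf_{[a,b]}h>0$ whenever $0<a<b<1$; (H4) $\kappa:=d^{\frac1{p-1}}h\in L^1(0,1)$. Put $\Theta:=\mathcal D(d)\cup\mathcal D(f)\cup\mathcal D(g)\cup\mathcal D(h)$ and $\Theta^*:=\Theta\cup\{0,1\}$. For $c\in\mathbb R$, consider the problem $$(P_c)\quad (d(v)|v'|^{p-2}v')'+(cg(v)-f(v))v'+h(v)=0,\quad v\in[0,1],\quad v(-\infty)=1,\ v(+\infty)=0.$$ Definition (solution of $(P_c)$). A continuous function $v:\mathbb R\to[0,1]$ is a solution of $(P_c)$ if $v\in C^1(\mathbb R\setminus v^{-1}(\Theta^* ))$, $v(z)\to1$ as $z\to-\infty$, $v(z)\to0$ as $z\to+\infty$, and there exists a continuous function $\Phi_v:\mathbb R\to\mathbb R$ such that: (i) $\Phi_v(z)=d(v(z))|v'(z)|^{p-2}v'(z)$ in each open interval where $v$ is $C^1$ (the right-hand side being read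 as $0$ at points where $v'(z)=0$, in particular where $v(z)\in\{0,1\}$); (ii) $\lim_{z\to\pm\infty}\Phi_v(z)=0$; (iii) $\Phi_v(z)=0$ whenever $v(z)=0$ or $v(z)=1$; (iv) for all $z_1,z_2\in\mathbb R$, $$\Phi_v(z_2)-\Phi_v(z_1)+\int_{v(z_1)}^{v(z_2)}(cg(\xi)-f(\xi))\,d\xi+\int_{z_1}^{z_2}h(v(z))\,dz=0.$$ A traveling wave solution (t.w.s.) of speed $c$ (for the equation $f(u)u_x+g(u)u_t=(d(u)|u_x|^{p-2}u_x)_x+h(u)$) is a function $u(x,t)=v(x-ct)$ with wave profile $v$ a solution of $(P_c)$ in this sense. *)

(* Defs.v *)
From HB Require Import structures.
From mathcomp Require Export all_boot all_order all_algebra.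
From mathcomp Require Export all_classical all_reals all_analysis.

Set Implicit Arguments.
Unset Strict Implicit.
Unset Printing Implicit Defensive.

Export Order.TTheory GRing.Theory Num.Theory.
Export numFieldNormedType.Exports.

#[export] Set Implicit Arguments.
#[export] Unset Strict Implicit.
#[export] Unset Printing Implicit Defensive.

Local Open Scope ring_scope.
Local Open Scope classical_set_scope.

(* A coefficient defined on [0, 1] or on (0, 1) is a total function R -> R whose
   values outside that interval are irrelevant.  A class modulo modification at
   finitely many points is given by a representative, and every pointwise
   condition is imposed on that representative. *)

Section Coefficients.
Variable R : realType.
Implicit Types mu : R -> R.

Definition discont mu : set R :=
  [set x | (0 < x < 1) /\ ~ {for x, continuous mu}].

Definition Chat_open mu : Prop :=
  finite_set (discont mu) /\
  (forall x, discont mu x -> ~ exists l : R, mu y @[y --> x^'] --> l).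

Definition Chat_closed mu : Prop :=
  [/\ Chat_open mu,
      mu y @[y --> 0^'+] --> mu 0
    & mu y @[y --> 1^'-] --> mu 1].

Definition bounded_coeff mu : Prop :=
  mu \_ `]0, 1[ \in Lfun (@lebesgue_measure R) +oo%E.

(* Both conditions "inf_[a,b] mu > 0 whenever 0 < a < b < 1" and its upper
   counterpart are taken in the extended reals, so that unbounded sets do not
   yield a default value. *)
Definition locally_pos mu : Prop :=
  forall a b : R, 0 < a -> a < b -> b < 1 ->
    (0 < ereal_inf [set (mu x)%:E | x in `[a, b]])%E.

Definition locally_bnd_above mu : Prop :=
  forall a b : R, 0 < a -> a < b -> b < 1 ->
    (ereal_sup [set (mu x)%:E | x in `[a, b]] < +oo)%E.

Definition kappa (p : R) (d h : R -> R) (xi : R) : R :=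
  d xi `^ (1 / (p - 1)) * h xi.

Definition ell_inf (p : R) (d h : R -> R) : \bar R :=
  limf_einf (fun xi => (kappa p d h xi `^ (p - 1) / xi)%:E) 0^'+.

Definition ell_sup (p : R) (d h : R -> R) : \bar R :=
  limf_esup (fun xi => (kappa p d h xi `^ (p - 1) / xi)%:E) 0^'+.

End Coefficients.

Section Waves.
Variable R : realType.
Variables (p : R) (f g h d : R -> R).

Definition oriented_int (F : R -> R) (a b : R) : R :=
  if a <= b then \int[lebesgue_measure]_(x in `[a, b]) F x
  else - \int[lebesgue_measure]_(x in `[b, a]) F x.

Definition C1_on (U : set R) (v : R -> R) : Prop :=
  forall z, U z -> derivable v z 1 /\ {for z, continuous (derive1 v)}.

Definition Theta : set R :=
  discont d `|` discont f `|` discont g `|` discont h.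

Definition Theta_star : set R := Theta `|` [set 0; 1].

(* In the flux identity the right-hand side vanishes when v' z = 0 because of
   the last factor, whatever the value of the power.  In particular it vanishes
   at a point z of the interval with v z = 0 or v z = 1, since v is then extremal
   at z; so d 0 and d 1 play no role. *)
Definition is_flux (c : R) (v Phi : R -> R) : Prop :=
  continuous Phi /\
  [/\ forall a b : R, C1_on `]a, b[ v -> forall z, z \in `]a, b[ ->
        Phi z = d (v z) * `|derive1 v z| `^ (p - 2) * derive1 v z,
      Phi z @[z --> -oo] --> (0 : R) /\ Phi z @[z --> +oo] --> (0 : R),
      forall z, v z = 0 \/ v z = 1 -> Phi z = 0
    & forall z1 z2 : R,
        Phi z2 - Phi z1
        + oriented_int (fun xi => c * g xi - f xi) (v z1) (v z2)
        + oriented_int (fun z => h (v z)) z1 z2 = 0].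

Definition is_solution (c : R) (v : R -> R) : Prop :=
  continuous v /\ (forall z, 0 <= v z <= 1) /\
  [/\ C1_on (~` (v @^-1` Theta_star)) v,
      v z @[z --> -oo] --> (1 : R),
      v z @[z --> +oo] --> (0 : R)
    & exists Phi : R -> R, is_flux c v Phi].

Definition is_tws (c : R) (u : R -> R -> R) : Prop :=
  exists v : R -> R, is_solution c v /\ forall x t, u x t = v (x - c * t).

End Waves.

(* Main.v *)
Require Import Defs.
From mathcomp Require Import ess_sup_inf measurable_realfun ring lra.

(** Write q = c g - f and e = 1 / (p - 1). Where 0 < v < 1 a wave v turns out to
    be strictly decreasing, so that minus its flux can be read as a function y
    of the value x = v z instead of the position z. Dividing the wave equation by
    v' = - (y / d)^e turns it into a singular first order problem on (0, 1),
      y' = q - kappa y^(- e),   y > 0,   y (0+) = y (1-) = 0,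
    valid away from the finitely many discontinuities of the coefficients, and the
    position is recovered from dz/dx = - (d / y)^e. Waves up to translation
    correspond to the solutions y of this problem, called orbits below, and the
    three claims are claims about orbits.

    From waves to orbits. Let Q be the primitive of q that vanishes at 0. By the
    integral law, Phi + Q(v) decreases along a wave at the rate h(v). At a zero of
    the flux Phi with 0 < v < 1 the wave is almost stationary, so Phi itself
    decreases there: the flux can only cross 0 downwards ([wave_crossing]). A
    stretch of positive flux would thus have to start at v = 0, and the earlier
    descent of the wave from 1 to 0 forbids that ([wave_flux_le0]). The
    derivatives are unknown where v takes one of finitely many values; the mean
    value inequality [mvt_le_preim] tolerates that.

    No orbit (claims 1 and 2). Let r = y / x. If q <= A and kappa^(p-1) >= m x
    near 0, then x r' <= A - (r + (m / r)^e), and by Young's inequality the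
    parenthesis is at least p' (m (p - 1))^(1/p) ([young_min]). If A is smaller
    than that, then r tends to +oo at 0 like a logarithm, whereas y' <= A keeps r
    bounded ([no_orbit]).

    Uniqueness (claim 3). The right-hand side of the orbit equation increases with
    y, so the gap between two orbits cannot shrink as x increases, yet it must
    close at 1 ([orbit_le]). Two waves then have the same orbit, hence the same
    dz/dx, and their positions differ by a constant ([solution_unique]).

    Existence (claim 3). By the same monotonicity the orbit is determined from its
    value 0 at 1, and Perron's method produces it: y x is the infimum at x of the
    positive functions u on [x, 1) with u' <= q - kappa u^(- e) ([perron_orbit]).
    No integration of the singular equation is needed, because the slope of the
    infimum can be estimated from both sides by lines. The infimum is positive
    because the singular term pushes small values up towards the left, and it
    vanishes at 1 thanks to explicit competitors. It vanishes at 0 because the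
    inequality assumed on c makes
      U x = Q x - rho^(- e) * (integral of kappa t^(- e) over (0, x))
    a competitor lying above rho x, rho being the value for which Young's
    inequality is an equality ([young_min_attained], [orbit_exists]).

    The way back ([wave_of_orbit]) inverts the decreasing function z(x). The one
    delicate point is the flux identity where v is C1 and passes through a
    discontinuity s of d: there d = y / |v'|^(p-1) would have a limit at s, which
    is excluded since d has no removable discontinuity. *)

Local Open Scope ring_scope.
Local Open Scope classical_set_scope.

(** * Mean value inequalities with exceptional points *)

Section MeanValue.
Variable R : realType.
Implicit Types (u v : R -> R) (S : seq R) (a b x K : R).

Lemma mvt_le u a b K : a <= b ->
  (forall x, a <= x <= b -> {for x, continuous u}) ->
  (forall x, a < x < b -> exists2 d, is_derive x 1 u d & d <= K) ->
  u b - u a <= K * (b - a).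
Proof.
move=> ab cu du; have [->|ab'] := eqVneq a b; first by rewrite !subrr mulr0.
have {ab'}ab' : a < b by rewrite lt_neqAle ab' ab.
have [||c cab ->] := @MVT R u (derive1 u) a b ab'.
- move=> x; rewrite in_itv/= => /du[d ud _].
  by rewrite derive1E; apply: derivableP; exact: ex_derive.
- apply: continuous_in_subspaceT => x; rewrite inE/= in_itv/= => ?; exact: cu.
rewrite ler_wpM2r ?subr_ge0//.
move: cab; rewrite in_itv/= => /du[d ud]; rewrite derive1E.
by rewrite (@derive_val _ _ _ _ _ _ _ ud).
Qed.

(** The interval is cut at the exceptional points, one at a time. *)
Lemma mvt_le_off u a b K S : a <= b ->
  (forall x, a <= x <= b -> {for x, continuous u}) ->
  (forall x, a < x < b -> x \notin S -> exists2 d, is_derive x 1 u d & d <= K) ->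
  u b - u a <= K * (b - a).
Proof.
elim: S a b => [|s S IH] a b ab cu du.
  by apply: mvt_le => // x ?; exact: du.
have [/andP[as_ sb]|nsab] := boolP (a < s < b); last first.
  apply: IH => // x xab xS; apply: du => //; rewrite inE negb_or xS andbT.
  by apply: contraNneq nsab => <-.
have l : u s - u a <= K * (s - a).
  apply: IH => [|x|x]; first exact: ltW.
    by move=> /andP[? ?]; apply: cu; apply/andP; split; lra.
  move=> /andP[? ?] xS; apply: du; first by apply/andP; split; lra.
  by rewrite inE negb_or xS andbT lt_eqF.
have r : u b - u s <= K * (b - s).
  apply: IH => [|x|x]; first exact: ltW.
    by move=> /andP[? ?]; apply: cu; apply/andP; split; lra.
  move=> /andP[? ?] xS; apply: du; first by apply/andP; split; lra.
  by rewrite inE negb_or xS andbT gt_eqF.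
by lra.
Qed.

Lemma mvt_ge_off u a b K S : a <= b ->
  (forall x, a <= x <= b -> {for x, continuous u}) ->
  (forall x, a < x < b -> x \notin S -> exists2 d, is_derive x 1 u d & K <= d) ->
  K * (b - a) <= u b - u a.
Proof.
move=> ab cu du.
have : (- u) b - (- u) a <= - K * (b - a).
  apply: (@mvt_le_off (- u) _ _ _ S ab) => x xab.
    by apply: continuousN; exact: cu.
  move=> xS; have [d ud dK] := du _ xab xS.
  by exists (- d); [exact: is_deriveN|rewrite lerN2].
by rewrite !fctE; lra.
Qed.

End MeanValue.

(** * First and last hitting points, comparison *)

Section Hitting.
Variable R : realType.
Implicit Types (e u v : R -> R) (S : seq R) (a b x t K : R).

Lemma continuous_eps u x : {for x, continuous u} -> forall eps, 0 < eps ->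
  exists2 del, 0 < del & forall y, `|y - x| < del -> `|u y - u x| < eps.
Proof.
move=> /cvgrPdist_lt cu eps e0; have := cu _ e0.
move/nbhs_ballP => [d /= d0 dP]; exists d => // y yx.
by rewrite distrC; apply: dP; rewrite /ball/= distrC.
Qed.

Lemma continuous_gt0 u x : {for x, continuous u} -> 0 < u x ->
  exists2 del, 0 < del & forall y, `|y - x| < del -> 0 < u y.
Proof.
move=> cu u0; have [d d0 dP] := continuous_eps cu u0; exists d => // y /dP.
by rewrite ltr_norml => /andP[]; lra.
Qed.

Lemma first_le0 e a b : (forall x, a <= x <= b -> {for x, continuous e}) ->
  (exists2 x, a <= x <= b & e x <= 0) ->
  exists t, [/\ a <= t <= b, e t <= 0 & forall x, a <= x -> x < t -> 0 < e x].
Proof.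
move=> ce [x0 x0ab ex0].
pose A : set R := [set x | a <= x <= b /\ e x <= 0].
have A0 : A x0 by [].
have lbA : lbound A a by move=> x [/andP[]].
have hA : has_inf A by split; [exists x0|exists a].
have tA x : A x -> inf A <= x by move=> ?; apply: ge_inf => //; exists a.
have at_ : a <= inf A by apply: lb_le_inf => //; exists x0.
have tb : inf A <= b by apply: le_trans (tA _ A0) _; case/andP: x0ab.
exists (inf A); split; first by rewrite at_.
- rewrite leNgt; apply/negP => et.
  have [d d0 dP] := continuous_gt0 (ce _ (introT andP (conj at_ tb))) et.
  have [x Ax xd] := inf_adherent d0 hA.
  have := dP x; rewrite ger0_norm ?subr_ge0 ?tA// => /(_ _)/wrap[]; first lra.
  by case: Ax => _; lra.
- move=> x ax xt; rewrite ltNge; apply/negP => ex.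
  have := tA x; rewrite /A/= => /(_ _)/wrap[|]; last lra.
  by split=> //; apply/andP; split; lra.
Qed.

Lemma last_le0 e a b : (forall x, a <= x <= b -> {for x, continuous e}) ->
  (exists2 x, a <= x <= b & e x <= 0) ->
  exists t, [/\ a <= t <= b, e t <= 0 & forall x, t < x -> x <= b -> 0 < e x].
Proof.
move=> ce [x0 x0ab ex0].
have [||t [tab et tP]] := @first_le0 (e \o -%R) (- b) (- a).
- move=> x xab; apply: continuous_comp; first exact: continuousN.
  by apply: ce; lra.
- by exists (- x0); rewrite ?fctE ?opprK//; lra.
- exists (- t); split=> // [|x ? ?]; first lra.
  by have := tP (- x); rewrite /= opprK; apply; lra.
Qed.

Lemma first_zero e a b : (forall x, a <= x <= b -> {for x, continuous e}) ->
  a <= b -> 0 < e a -> e b <= 0 ->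
  exists t, [/\ a < t <= b, e t = 0 & forall x, a <= x -> x < t -> 0 < e x].
Proof.
move=> ce ab ea eb.
have [|t [/andP[ta tb] et tP]] := first_le0 ce; first by exists b; rewrite ?ab/=.
have ta' : a < t by rewrite lt_neqAle ta andbT; apply: contraTneq ea => ->; lra.
exists t; split; [by rewrite ta' tb| |by []].
apply/eqP; rewrite eq_le et leNgt; apply/negP => et0.
have cNe : {for t, continuous (- e)} by apply: continuousN; apply: ce; lra.
have [|d d0 dP] := continuous_gt0 cNe; first by rewrite fctE; lra.
have := dP (Num.max a (t - d / 2)); have := tP (Num.max a (t - d / 2)).
rewrite !fctE; have [am|am] := leP a (t - d/2) => e1 e2.
  have : 0 < e (t - d / 2) by apply: e1; lra.
  have : 0 < - e (t - d / 2) by apply: e2; rewrite ltr_norml; lra.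
  by lra.
have : 0 < - e a by apply: e2; rewrite ltr_norml; lra.
by lra.
Qed.

Lemma last_zero e a b : (forall x, a <= x <= b -> {for x, continuous e}) ->
  a <= b -> e a <= 0 -> 0 < e b ->
  exists t, [/\ a <= t < b, e t = 0 & forall x, t < x -> x <= b -> 0 < e x].
Proof.
move=> ce ab ea eb.
have [||||t [tab et tP]] := @first_zero (e \o -%R) (- b) (- a).
- move=> x xab; apply: continuous_comp; first exact: continuousN.
  by apply: ce; lra.
- by lra.
- by rewrite /= opprK.
- by rewrite /= opprK.
- exists (- t); split=> // [|x ? ?]; first lra.
  by have := tP (- x); rewrite /= opprK; apply; lra.
Qed.

(** The set of exceptional points, the preimage of S under v, can be infinite. But
    v takes the same value s at its first and last passages through s, so what
    happens in between does not contribute to v b - v a; since K >= 0 the length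
    of that stretch can be added to the bound for free. *)
Lemma mvt_le_preim v a b K S : 0 <= K -> a <= b ->
  (forall x, a <= x <= b -> {for x, continuous v}) ->
  (forall x, a < x < b -> v x \notin S -> exists2 d, is_derive x 1 v d & d <= K) ->
  v b - v a <= K * (b - a).
Proof.
move=> K0; elim: S a b => [|s S IH] a b ab cv dv.
  by apply: mvt_le => // x ?; exact: dv.
have ce x : a <= x <= b -> {for x, continuous (fun x => `|v x - s|)}.
  move=> xab; apply: (@continuous_comp _ _ _ (fun x => v x - s) (fun x => `|x|)).
    by apply: continuousB; [exact: cv|exact: cst_continuous].
  exact: norm_continuous.
have [ex|nex] := pselect (exists2 x, a <= x <= b & `|v x - s| <= 0); last first.
  apply: IH => // x /andP[ax xb] xS; apply: dv; first by rewrite ax xb.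
  rewrite inE negb_or xS andbT; apply/eqP => vxs; apply: nex; exists x.
    by apply/andP; split; exact: ltW.
  by rewrite vxs subrr normr0.
have [t [/andP[at_ tb] vt tP]] := first_le0 ce ex.
have [r [/andP[ar rb] vr rP]] := last_le0 ce ex.
have tr : t <= r.
  by rewrite leNgt; apply/negP => rt; have := rP t rt tb; rewrite ltNge vt.
have {vt}vt : v t = s by apply/eqP; rewrite -subr_eq0 -normr_le0.
have {vr}vr : v r = s by apply/eqP; rewrite -subr_eq0 -normr_le0.
have l : v t - v a <= K * (t - a).
  apply: IH => // x => [?|/andP[ax xt] xS]; first by apply: cv; lra.
  apply: dv; first lra.
  rewrite inE negb_or xS andbT; apply/eqP => vxs.
  by have := tP x (ltW ax) xt; rewrite vxs subrr normr0 ltxx.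
have rr : v b - v r <= K * (b - r).
  apply: IH => // x => [?|/andP[ax xt] xS]; first by apply: cv; lra.
  apply: dv; first lra.
  rewrite inE negb_or xS andbT; apply/eqP => vxs.
  by have := rP x ax (ltW xt); rewrite vxs subrr normr0 ltxx.
by nra.
Qed.

Lemma mvt_ge_preim v a b K S : 0 <= K -> a <= b ->
  (forall x, a <= x <= b -> {for x, continuous v}) ->
  (forall x, a < x < b -> v x \notin S -> exists2 d, is_derive x 1 v d & - K <= d) ->
  - K * (b - a) <= v b - v a.
Proof.
move=> K0 ab cv dv.
have : (- v) b - (- v) a <= K * (b - a).
  apply: (@mvt_le_preim (- v) _ _ _ (map -%R S) K0 ab) => x xab.
    by apply: continuousN; exact: cv.
  rewrite fctE mem_map; last exact: oppr_inj.
  move=> xS; have [d ud dK] := dv _ xab xS.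
  by exists (- d); [exact: is_deriveN|lra].
by rewrite !fctE; lra.
Qed.

(** The sign of the derivative is known only while e > 0, but then e does not
    decrease and therefore stays positive: the interval on which this is known
    cannot end before b. *)
Lemma ndecr_while_pos e a b S : a <= b ->
  (forall x, a <= x <= b -> {for x, continuous e}) ->
  (forall x, a < x < b -> x \notin S -> 0 < e x ->
     exists2 d, is_derive x 1 e d & 0 <= d) ->
  0 < e a -> e a <= e b.
Proof.
move=> ab ce de ea; rewrite leNgt; apply/negP => eb.
pose c := Num.max 0 ((e a + e b) / 2).
have c0 : 0 <= c by rewrite /c le_max lexx.
have cea : c < e a by rewrite /c gt_max ea/=; lra.
have ebc : e b <= c by rewrite /c le_max; apply/orP; right; lra.
have [|||t [/andP[at_ tb] et tP]] := @first_zero (fun x => e x - c) a b _ ab.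
- by move=> x ?; apply: continuousB; [exact: ce|exact: cst_continuous].
- by lra.
- by lra.
have : 0 * (t - a) <= e t - e a.
  apply: (@mvt_ge_off R e a t 0 S (ltW at_)) => x xt; first by apply: ce; lra.
  move=> xS; apply: de => //; first lra.
  by have : 0 < e x - c by [apply: tP; lra]; lra.
by rewrite mul0r; lra.
Qed.

Lemma cvgNy_eps (f : R -> R) (l eps : R) : f z @[z --> -oo] --> l -> 0 < eps ->
  exists A, forall z, z <= A -> `|f z - l| < eps.
Proof.
move=> /cvgrPdist_lt fl /fl[A [_ AP]]; exists (A - 1) => z zA.
by rewrite distrC; apply: AP; lra.
Qed.

Lemma cvgy_eps (f : R -> R) (l eps : R) : f z @[z --> +oo] --> l -> 0 < eps ->
  exists A, forall z, A <= z -> `|f z - l| < eps.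
Proof.
move=> /cvgrPdist_lt fl /fl[A [_ AP]]; exists (A + 1) => z zA.
by rewrite distrC; apply: AP; lra.
Qed.

End Hitting.

(** * Perron's method for the orbit equation *)

Section Slopes.
Variable R : realType.

Lemma is_derive_slopes (f : R -> R) (x l : R) :
  (forall eps : R, 0 < eps -> exists2 del : R, 0 < del &
     forall h, h != 0 -> `|h| < del -> `|f (x + h) - f x - l * h| <= eps * `|h|) ->
  is_derive x 1 f l.
Proof.
move=> H; suff cl : h^-1 *: (f (h *: 1 + x) - f x) @[h --> 0^'] --> l.
  apply: DeriveDef; first by apply/cvg_ex; exists l.
  exact/cvg_lim.
apply/cvgrPdist_le => e e0; have [d d0 dP] := H _ e0.
apply/nbhs_ballP; exists d => //= h; rewrite /ball/= sub0r normrN => hd h0.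
rewrite /GRing.scale/= mulr1 [h + x]addrC distrC.
have -> : h^-1 * (f (x + h) - f x) - l = (f (x + h) - f x - l * h) / h.
  by rewrite mulrBl mulfK// mulrC.
by rewrite normrM normfV ler_pdivrMr ?normr_gt0//; exact: dP.
Qed.

End Slopes.

Section Perron.
Variable R : realType.
Variables (q k phi : R -> R) (S : seq R) (M : R).
Implicit Types x y z a b C m del eps tau sig : R.
Hypothesis phi_gt0 : forall y, 0 < y -> 0 < phi y.
Hypothesis phi_nincr : forall x y, 0 < x -> x <= y -> phi y <= phi x.
Hypothesis phi_cont : forall y, 0 < y -> {for y, continuous phi}.
Hypothesis phi_blowup :
  forall C, exists2 del : R, 0 < del & forall y, 0 < y -> y <= del -> C <= phi y.
Hypothesis q_bnd : forall x, 0 < x < 1 -> `|q x| <= M.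
Hypothesis k_ge0 : forall x, 0 < x < 1 -> 0 <= k x.
Hypothesis k_lb : forall a b, 0 < a -> a < b -> b < 1 ->
  exists2 m : R, 0 < m & forall x, a <= x <= b -> m <= k x.
Hypothesis k_ub : forall a b, 0 < a -> a < b -> b < 1 ->
  exists C, forall x, a <= x <= b -> k x <= C.
Hypothesis q_cont : forall x, 0 < x < 1 -> x \notin S -> {for x, continuous q}.
Hypothesis k_cont : forall x, 0 < x < 1 -> x \notin S -> {for x, continuous k}.

Definition rate_field x y := q x - k x * phi y.

(** A competitor for Perron's method at x0 is constrained to the right of x0 only,
    so that any competitor can be continued to the left. The exceptional points
    are not fixed in advance, so that two competitors may be glued. *)
Definition upper_barrier x0 (u : R -> R) :=
  [/\ forall x, 0 < x < 1 -> {for x, continuous u},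
      forall x, x0 <= x < 1 -> 0 < u x
    & exists s : seq R, forall x, x0 < x < 1 -> x \notin s ->
        exists2 d, is_derive x 1 u d & d <= rate_field x (u x)].

Definition perron x : R := inf [set u x | u in upper_barrier x].

Lemma rate_field_le x y : 0 < x < 1 -> 0 < y -> rate_field x y <= M.
Proof.
move=> x01 y0; have := q_bnd x01; rewrite ler_norml => /andP[_ qM].
have := mulr_ge0 (k_ge0 x01) (ltW (phi_gt0 y0)).
by rewrite /rate_field; lra.
Qed.

Lemma rate_field_homo x y z : 0 < x < 1 -> 0 < y -> y <= z -> rate_field x y <= rate_field x z.
Proof.
by move=> x01 y0 yz; rewrite /rate_field lerB// ler_wpM2l ?k_ge0// phi_nincr.
Qed.

Lemma rate_field_cont x y : 0 < x < 1 -> x \notin S -> 0 < y -> forall eps, 0 < eps ->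
  exists2 del : R, 0 < del & forall x' y', `|x' - x| < del -> `|y' - y| < del ->
     `|rate_field x' y' - rate_field x y| < eps.
Proof.
move=> x01 xS y0 eps e0.
have : rate_field z.1 z.2 @[z --> (x, y)] --> rate_field x y.
  apply: cvgB.
    by apply: (cvg_comp _ _ cvg_fst); exact: (q_cont x01 xS).
  apply: cvgM.
    by apply: (cvg_comp _ _ cvg_fst); exact: (k_cont x01 xS).
  by apply: (cvg_comp _ _ cvg_snd); exact: (phi_cont y0).
move/cvgrPdist_lt => /(_ _ e0)/nbhs_ballP[d /= d0 dP]; exists d => // x' y' xd yd.
rewrite distrC; apply: (dP (x', y')); split; rewrite /ball/= distrC//.
Qed.

Lemma upper_barrier_sub x0 x1 u : x0 <= x1 -> upper_barrier x0 u -> upper_barrier x1 u.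
Proof.
move=> x01 [cu pu [s su]]; split=> // [x ?|]; first by apply: pu; lra.
by exists s => x ?; apply: su; lra.
Qed.

Lemma perron_le x u : x < 1 -> upper_barrier x u -> perron x <= u x.
Proof.
move=> x1 su; apply: ge_inf; last by exists u.
by exists 0 => _ [w [_ pw _] <-]; apply/ltW/pw; rewrite lexx.
Qed.

Lemma upper_barrier_glue x1 x2 u w : 0 < x1 -> x1 < x2 -> x2 < 1 -> upper_barrier x2 u ->
  (forall x, 0 < x < 1 -> {for x, continuous w}) -> w x2 = u x2 ->
  (forall x, x1 <= x <= x2 -> 0 < w x) ->
  (forall x, x1 < x < x2 -> x \notin S ->
     exists2 d, is_derive x 1 w d & d <= rate_field x (w x)) ->
  upper_barrier x1 (fun x => if x <= x2 then w x else u x).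
Proof.
move=> x10 x12 x21 [cu pu [s su]] cw wu pw dw.
have nl x : x < x2 -> \forall z \near x, w z = if z <= x2 then w z else u z.
  by move=> xx2; near=> z; rewrite ltW//; near: z; exact: lt_nbhsl.
have nr x : x2 < x -> \forall z \near x, u z = if z <= x2 then w z else u z.
  move=> xx2; near=> z; rewrite leNgt ifF//; apply/negbF.
  by near: z; exact: lt_nbhsr.
split.
- move=> x x01; have [xx2|xx2|->] := ltgtP x x2.
  + rewrite /prop_for/continuous_at (ltW xx2); apply: cvg_trans (cw _ x01).
    by apply: near_eq_cvg; exact: nl.
  + rewrite /prop_for/continuous_at leNgt xx2/=; apply: cvg_trans (cu _ x01).
    by apply: near_eq_cvg; exact: nr.
  + have x201 : 0 < x2 < 1 by lra.
    apply/cvgrPdist_lt => e e0; near=> z.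
    rewrite lexx; case: ifP => _.
      by near: z; move/cvgrPdist_lt : (cw _ x201); exact.
    by rewrite wu; near: z; move/cvgrPdist_lt : (cu _ x201); exact.
- by move=> x x01; case: ifPn => [?|]; [apply: pw; lra|rewrite -ltNge => ?; apply: pu; lra].
- exists (x2 :: S ++ s) => x xx; rewrite inE mem_cat !negb_or => /and3P[xx2 xS xs].
  have [xlt|xgt|xe] := ltgtP x x2; last by rewrite xe eqxx in xx2.
  + have [|d wd dF] := dw x _ xS; first lra.
    by exists d => //; apply: near_eq_is_derive wd => //; exact: nl.
  + have [|d ud dF] := su x _ xs; first lra.
    by exists d => //; apply: near_eq_is_derive ud => //; exact: nr.
Unshelve. all: by end_near. Qed.


Variables (Kap : R -> R) (K1 : R).
Hypothesis Kap_cont : forall x, 0 < x < 1 -> {for x, continuous Kap}.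
Hypothesis Kap_der : forall x, 0 < x < 1 -> x \notin S -> is_derive x 1 Kap (k x).
Hypothesis Kap_le : forall x, 0 < x < 1 -> Kap x <= K1.
Hypothesis Kap_lim : Kap x @[x --> 1^'-] --> K1.

Lemma bound_ge0 : 0 <= M.
Proof. by apply: le_trans (normr_ge0 (q 2^-1)) (q_bnd _); lra. Qed.

(** The function stays above eps, so phi eps dominates phi of its values. Its
    limit at 1 is eps, which is arbitrarily small: this is what makes the infimum
    vanish at 1, and it also shows that competitors exist. *)
Lemma explicit_upper_barrier eps x0 : 0 < eps -> 0 < x0 ->
  upper_barrier x0 (fun x => eps + M * (1 - x) + phi eps * (K1 - Kap x)).
Proof.
move=> e0 x00; split.
- move=> x x01; apply: cvgD; last first.
    by apply: cvgM; [exact: cvg_cst|apply: cvgB; [exact: cvg_cst|exact: Kap_cont]].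
  apply: cvgD; first exact: cvg_cst.
  by apply: cvgM; [exact: cvg_cst|apply: cvgB; [exact: cvg_cst|exact: cvg_id]].
- move=> x x01; have := bound_ge0; have := phi_gt0 e0; have := @Kap_le x.
  by rewrite -subr_ge0 => H; nra.
- exists S => x x01 xS; have x01' : 0 < x < 1 by lra.
  exists (- M - phi eps * k x).
    have dK := Kap_der x01' xS.
    by apply: is_derive_eq; rewrite /GRing.scale/=; ring.
  have : phi (eps + M * (1 - x) + phi eps * (K1 - Kap x)) <= phi eps.
    apply: phi_nincr => //.
    have := bound_ge0; have := phi_gt0 e0; have := @Kap_le x.
    by rewrite -subr_ge0 => H; nra.
  move=> /(ler_wpM2l (k_ge0 x01')); have := q_bnd x01'.
  by rewrite ler_norml /rate_field; lra.
Qed.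

Lemma perron_near_opt x eps : 0 < x < 1 -> 0 < eps ->
  exists2 u, upper_barrier x u & u x < perron x + eps.
Proof.
move=> x01 e0; have [|_ [u su <-] ux] := @inf_adherent _ [set u x | u in upper_barrier x] _ e0.
  split; first by eexists; eexists; [apply: (@explicit_upper_barrier 1 x) => //; lra|].
  by exists 0 => _ [w [_ pw _] <-]; apply/ltW/pw; lra.
by exists u.
Qed.

(** Below a small height e the singular term makes every competitor decrease with
    slope at most - 1. A competitor below the segment from height e at a to
    height 0 at c would therefore stay below it, and could not be positive at c. *)
Lemma perron_gt0 a b : 0 < a -> a < b -> b < 1 ->
  exists2 del : R, 0 < del & forall x, a <= x <= b -> del <= perron x.
Proof.
move=> a0 ab b1; pose c := (b + 1) / 2.
have [|||m m0 mk] := @k_lb a c => //; rewrite /c; [lra|lra|].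
have [d d0 dphi] := phi_blowup ((M + 1) / m).
pose e := Num.min d (c - a).
have e0 : 0 < e by rewrite lt_min d0/= /c; lra.
have ed : e <= d by rewrite ge_min lexx.
have eca : e <= c - a by rewrite ge_min lexx orbT.
have bc : b < c by rewrite /c; lra.
have ca0 : 0 < c - a by lra.
pose s := e / (c - a).
have s0 : 0 < s by rewrite divr_gt0.
have s1 : s <= 1 by rewrite ler_pdivrMr// mul1r.
exists (s * (c - b)); first by rewrite mulr_gt0//; lra.
move=> x xab; have x01 : 0 < x < 1 by lra.
apply: lb_le_inf.
  by eexists; eexists; [apply: (@explicit_upper_barrier 1 x) => //; lra|].
move=> _ [u [cu pu [S' su]] <-].
suff : s * (c - x) <= u x by nra.
rewrite leNgt; apply/negP => ux.
have : s * (c - x) - u x <= s * (c - c) - u c.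
  apply: (@ndecr_while_pos R (fun x => s * (c - x) - u x) x c S') => //; first lra.
  - move=> z zx; apply: cvgB; last by apply: cu; rewrite /c in zx *; lra.
    by apply: cvgM; [exact: cvg_cst|apply: cvgB; [exact: cvg_cst|exact: cvg_id]].
  - move=> z zx zS ez; have z1 : x < z < 1 by rewrite /c in zx *; lra.
    have [D uD DF] := su _ z1 zS.
    exists (- s - D).
      by apply: is_derive_eq; rewrite /GRing.scale/=; ring.
    have uz : 0 < u z by apply: pu; lra.
    have uze : u z <= d.
      have : s * (c - z) <= s * (c - a) by rewrite ler_wpM2l ?ltW//; lra.
      have -> : s * (c - a) = e by rewrite /s divfK// gt_eqF.
      by lra.
    have z01 : 0 < z < 1 by lra.
    have : M + 1 <= k z * phi (u z).
      apply: (@le_trans _ _ (m * ((M + 1) / m))); first by rewrite mulrC divfK// gt_eqF.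
      apply: ler_pM; [lra| |apply: mk; rewrite /c in zx *; lra|exact: dphi].
      by rewrite divr_ge0 ?ltW//; have := bound_ge0; lra.
    by have := q_bnd z01; rewrite ler_norml; move: DF; rewrite /rate_field; lra.
  - by lra.
have : 0 < u c by apply: pu; rewrite /c; lra.
by rewrite subrr mulr0; lra.
Qed.

Lemma perron_pos x : 0 < x < 1 -> 0 < perron x.
Proof.
move=> x01; have [|||d d0 dP] := @perron_gt0 x ((x + 1) / 2); [lra..|].
by apply: lt_le_trans d0 _; apply: dP; lra.
Qed.

(* the infimum is from now on accessed through its properties only *)
Local Opaque perron.

(** A nearly optimal competitor at x2 can be continued to the left of x2 by a line
    of slope sig, as long as sig is at most the rate field along that line; its
    value at x1 then bounds the infimum there. *)
Lemma perron_slope_ge x1 x2 sig tau : 0 < x1 -> x1 < x2 -> x2 < 1 -> 0 < tau ->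
  (forall y x, perron x2 <= y <= perron x2 + tau -> x1 <= x <= x2 ->
     0 < y + sig * (x - x2) /\
     (x \notin S -> sig <= rate_field x (y + sig * (x - x2)))) ->
  sig * (x2 - x1) <= perron x2 - perron x1.
Proof.
move=> x10 x12 x21 t0 H.
suff : forall e : R, 0 < e -> e <= tau -> perron x1 <= perron x2 + e + sig * (x1 - x2).
  move=> He; rewrite leNgt; apply/negP => ns.
  pose e := Num.min tau ((sig * (x2 - x1) - (perron x2 - perron x1)) / 2).
  have e0 : 0 < e by rewrite lt_min t0/=; lra.
  have e1 : e <= (sig * (x2 - x1) - (perron x2 - perron x1)) / 2 by rewrite ge_min lexx orbT.
  by have := He e e0; rewrite ge_min lexx => /(_ isT); lra.
move=> e e0 et.
have [||u su ue] := @perron_near_opt x2 e; [lra|by []|].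
have pu := perron_le x21 su.
have sg : upper_barrier x1 (fun x => if x <= x2 then u x2 + sig * (x - x2) else u x).
  apply: upper_barrier_glue => //.
  - move=> x x01; apply: cvgD; first exact: cvg_cst.
    by apply: cvgM; [exact: cvg_cst|apply: cvgB; [exact: cvg_id|exact: cvg_cst]].
  - by rewrite subrr mulr0 addr0.
  - by move=> x x12'; have [] := H (u x2) x _ x12'; [lra|].
  - move=> x x12' xS; exists sig.
      by apply: is_derive_eq; rewrite /GRing.scale/=; ring.
    by have [||_] := H (u x2) x; [lra|lra|exact].
have := perron_le _ sg; rewrite (ltW x12) => /(_ _)/wrap[|]; first lra.
lra.
Qed.

Lemma perron_slope_le_M x1 x2 : 0 < x1 -> x1 <= x2 -> x2 < 1 ->
  perron x2 - perron x1 <= M * (x2 - x1).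
Proof.
move=> x10 x12 x21; apply/ler_addgt0Pr => e e0.
have [||u su ue] := @perron_near_opt x1 e; [lra|by []|].
have := perron_le x21 (upper_barrier_sub x12 su).
have [cu pu [s du]] := su.
suff : u x2 - u x1 <= M * (x2 - x1) by lra.
apply: (@mvt_le_off R u x1 x2 M s) => // x x12'; first by apply: cu; lra.
move=> xs; have [|d ud dF] := du x _ xs; first lra.
exists d => //; apply: le_trans dF _; apply: rate_field_le; first lra.
by apply: pu; lra.
Qed.

(** A nearly optimal competitor at x1 climbs by at most M (x2 - x1) on [x1, x2].
    If the rate field is at most sig below that height, then sig also bounds the
    slope of the competitor, whose value at x2 bounds the infimum there. *)
Lemma perron_slope_le x1 x2 sig tau : 0 < x1 -> x1 <= x2 -> x2 < 1 -> 0 < tau ->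
  (forall y x, 0 < y -> y <= perron x1 + tau + M * (x2 - x1) ->
     x1 <= x <= x2 -> x \notin S -> rate_field x y <= sig) ->
  perron x2 - perron x1 <= sig * (x2 - x1).
Proof.
move=> x10 x12 x21 t0 H; apply/ler_addgt0Pr => e' e'0.
pose e := Num.min tau e'.
have e0 : 0 < e by rewrite lt_min t0 e'0.
have et : e <= tau by rewrite ge_min lexx.
have ee' : e <= e' by rewrite ge_min lexx orbT.
have [||u su ue] := @perron_near_opt x1 e; [lra|by []|].
have := perron_le x21 (upper_barrier_sub x12 su).
have [cu pu [s du]] := su.
suff : u x2 - u x1 <= sig * (x2 - x1) by lra.
apply: (@mvt_le_off R u x1 x2 sig (S ++ s)) => // x x12'; first by apply: cu; lra.
rewrite mem_cat negb_or => /andP[xS xs].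
have [|d ud dF] := du x _ xs; first lra.
exists d => //; apply: le_trans dF _; apply: H => //; [apply: pu; lra| |lra].
have x1x : x1 <= x by lra.
have : u x - u x1 <= M * (x - x1).
  apply: (@mvt_le_off R u x1 x M s) => // z zx; first by apply: cu; lra.
  move=> zs; have [|d' ud' dF'] := du z _ zs; first lra.
  exists d' => //; apply: le_trans dF' _; apply: rate_field_le; first lra.
  by apply: pu; lra.
have : M * (x - x1) <= M * (x2 - x1) by rewrite ler_wpM2l ?bound_ge0//; lra.
by lra.
Qed.


(** On compact intervals all slopes lie between - L and M. *)
Lemma perron_continuous x : 0 < x < 1 -> {for x, continuous perron}.
Proof.
move=> x01; pose a := x / 2; pose b := (x + 1) / 2.
have [a0 ab b1] : [/\ 0 < a, a < b & b < 1] by rewrite /a /b; split; lra.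
have [d d0 dP] := perron_gt0 a0 ab b1.
have [C kC] := k_ub a0 ab b1.
have pd := phi_gt0 d0.
pose L := M + `|C| * phi d.
have L0 : 0 <= L by rewrite addr_ge0 ?bound_ge0// mulr_ge0// ltW.
have slope x1 x2 : a <= x1 -> x1 <= x2 -> x2 <= b ->
    `|perron x2 - perron x1| <= L * (x2 - x1).
  move=> ax1 x12 x2b; rewrite ler_norml; apply/andP; split; last first.
    apply: (@le_trans _ _ (M * (x2 - x1))); first by apply: perron_slope_le_M; lra.
    rewrite ler_wpM2r//; first lra.
    by rewrite /L lerDl mulr_ge0// ltW.
  have [->|x12'] := eqVneq x1 x2; first by rewrite !subrr mulr0 oppr0.
  have {}x12' : x1 < x2 by rewrite lt_neqAle x12' x12.
  rewrite -mulNr; apply: (@perron_slope_ge x1 x2 (- L) 1) => //; [lra|lra|].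
  move=> y z yx2 zx.
  have dy : d <= y by apply: le_trans (dP x2 _) _; lra.
  have dyz : d <= y + - L * (z - x2) by nra.
  split; first lra.
  move=> _; have z01 : 0 < z < 1 by lra.
  have kz : k z <= `|C| by apply: le_trans (kC z _) (ler_norm C); lra.
  have : k z * phi (y + - L * (z - x2)) <= `|C| * phi d.
    apply: ler_pM => //; [exact: k_ge0|apply/ltW/phi_gt0; lra|exact: phi_nincr].
  by have := q_bnd z01; rewrite ler_norml /rate_field /L; lra.
have {x01} xab : a < x < b by rewrite /a /b; lra.
clearbody L a b.
apply/cvgrPdist_lt => e e0; near=> t.
have taxb : a <= t <= b.
  by apply/andP; split; apply: ltW; near: t; [apply: lt_nbhsr|apply: lt_nbhsl]; case/andP: xab.
have tx : `|x - t| < e / (L + 1).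
  by near: t; apply: cvgr_dist_lt => //; rewrite divr_gt0// ltr_pwDr.
apply: (@le_lt_trans _ _ (L * `|x - t|)).
  have [xt|tx'] := leP x t.
    by rewrite distrC [`|x - t|]distrC [`|t - x|]ger0_norm ?subr_ge0//; apply: slope; lra.
  by rewrite (@gtr0_norm _ (x - t)) ?subr_gt0//; apply: slope; lra.
apply: (@le_lt_trans _ _ ((L + 1) * `|x - t|)); first by rewrite ler_wpM2r//; lra.
by rewrite mulrC -ltr_pdivlMr ?ltr_pwDr.
Unshelve. all: by end_near. Qed.

(** Near x the rate field is within e of its value F0 at the point reached by the
    infimum, so the two slope estimates apply with slopes F0 - e and F0 + e. *)
Lemma perron_derive x : 0 < x < 1 -> x \notin S ->
  is_derive x 1 perron (rate_field x (perron x)).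
Proof.
move=> x01 xS; set F0 := rate_field x (perron x).
have p0 := perron_pos x01.
apply: is_derive_slopes => e e0.
have [d1' d1'0 Fd] := rate_field_cont x01 xS p0 e0.
pose d1 := Num.min d1' (perron x).
have d10 : 0 < d1 by rewrite lt_min d1'0.
have d1d1' : d1 <= d1' by rewrite ge_min lexx.
have d1p : d1 <= perron x by rewrite ge_min lexx orbT.
have {Fd d1'0 d1d1'} Fd x' y' : `|x' - x| < d1 -> `|y' - perron x| < d1 ->
    `|rate_field x' y' - F0| < e.
  by move=> ? ?; apply: Fd; lra.
clearbody F0 d1; have d14 : 0 < d1 / 4 by lra.
have [d2 d20 pd2] := continuous_eps (perron_continuous x01) d14.
(* B bounds all slopes involved, and moving by d along a slope B stays within d1 / 8 *)
pose B := `|F0| + e + M + 1.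
have B0 : 0 < B by rewrite /B; have := normr_ge0 F0; have := bound_ge0; lra.
pose d := Num.min (Num.min d1 d2) (Num.min (Num.min x (1 - x)) (d1 / (8 * B))).
have d0 : 0 < d.
  have q1 : 0 < d1 / (8 * B) by rewrite divr_gt0// mulr_gt0.
  have [x0 x1] : 0 < x /\ 0 < 1 - x by split; lra.
  by rewrite /d; do !(rewrite lt_min; apply/andP; split).
have [dd1 dd2 [dx d1x dB]] :
    [/\ d <= d1, d <= d2 & [/\ d <= x, d <= 1 - x & d * (8 * B) <= d1]].
  by rewrite -ler_pdivlMr ?mulr_gt0//; split; [..|split]; rewrite !ge_min lexx ?orbT.
clearbody d.
have close z : x - d < z < x + d -> - (d1 / 4) < perron z - perron x < d1 / 4.
  move=> zd; rewrite -ltr_norml; apply: pd2; apply: lt_le_trans dd2.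
  by rewrite ltr_norml; lra.
have small s t : `|s| <= B -> `|t| <= d -> - (d1 / 8) <= s * t <= d1 / 8.
  move=> sB td; rewrite -ler_norml normrM; apply: (@le_trans _ _ (B * d)); last lra.
  by apply: ler_pM.
have FB : `|F0 - e| <= B.
  by apply: le_trans (ler_normB _ _) _; rewrite (gtr0_norm e0) /B; have := bound_ge0; lra.
have MB : `|M| <= B.
  by rewrite (ger0_norm bound_ge0) /B; have := normr_ge0 F0; lra.
clear d2 d20 pd2 dd2 dB B0; clearbody B; clear d14.
have main x1 x2 : x - d < x1 -> x1 < x2 -> x2 < x + d -> x2 - x1 < d ->
    `|perron x2 - perron x1 - F0 * (x2 - x1)| <= e * (x2 - x1).
  move=> xx1 x12 x2x x21.
  have p1 := close x1 ltac:(lra); have p2 := close x2 ltac:(lra).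
  have [x10 x20] : 0 < x1 /\ x2 < 1 by split; lra.
  clear close; have lo : (F0 - e) * (x2 - x1) <= perron x2 - perron x1.
    apply: (@perron_slope_ge x1 x2 (F0 - e) (d1 / 4)) => //; first by rewrite divr_gt0.
    move=> y z yx2 zx.
    have zx2 : `|z - x2| <= d by rewrite ler_norml; lra.
    have sm := small _ _ FB zx2.
    split; first lra.
    move=> zS; have := Fd z (y + (F0 - e) * (z - x2)); rewrite !ltr_norml.
    have zd : - d1 < z - x < d1 by clear sm p1 p2 yx2; lra.
    have yd : - d1 < y + (F0 - e) * (z - x2) - perron x < d1.
      by clear zd zx zx2 p1 xx1 x2x dx d1x; lra.
    by move=> /(_ zd yd) /andP[+ _]; rewrite ltrBrDl => /ltW.
  have hi : perron x2 - perron x1 <= (F0 + e) * (x2 - x1).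
    clear lo; apply: (@perron_slope_le x1 x2 (F0 + e) (d1 / 4)) => //.
    - exact: ltW.
    - by rewrite divr_gt0.
    move=> y z y0 yM zx zS.
    have x21' : `|x2 - x1| <= d by rewrite ler_norml; lra.
    have sm := small _ _ MB x21'.
    apply: le_trans (rate_field_homo _ y0 yM) _; first lra.
    have := Fd z (perron x1 + d1 / 4 + M * (x2 - x1)); rewrite !ltr_norml.
    have zd : - d1 < z - x < d1 by clear sm p1 p2 yM; lra.
    have yd : - d1 < perron x1 + d1 / 4 + M * (x2 - x1) - perron x < d1.
      by clear zd zx p2 xx1 x2x dx d1x yM; lra.
    by move=> /(_ zd yd) /andP[_]; rewrite ltrBlDl => /ltW.
  by rewrite ler_norml; lra.
clear close small Fd; exists d => // h h0 hd; have [hp|hn] := ltP 0 h.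
  have := main x (x + h); rewrite (gtr0_norm hp) in hd *.
  have -> : x + h - x = h by ring.
  by move=> H; apply: H; lra.
have {}hn : h < 0 by rewrite lt_neqAle h0.
have := main (x + h) x; rewrite (ltr0_norm hn) in hd *.
have -> : x - (x + h) = - h by ring.
have -> : perron (x + h) - perron x - F0 * h =
  - (perron x - perron (x + h) - F0 * - h) by ring.
move=> H.
by rewrite normrN; apply: H; lra.
Qed.

Lemma perron_lim1 : perron x @[x --> 1^'-] --> 0.
Proof.
apply/cvgrPdist_le => e e0.
have e2 : 0 < e / 2 by lra.
have pe := phi_gt0 e2.
near=> x.
have x01 : 0 < x < 1.
  by apply/andP; split; near: x; [exact: nbhs_left_gt|exact: nbhs_left_lt].
rewrite sub0r normrN gtr0_norm ?perron_pos//.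
have := perron_le (proj2 (andP x01)) (explicit_upper_barrier e2 (proj1 (andP x01))).
move/le_trans; apply.
have : M * (1 - x) <= e / 4.
  have : (M + 1) * (1 - x) <= e / 4.
    rewrite mulrC -ler_pdivlMr; last by have := bound_ge0; lra.
    apply: ltW; near: x; apply: nbhs_left_ltBl; rewrite divr_gt0//; have := bound_ge0; lra.
  by have := bound_ge0; lra.
have : phi (e / 2) * (K1 - Kap x) <= e / 4.
  rewrite mulrC -ler_pdivlMr//.
  have : `|K1 - Kap x| <= e / 4 / phi (e / 2).
    by near: x; move/cvgrPdist_le : Kap_lim; apply; rewrite divr_gt0//; lra.
  by apply: le_trans; exact: ler_norm.
lra.
Unshelve. all: by end_near. Qed.

Theorem perron_orbit : exists y : R -> R,
  [/\ (forall x, 0 < x < 1 -> 0 < y x),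
      (forall x, 0 < x < 1 -> {for x, continuous y}),
      (forall x, 0 < x < 1 -> x \notin S -> is_derive x 1 y (rate_field x (y x))),
      y x @[x --> 1^'-] --> (0 : R)
    & forall u : R -> R, (forall x, 0 < x < 1 -> upper_barrier x u) ->
        forall x, 0 < x < 1 -> y x <= u x].
Proof.
exists perron; split; [exact: perron_pos|exact: perron_continuous
  |exact: perron_derive|exact: perron_lim1|].
by move=> u su x x01; apply: perron_le; [case/andP: x01|exact: su].
Qed.

End Perron.

(** * Oriented integrals *)

Section OrientedIntegral.
Variable R : realType.
Notation mu := (@lebesgue_measure R).
Implicit Types (F : R -> R) (a b c x y z m M : R).

Lemma bounded_integrable_itv F a b M : measurable_fun `[a, b] F ->
  (forall x, a <= x <= b -> `|F x| <= M) -> mu.-integrable `[a, b] (EFin \o F).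
Proof.
move=> mF FM; apply: measurable_bounded_integrable => //.
  by rewrite /= lebesgue_measure_itv/=; case: ifP => //; rewrite -EFinD ltry.
exists M; split; first exact: num_real.
move=> K MK x /=; rewrite in_itv/= => /FM FxM.
exact: le_trans FxM (ltW MK).
Qed.

Lemma oriented_intE F a b x y : mu.-integrable `[a, b] (EFin \o F) ->
  a <= x <= b -> a <= y <= b ->
  oriented_int F x y =
  \int[mu]_(t in `[a, y]) F t - \int[mu]_(t in `[a, x]) F t.
Proof.
have main x' y' : mu.-integrable `[a, b] (EFin \o F) -> a <= x' -> y' <= b -> x' <= y' ->
    \int[mu]_(t in `[x', y']) F t =
    \int[mu]_(t in `[a, y']) F t - \int[mu]_(t in `[a, x']) F t.
  move=> iF ax yb xy; rewrite Rintegral_itvB ?bnd_simp//; last first.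
    by apply: integrableS iF => //; apply: subset_itvl; rewrite bnd_simp.
  rewrite Rintegral_itv_obnd_cbnd//; apply: integrableS iF => //.
  by apply: subset_itv; rewrite bnd_simp.
move=> iF /andP[ax xb] /andP[ay yb]; rewrite /oriented_int; case: ifPn => [xy|].
  exact: main.
by rewrite -ltNge => /ltW yx; rewrite main// opprB.
Qed.

Lemma oriented_int_chasles F a b x y z : mu.-integrable `[a, b] (EFin \o F) ->
  a <= x <= b -> a <= y <= b -> a <= z <= b ->
  oriented_int F x z = oriented_int F x y + oriented_int F y z.
Proof.
by move=> iF xab yab zab; rewrite !(oriented_intE iF)//; ring.
Qed.

Lemma oriented_int_continuous F a b c x : mu.-integrable `[a, b] (EFin \o F) ->
  a <= c <= b -> a < x < b -> {for x, continuous (oriented_int F c)}.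
Proof.
move=> iF cab /andP[ax xb]; have ab := lt_trans ax xb.
have := @parameterized_integral_continuous R a b F (ltW ab) iF.
move/(continuous_within_itvP _ ab) => [+ _ _].
move=> /(_ x); rewrite in_itv/= ax xb => /(_ isT) cP.
pose g t := parameterized_integral mu a t F - \int[mu]_(t in `[a, c]) F t.
have cg : g t @[t --> x] --> g x by apply: cvgB => //; exact: cvg_cst.
have gE t : a <= t <= b -> g t = oriented_int F c t.
  by move=> tab; rewrite (oriented_intE iF).
rewrite /prop_for/continuous_at -gE ?(ltW ax) ?(ltW xb)//.
apply: cvg_trans cg; apply: near_eq_cvg; near=> t; apply: gE.
by apply/andP; split; apply: ltW; near: t; [exact: lt_nbhsr|exact: lt_nbhsl].
Unshelve. all: by end_near. Qed.

Lemma oriented_int_derive F a b c x : mu.-integrable `[a, b] (EFin \o F) ->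
  a <= c <= b -> a < x < b -> {for x, continuous F} ->
  is_derive x 1 (oriented_int F c) (F x).
Proof.
move=> iF cab /andP[ax xb] cF; have ab := lt_trans ax xb.
have [dP PE] := @continuous_FTC1_closed R F a x b xb iF ax cF.
pose g t := parameterized_integral mu a t F - \int[mu]_(t in `[a, c]) F t.
have dg : is_derive x 1 g (F x).
  have dP' : is_derive x 1 (fun t => parameterized_integral mu a t F) (F x).
    by apply: (DeriveDef dP); rewrite -derive1E.
  by apply: is_derive_eq; rewrite subr0.
have gE t : a <= t <= b -> g t = oriented_int F c t.
  by move=> tab; rewrite (oriented_intE iF).
apply: near_eq_is_derive dg => //.
near=> t; apply: gE.
by apply/andP; split; apply: ltW; near: t; [exact: lt_nbhsr|exact: lt_nbhsl].
Unshelve. all: by end_near. Qed.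

Lemma oriented_int_ge F x y m : mu.-integrable `[x, y] (EFin \o F) ->
  x <= y -> (forall t, x <= t <= y -> m <= F t) ->
  m * (y - x) <= oriented_int F x y.
Proof.
move=> iF xy mF; rewrite /oriented_int xy.
have -> : m * (y - x) = \int[mu]_(t in `[x, y]) m.
  rewrite Rintegral_cst//= lebesgue_measure_itv/= lte_fin.
  by have [|yx|->] := ltgtP x y => //=; rewrite ?subrr//; move: xy; rewrite leNgt yx.
apply: le_Rintegral => //.
by apply: (@bounded_integrable_itv (fun=> m) x y `|m|).
Qed.

Lemma integrableN_EFin D F : measurable D -> mu.-integrable D (EFin \o F) ->
  mu.-integrable D (EFin \o (fun t => - F t)).
Proof. by move=> mD iF; apply: (integrableN iF). Qed.

Lemma oriented_intN F x y : mu.-integrable `[x, y] (EFin \o F) -> x <= y ->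
  oriented_int (fun t => - F t) x y = - oriented_int F x y.
Proof.
move=> iF xy; rewrite /oriented_int xy -mulN1r -RintegralZl//.
by apply: eq_Rintegral => t _; rewrite mulN1r.
Qed.

Lemma oriented_int_le F x y m : mu.-integrable `[x, y] (EFin \o F) ->
  x <= y -> (forall t, x <= t <= y -> F t <= m) ->
  oriented_int F x y <= m * (y - x).
Proof.
move=> iF xy mF; rewrite -lerN2 -oriented_intN// -mulNr; apply: oriented_int_ge => //.
  exact: integrableN_EFin.
by move=> t /mF; rewrite lerN2.
Qed.

Lemma oriented_int_refl F x : oriented_int F x x = 0.
Proof. by rewrite /oriented_int lexx set_itv1 Rintegral_set1. Qed.

(** Integrals do not see the endpoints, where F and G may differ. *)
Lemma eq_oriented_int F G a b x y :
  measurable_fun `]a, b[ F -> measurable_fun `]a, b[ G ->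
  (forall t, a < t < b -> F t = G t) ->
  a <= x <= b -> a <= y <= b -> oriented_int F x y = oriented_int G x y.
Proof.
move=> mF mG FG.
have main x' y' : a <= x' -> y' <= b ->
    \int[mu]_(t in `[x', y']) F t = \int[mu]_(t in `[x', y']) G t.
  move=> ax yb; have sub : `]x', y'[ `<=` `]a, b[.
    by apply: subset_itv; rewrite bnd_simp.
  rewrite /Rintegral; congr fine; apply: eq_integral_itv_bounded.
  - exact: measurable_funS sub mF.
  - exact: measurable_funS sub mG.
  - move=> t; rewrite in_itv/= => /andP[xt ty]; apply: FG.
    by rewrite (le_lt_trans ax xt) (lt_le_trans ty yb).
move=> /andP[ax xb] /andP[ay yb]; rewrite /oriented_int; case: ifPn => _.
  exact: main.
by rewrite main.
Qed.

End OrientedIntegral.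

Section BoundedIntegrand.
Variable R : realType.
Notation mu := (@lebesgue_measure R).
Variables (F : R -> R) (M : R).
Hypothesis F_meas : measurable_fun setT F.
Hypothesis F_bnd : forall x, `|F x| <= M.

Lemma bounded_integrable a b : mu.-integrable `[a, b] (EFin \o F).
Proof.
by apply: (@bounded_integrable_itv _ _ _ _ M) => //; exact: measurable_funS F_meas.
Qed.

Lemma oriented_intB x y :
  oriented_int F x y = oriented_int F 0 y - oriented_int F 0 x.
Proof.
pose m := Num.min 0 (Num.min x y); pose n := Num.max 0 (Num.max x y).
have := @oriented_int_chasles R F m n 0 x y (bounded_integrable m n).
have -> : m <= 0 <= n by rewrite /m /n ge_min le_max lexx.
have -> : m <= x <= n by rewrite /m /n !ge_min !le_max lexx !orbT.
have -> : m <= y <= n by rewrite /m /n !ge_min !le_max lexx !orbT.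
by move=> /(_ isT isT isT); lra.
Qed.

Lemma oriented_int_lip x y :
  `|oriented_int F 0 x - oriented_int F 0 y| <= M * `|x - y|.
Proof.
wlog xy : x y / y <= x.
  move=> H; have [|/ltW] := leP y x; first exact: H.
  by move=> /H; rewrite distrC [`|y - x|]distrC.
rewrite -oriented_intB (ger0_norm (_ : 0 <= x - y)) ?subr_ge0//.
rewrite ler_norml -mulNr; apply/andP; split.
  apply: oriented_int_ge => //; first exact: bounded_integrable.
  by move=> t _; have := F_bnd t; rewrite ler_norml => /andP[].
apply: oriented_int_le => //; first exact: bounded_integrable.
by move=> t _; have := F_bnd t; rewrite ler_norml => /andP[].
Qed.

Let enclosing (x : R) : Num.min 0 (x - 1) < x < Num.max 0 (x + 1).
Proof. by rewrite gt_min lt_max; apply/andP; split; apply/orP; right; lra. Qed.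

Let enclosing0 (x : R) : Num.min 0 (x - 1) <= 0 <= Num.max 0 (x + 1).
Proof. by rewrite ge_min le_max lexx. Qed.

Lemma bounded_oriented_int_continuous : continuous (oriented_int F 0).
Proof.
move=> x; apply: oriented_int_continuous (enclosing0 x) (enclosing x).
exact: bounded_integrable.
Qed.

Lemma bounded_oriented_int_derive x : {for x, continuous F} ->
  is_derive x 1 (oriented_int F 0) (F x).
Proof.
apply: oriented_int_derive (enclosing0 x) (enclosing x).
exact: bounded_integrable.
Qed.

End BoundedIntegrand.

(** * Piecewise continuous coefficients *)

Section Coefficient.
Variable R : realType.
Notation mu := (@lebesgue_measure R).
Implicit Types (F : R -> R) (S : seq R) (a b c x y z m M : R).

Lemma measurable_off F S a b :
  (forall x, a < x < b -> x \notin S -> {for x, continuous F}) ->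
  measurable_fun `]a, b[ F.
Proof.
elim: S a b => [|s S IH] a b cF.
  apply: subspace_continuous_measurable_fun => //.
  apply: continuous_in_subspaceT => x; rewrite inE/= in_itv/= => xab.
  exact: cF.
have [/andP[as_ sb]|nsab] := boolP (a < s < b); last first.
  apply: IH => x xab xS; apply: cF => //; rewrite inE negb_or xS andbT.
  by apply: contraNneq nsab => <-.
have mE : measurable_fun (`]a, s[ `|` ([set s] `|` `]s, b[)) F.
  apply/measurable_funU => //; first exact: measurableU.
  split.
    apply: IH => x xas xS; apply: cF; first lra.
    by rewrite inE negb_or xS andbT; apply/eqP; lra.
  apply/measurable_funU => //; split; first exact: measurable_fun_set1.
  apply: IH => x xas xS; apply: cF; first lra.
  by rewrite inE negb_or xS andbT; apply/eqP; lra.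
apply: measurable_funS mE => //.
  by apply: measurableU => //; exact: measurableU.
move=> x /=; rewrite !in_itv/= => /andP[ax xb].
have [xs|xs|->] := ltgtP x s; [left|right; right|by right; left].
- by rewrite ax.
- by rewrite xb.
Qed.

Lemma seq_bounded F S : exists M, forall x, x \in S -> `|F x| <= M.
Proof.
elim: S => [|s S [M FM]]; first by exists 0.
exists (Num.max `|F s| M) => x; rewrite inE => /orP[/eqP->|/FM FxM].
  by rewrite le_max lexx.
by rewrite le_max FxM orbT.
Qed.

Lemma discont_seq F : Chat_open F ->
  exists S, forall x, discont F x <-> x \in S.
Proof.
by move=> [/finite_seqP[S SE] _]; exists S => x; rewrite SE.
Qed.

(** The essential bound holds at every point of continuity, since exceeding it
    there means exceeding it on an interval. The other points are finitely many. *)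
Lemma bounded_coeff_le F : Chat_closed F -> bounded_coeff F ->
  exists M, forall x, 0 < x < 1 -> `|F x| <= M.
Proof.
move=> [/discont_seq[S SE] _ _].
rewrite /bounded_coeff => /sub_Lfun_finLfun; rewrite inE/= /finite_norm unlock /=.
have -> : (0 < lebesgue_measure [set: R])%E.
  have : (lebesgue_measure (`[0%R, 1%R] : set R) <= lebesgue_measure [set: R])%E.
    by apply: le_measure => //; rewrite inE.
  by apply: lt_le_trans; rewrite lebesgue_measure_itv/= lte_fin ltr01 sube0 lte_fin.
move/ess_supr_bounded => [M [N [mN N0 NM]]].
have off x : 0 < x < 1 -> x \notin S -> `|F x| <= M.
  move=> x01 xS; rewrite leNgt; apply/negP => Mx.
  have cF : {for x, continuous F}.
    apply: contrapT => ncF; move/negP : xS; apply; apply/SE; split=> //.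
  have cG : {for x, continuous (fun t => `|F t| - M)}.
    apply: cvgB; last exact: cvg_cst.
    by apply: cvg_norm; exact: cF.
  have [|del d0 dP] := continuous_gt0 cG; first by rewrite subr_gt0.
  pose e := Num.min del (Num.min x (1 - x)).
  have e0 : 0 < e by rewrite !lt_min d0; lra.
  have [ed ex ex1] : [/\ e <= del, e <= x & e <= 1 - x].
    by split; rewrite /e !ge_min lexx ?orbT.
  have : (lebesgue_measure (`](x - e)%R, (x + e)%R[ : set R) <= lebesgue_measure N)%E.
    apply: le_measure; rewrite ?inE//.
    move=> t; rewrite /= in_itv/= => te; apply: NM => /=.
    rewrite patchE mem_set/=; last by rewrite in_itv/=; lra.
    apply/negP; rewrite -ltNge -subr_gt0; apply: dP.
    by rewrite ltr_norml; lra.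
  rewrite N0 lebesgue_measure_itv/= lte_fin ifT; last by lra.
  by rewrite -EFinD lee_fin; lra.
have [M' M'P] := seq_bounded F S.
exists (Num.max M M') => x x01; rewrite le_max.
by have [/M'P ->|/(off _ x01) ->] := boolP (x \in S); rewrite ?orbT.
Qed.

Lemma bounded_coeff_measurable F : bounded_coeff F ->
  measurable_fun setT (F \_ `]0, 1[).
Proof. by move=> /sub_Lfun_mfun; rewrite inE. Qed.

Lemma patch_oo F x : 0 < x < 1 -> (F \_ `]0, 1[) x = F x.
Proof. by move=> x01; rewrite patchE mem_set//= in_itv/=. Qed.

Lemma patch_oo_continuous F x : 0 < x < 1 ->
  {for x, continuous F} -> {for x, continuous (F \_ `]0, 1[)}.
Proof.
move=> x01 cF; rewrite /prop_for/continuous_at patch_oo//.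
apply: cvg_trans cF; apply: near_eq_cvg; near=> t.
rewrite patch_oo//; apply/andP; split; near: t.
  by apply: lt_nbhsr; lra.
by apply: lt_nbhsl; lra.
Unshelve. all: by end_near. Qed.

Lemma locally_posP F a b : locally_pos F -> 0 < a -> a < b -> b < 1 ->
  exists2 m : R, 0 < m & forall x, a <= x <= b -> m <= F x.
Proof.
move=> lF a0 ab b1; have := lF a b a0 ab b1.
have lb x : a <= x <= b -> (ereal_inf [set (F x)%:E | x in `[a, b]] <= (F x)%:E)%E.
  by move=> xab; apply: ereal_inf_lbound; exists x => //=; rewrite in_itv.
case E: ereal_inf lb => [m| |] lb //.
  by rewrite lte_fin => m0; exists m => // x /lb; rewrite lee_fin.
by move=> _; exists 1 => // x /lb.
Qed.

Lemma locally_bnd_aboveP F a b : locally_bnd_above F -> 0 < a -> a < b -> b < 1 ->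
  exists m : R, forall x, a <= x <= b -> F x <= m.
Proof.
move=> lF a0 ab b1; have := lF a b a0 ab b1.
have ub x : a <= x <= b -> ((F x)%:E <= ereal_sup [set (F x)%:E | x in `[a, b]])%E.
  by move=> xab; apply: ereal_sup_ubound; exists x => //=; rewrite in_itv.
case E: ereal_sup ub => [m| |] ub //.
  by move=> _; exists m => // x /ub; rewrite lee_fin.
by move=> _; exists 1 => // x /ub.
Qed.

Lemma locally_pos_gt0 F x : locally_pos F -> 0 < x < 1 -> 0 < F x.
Proof.
move=> lF x01; have [|||m m0 mF] := @locally_posP F (x / 2) x lF; [lra..|].
by apply: lt_le_trans m0 _; apply: mF; lra.
Qed.

End Coefficient.

(** * From a wave to its orbit *)

Section Flux.
Variable R : realType.
Variable p : R.
Hypothesis p_gt1 : 1 < p.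
Implicit Types D P w Y : R.

Lemma flux_absE D w P : P = D * `|w| `^ (p - 2) * w -> 0 < D ->
  `|P| = D * `|w| `^ (p - 1).
Proof.
move=> -> D0; rewrite !normrM (gtr0_norm D0) (ger0_norm (powR_ge0 _ _)) -mulrA.
congr (_ * _); rewrite mulrC.
by rewrite -[RHS]mulr_powRB1//; [congr (_ * _ `^ _); ring|have := p_gt1; lra].
Qed.

Lemma flux_le0 D w P : P = D * `|w| `^ (p - 2) * w -> 0 < D -> P <= 0 -> w <= 0.
Proof.
move=> -> D0 P0; rewrite leNgt; apply/negP => w0; move: P0; rewrite leNgt.
by rewrite mulr_gt0// mulr_gt0// powR_gt0// normr_gt0 gt_eqF.
Qed.

Lemma flux_ge0 D w P : P = D * `|w| `^ (p - 2) * w -> 0 < D -> 0 <= P -> 0 <= w.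
Proof.
move=> -> D0 P0; rewrite leNgt; apply/negP => w0; move: P0; rewrite leNgt.
by rewrite nmulr_llt0// mulr_gt0// powR_gt0// normr_gt0 lt_eqF.
Qed.

Lemma powRK_p1 x : 0 <= x -> (x `^ (p - 1)) `^ (1 / (p - 1)) = x.
Proof.
by move=> x0; rewrite -powRrM mulrC divfK ?powRr1// subr_eq0 gt_eqF.
Qed.

Lemma powRK_p1V x : 0 <= x -> (x `^ (1 / (p - 1))) `^ (p - 1) = x.
Proof.
by move=> x0; rewrite -powRrM divfK ?powRr1// subr_eq0 gt_eqF.
Qed.

Lemma powRV (x r : R) : 0 <= x -> x^-1 `^ r = (x `^ r)^-1.
Proof. by move=> x0; rewrite -powR_inv1// powRAC powR_inv1// powR_ge0. Qed.

Lemma flux_speed D w P : P = D * `|w| `^ (p - 2) * w -> 0 < D -> P <= 0 ->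
  w = - ((- P) / D) `^ (1 / (p - 1)).
Proof.
move=> PE D0 P0; have w0 := flux_le0 PE D0 P0; have := flux_absE PE D0.
rewrite (ler0_norm P0) => ->; rewrite mulrC mulKf ?gt_eqF//.
by rewrite powRK_p1// ler0_norm// opprK.
Qed.

Lemma flux_of_speed D Y : 0 < D -> 0 <= Y ->
  let w := - (Y / D) `^ (1 / (p - 1)) in - Y = D * `|w| `^ (p - 2) * w.
Proof.
move=> D0 Y0 w; have w0 : w <= 0 by rewrite oppr_le0 powR_ge0.
have YD : 0 <= Y / D by rewrite divr_ge0// ltW.
have : `|w| * `|w| `^ (p - 2) = Y / D.
  rewrite /w normrN ger0_norm ?powR_ge0//.
  have -> : p - 2 = p - 1 - 1 by ring.
  by rewrite mulr_powRB1 ?powR_ge0 ?powRK_p1V//; have := p_gt1; lra.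
rewrite {1}(ler0_norm w0) mulNr => H.
by rewrite -mulrA [_ `^ _ * w]mulrC -[w * _]opprK H mulrN mulrC divfK ?gt_eqF.
Qed.

Lemma flux_small D w P eps : P = D * `|w| `^ (p - 2) * w -> 0 < D -> 0 < eps ->
  `|P| <= D * eps `^ (p - 1) -> `|w| <= eps.
Proof.
move=> PE D0 e0; rewrite (flux_absE PE D0) ler_pM2l// => H.
rewrite leNgt; apply/negP => ew; move: H; rewrite leNgt.
by rewrite gt0_ltr_powR// ?nnegrE ?ltW//; have := p_gt1; lra.
Qed.

End Flux.

Section Coefs.
Variable R : realType.
Notation mu := (@lebesgue_measure R).

(** What the orbit of a solution depends on. The flux identity is required only
    where v avoids the exceptional values S; the vanishing of the flux on plateaus
    is listed separately because a plateau may lie at such a value. *)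
Definition wave (p : R) (q h d : R -> R) (S : seq R) (v Phi : R -> R) :=
  [/\ continuous v /\ (forall z, 0 <= v z <= 1),
      v z @[z --> -oo] --> (1 : R) /\ v z @[z --> +oo] --> (0 : R),
      continuous Phi /\ (forall z, v z = 0 \/ v z = 1 -> Phi z = 0),
      Phi z @[z --> -oo] --> (0 : R) /\ Phi z @[z --> +oo] --> (0 : R)
    & [/\ (forall z, 0 < v z < 1 -> v z \notin S -> derivable v z 1 /\
         Phi z = d (v z) * `|derive1 v z| `^ (p - 2) * derive1 v z),
       (forall a b c, (forall z, a < z < b -> v z = c) ->
          forall z, a < z < b -> Phi z = 0)
     & (forall z1 z2, Phi z2 - Phi z1 + oriented_int q (v z1) (v z2)
         + oriented_int (h \o v) z1 z2 = 0)]].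

Variables (p M : R) (q h d : R -> R) (S : seq R).
Hypothesis p_gt1 : 1 < p.
Hypothesis M_ge0 : 0 <= M.
Hypothesis q_meas : measurable_fun setT q.
Hypothesis q_bnd : forall x, `|q x| <= M.
Hypothesis h_meas : measurable_fun setT h.
Hypothesis h_bnd : forall x, `|h x| <= M.
Hypothesis h_ge0 : forall x, 0 <= h x.
Hypothesis h_lb : forall a b : R, 0 < a -> a < b -> b < 1 ->
  exists2 m : R, 0 < m & forall x, a <= x <= b -> m <= h x.
Hypothesis d_lb : forall a b : R, 0 < a -> a < b -> b < 1 ->
  exists2 m : R, 0 < m & forall x, a <= x <= b -> m <= d x.
Hypothesis q_cont : forall x, 0 < x < 1 -> x \notin S -> {for x, continuous q}.
Hypothesis h_cont : forall x, 0 < x < 1 -> x \notin S -> {for x, continuous h}.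

Let Q := oriented_int q 0.

Variables v Phi : R -> R.
Hypothesis vP : wave p q h d S v Phi.

Let v_cont : continuous v. Proof. by have [[]] := vP. Qed.
Let v01 z : 0 <= v z <= 1. Proof. by have [[]] := vP. Qed.
Let v_ny : v z @[z --> -oo] --> (1 : R). Proof. by have [? []] := vP. Qed.
Let v_y : v z @[z --> +oo] --> (0 : R). Proof. by have [? []] := vP. Qed.
Let Phi_cont : continuous Phi. Proof. by have [? ? []] := vP. Qed.
Let Phi_end z : v z = 0 \/ v z = 1 -> Phi z = 0. Proof. by have [? ? []] := vP; auto. Qed.
Let Phi_ny : Phi z @[z --> -oo] --> (0 : R). Proof. by have [? ? ? []] := vP. Qed.
Let Phi_y : Phi z @[z --> +oo] --> (0 : R). Proof. by have [? ? ? []] := vP. Qed.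
Let v_flux z : 0 < v z < 1 -> v z \notin S -> derivable v z 1 /\
   Phi z = d (v z) * `|derive1 v z| `^ (p - 2) * derive1 v z.
Proof. by have [? ? ? ? []] := vP; auto. Qed.
Let law z1 z2 : Phi z2 - Phi z1 + (Q (v z2) - Q (v z1)) + oriented_int (h \o v) z1 z2 = 0.
Proof. by rewrite -(oriented_intB q_meas q_bnd); have [? ? ? ? []] := vP; auto. Qed.

Let hv_int a b : mu.-integrable `[a, b] (EFin \o (h \o v)).
Proof.
apply: (@bounded_integrable _ _ M) => [|z]; last exact: h_bnd.
by apply: measurableT_comp => //; exact: continuous_measurable_fun.
Qed.

Let Q_0 : Q 0 = 0. Proof. exact: oriented_int_refl. Qed.

Let energy z := Phi z + Q (v z).

(** The integral law says that this energy decreases at the rate h (v z). *)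
Lemma energy_nincr z1 z2 : z1 <= z2 -> energy z2 <= energy z1.
Proof.
move=> z12; have := law z1 z2.
have := @oriented_int_ge R (h \o v) z1 z2 0 (hv_int z1 z2) z12.
by rewrite mul0r /energy => /(_ (fun _ _ => h_ge0 _)); lra.
Qed.

Lemma diffusion_gt0 x : 0 < x < 1 -> 0 < d x.
Proof.
move=> x01; have [|||m m0 mP] := @d_lb (x / 2) x; [lra..|].
by apply: lt_le_trans m0 (mP _ _); lra.
Qed.

Lemma wave_near z0 : 0 < v z0 < 1 -> exists a b, [/\ 0 < a, a < b, b < 1 &
  exists2 del : R, 0 < del & forall z, `|z - z0| < del -> a <= v z <= b].
Proof.
move=> vz; pose e := Num.min (v z0 / 2) ((1 - v z0) / 2).
have e0 : 0 < e by rewrite lt_min; lra.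
have [e1 e2] : e <= v z0 / 2 /\ e <= (1 - v z0) / 2.
  by split; rewrite /e ge_min lexx ?orbT.
exists (v z0 - e), (v z0 + e); split; [lra|lra|lra|].
have [del d0 dP] := continuous_eps (@v_cont z0) e0.
by exists del => // z /dP; rewrite ltr_norml; lra.
Qed.

Lemma energy_slope z0 : 0 < v z0 < 1 -> exists m del : R, [/\ 0 < m, 0 < del &
  forall z1 z2, z0 - del < z1 -> z1 <= z2 -> z2 < z0 + del ->
    energy z2 - energy z1 <= - m * (z2 - z1)].
Proof.
move=> /wave_near[a [b [a0 ab b1 [del del0 dP]]]].
have [m m0 mP] := h_lb a0 ab b1.
exists m, del; split=> // z1 z2 z1z z12 z2z.
have := @oriented_int_ge R (h \o v) z1 z2 m (hv_int z1 z2) z12.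
have H t : z1 <= t <= z2 -> m <= (h \o v) t.
  by move=> tz; apply: mP; apply: dP; rewrite ltr_norml; lra.
by move=> /(_ H); have := law z1 z2; rewrite /energy; lra.
Qed.

Lemma energy_decr z0 : 0 < v z0 < 1 -> forall z1 z2, z1 <= z0 -> z0 < z2 -> energy z2 < energy z1.
Proof.
move=> vz z1 z2 z10 z02; have [m [del [m0 d0 dP]]] := energy_slope vz.
pose z3 := Num.min z2 (z0 + del / 2).
have [z3a z3b z3c] : [/\ z3 <= z2, z3 <= z0 + del / 2 & z0 < z3].
  by split; rewrite /z3 ?ge_min ?lexx ?orbT// lt_min z02; lra.
clearbody z3.
apply: (le_lt_trans (energy_nincr z3a)); apply: (lt_le_trans _ (energy_nincr z10)).
have z0d : z0 - del < z0 by rewrite ltrBlDr ltrDl.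
have z3d : z3 < z0 + del by lra.
rewrite -subr_lt0; apply: le_lt_trans (dP _ _ z0d (ltW z3c) z3d) _.
by rewrite mulNr oppr_lt0 mulr_gt0// subr_gt0.
Qed.

Let nS x : 0 <= x <= 1 -> x \notin 0 :: 1 :: S -> 0 < x < 1 /\ x \notin S.
Proof.
move=> x01; rewrite !inE !negb_or => /and3P[x0 x1 xS]; split=> //.
by rewrite !lt_neqAle x1 eq_sym x0.
Qed.

Lemma wave_ndecr_on a b : a <= b -> (forall z, a < z < b -> 0 <= Phi z) -> v a <= v b.
Proof.
move=> ab Phi0; rewrite -subr_ge0 -[0](mul0r (b - a)) -[X in X * _]oppr0.
apply: (@mvt_ge_preim R v a b 0 (0 :: 1 :: S)) => // [z _|z zab /(nS (v01 z))[z01 zS]].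
  exact: v_cont.
have [dv PE] := v_flux z01 zS; exists (derive1 v z).
  by rewrite derive1E; apply: derivableP.
by rewrite oppr0; apply: flux_ge0 PE (diffusion_gt0 z01) _; exact: Phi0.
Qed.

Lemma wave_nincr_on a b : a <= b -> (forall z, a < z < b -> Phi z <= 0) -> v b <= v a.
Proof.
move=> ab Phi0; rewrite -subr_le0 -[0](mul0r (b - a)).
apply: (@mvt_le_preim R v a b 0 (0 :: 1 :: S)) => // [z _|z zab /(nS (v01 z))[z01 zS]].
  exact: v_cont.
have [dv PE] := v_flux z01 zS; exists (derive1 v z).
  by rewrite derive1E; apply: derivableP.
by apply: flux_le0 PE (diffusion_gt0 z01) _; exact: Phi0.
Qed.

(** Near such a point the flux is small, hence so is the slope of v, and the term
    Q (v z) of the energy moves slower than the energy decreases. So the flux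
    itself decreases there. *)
Lemma wave_crossing z0 : 0 < v z0 < 1 -> Phi z0 = 0 ->
  exists2 del : R, 0 < del & forall z, (z0 < z < z0 + del -> Phi z < 0) /\
                                    (z0 - del < z < z0 -> 0 < Phi z).
Proof.
have M0 := M_ge0; move=> vz P0; have [m [d1 [m0 d10 Gd]]] := energy_slope vz.
have [a [b [a0 ab b1 [d2 d20 vab]]]] := wave_near vz.
have [dm dm0 dmP] := d_lb a0 ab b1.
(* with slopes of v below eps, Q (v z) varies at most at half the rate m *)
pose eps := m / (2 * (M + 1)).
have M1 : 0 < M + 1 by lra.
have eps0 : 0 < eps by rewrite divr_gt0// mulr_gt0.
have t0 : 0 < dm * eps `^ (p - 1) by rewrite mulr_gt0// powR_gt0.
have [d3 d30 Pd] := continuous_eps (@Phi_cont z0) t0.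
pose del := Num.min d1 (Num.min d2 d3).
have del0 : 0 < del by rewrite !lt_min d10 d20.
have [de1 de2 de3] : [/\ del <= d1, del <= d2 & del <= d3].
  by split; rewrite /del !ge_min lexx ?orbT.
have vlip z1 z2 : z0 - del < z1 -> z1 <= z2 -> z2 < z0 + del ->
    `|v z2 - v z1| <= eps * (z2 - z1).
  move=> za z12 zb.
  have dv z : z1 < z < z2 -> v z \notin 0 :: 1 :: S ->
      derivable v z 1 /\ `|derive1 v z| <= eps.
    move=> zz /(nS (v01 z))[z01 zS]; have [dvz PE] := v_flux z01 zS; split=> //.
    have zd : `|z - z0| < del by rewrite ltr_norml; lra.
    apply: flux_small PE (diffusion_gt0 z01) eps0 _ => //.
    have := Pd z (lt_le_trans zd de3); rewrite P0 subr0 => /ltW /le_trans; apply.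
    by rewrite ler_wpM2r ?powR_ge0//; apply: dmP; apply: vab; exact: lt_le_trans zd de2.
  have dv' z : z1 < z < z2 -> v z \notin 0 :: 1 :: S -> is_derive z 1 v (derive1 v z).
    by move=> zz zS; rewrite derive1E; apply: derivableP; have [] := dv z zz zS.
  rewrite ler_norml -mulNr; apply/andP; split.
    apply: (@mvt_ge_preim R v z1 z2 eps (0 :: 1 :: S)) => //; first exact: ltW.
      by move=> z _; exact: v_cont.
    move=> z zz zS; exists (derive1 v z); first exact: dv'.
    by have [_] := dv z zz zS; rewrite ler_norml => /andP[].
  apply: (@mvt_le_preim R v z1 z2 eps (0 :: 1 :: S)) => //; first exact: ltW.
    by move=> z _; exact: v_cont.
  move=> z zz zS; exists (derive1 v z); first exact: dv'.
  by have [_] := dv z zz zS; rewrite ler_norml => /andP[].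
have Phid z1 z2 : z0 - del < z1 -> z1 < z2 -> z2 < z0 + del -> Phi z2 < Phi z1.
  move=> za z12 zb; have := Gd z1 z2; rewrite /energy => H.
  have {}H : Phi z2 + Q (v z2) - (Phi z1 + Q (v z1)) <= - m * (z2 - z1).
    by apply: H; lra.
  have := oriented_int_lip q_meas q_bnd (v z2) (v z1).
  rewrite -/(Q (v z2)) -/(Q (v z1)) ler_norml => /andP[Ql _].
  have : M * `|v z2 - v z1| <= m / 2 * (z2 - z1).
    apply: (@le_trans _ _ ((M + 1) * (eps * (z2 - z1)))).
      apply: ler_pM => //; [lra|by apply: vlip => //; exact: ltW].
    rewrite mulrA ler_wpM2r//; first lra.
    rewrite /eps le_eqVlt; apply/orP; left; apply/eqP; field.
    by rewrite gt_eqF.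
  have : 0 < m * (z2 - z1) by rewrite mulr_gt0//; lra.
  by lra.
exists del => // z; split=> zz.
  by rewrite -P0; apply: Phid; lra.
by rewrite -P0; apply: Phid; lra.
Qed.


Let v_const a b c z : (forall t, a < t < b -> v t = c) -> a < z < b -> Phi z = 0.
Proof. by have [? ? ? ? [? H ?]] := vP; move=> /H; exact. Qed.

Lemma wave_flux_neq0 z : Phi z != 0 -> 0 < v z < 1.
Proof.
move=> P0; have := v01 z; rewrite !le_eqVlt => /andP[/orP[/eqP v0|->]].
  by move: P0; rewrite Phi_end ?eqxx//; left.
move=> /orP[/eqP v1|-> //].
by move: P0; rewrite Phi_end ?eqxx//; right.
Qed.

(** On a maximal interval (a, b) of positive flux v increases. It cannot start at a
    value in (0, 1), because the flux crosses 0 downwards there, so v a = 0 and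
    the energy is 0 at a. It is then negative at b, that is, Q (v b) < 0. But on
    its way down from 1 the wave already took the value v b (or approached it, if
    v b = 1) with an energy at least 0, that is, with a positive flux: it was
    increasing at its last passage through v b before a, which is absurd. *)
Lemma wave_flux_le0 z : Phi z <= 0.
Proof.
rewrite leNgt; apply/negP; move: z => z0 P0.
have vz0 : 0 < v z0 < 1 by apply: wave_flux_neq0; rewrite gt_eqF.
have [A Az PA] : exists2 A, A <= z0 & Phi A <= 0.
  apply: contrapT => H.
  have [|A AP] := @cvgNy_eps _ _ _ (1 - v z0) v_ny; first lra.
  pose A' := Num.min A z0.
  have [AA Az] : A' <= A /\ A' <= z0 by split; rewrite /A' ge_min lexx ?orbT.
  have := AP _ AA; have : v A' <= v z0.
    apply: wave_ndecr_on => // z zz; rewrite leNgt; apply/negP => Pz.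
    by apply: H; exists z; [lra|exact: ltW].
  by rewrite ltr_norml; lra.
have [B zB PB] : exists2 B, z0 <= B & Phi B <= 0.
  apply: contrapT => H.
  have [|A' AP] := @cvgy_eps _ _ _ (v z0) v_y; first lra.
  pose A'' := Num.max A' z0.
  have [AA Az'] : A' <= A'' /\ z0 <= A'' by split; rewrite /A'' le_max lexx ?orbT.
  have := AP _ AA; have : v z0 <= v A''.
    apply: wave_ndecr_on => // z zz; rewrite leNgt; apply/negP => Pz.
    by apply: H; exists z; [lra|exact: ltW].
  by rewrite ltr_norml; lra.
have [|a [/andP[_ az] Pa aP]] := @last_zero R Phi A z0 _ Az PA P0.
  by move=> *; exact: Phi_cont.
have [|b [/andP[zb _] Pb bP]] := @first_zero R Phi z0 B _ zB P0 PB.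
  by move=> *; exact: Phi_cont.
have vaz : v a <= v z0.
  by apply: wave_ndecr_on; [exact: ltW|move=> z zz; apply: ltW; apply: aP; lra].
have vzb : v z0 <= v b.
  by apply: wave_ndecr_on; [exact: ltW|move=> z zz; apply: ltW; apply: bP; lra].
have va0 : v a = 0.
  apply/eqP; rewrite eq_le (proj1 (andP (v01 a))) andbT leNgt; apply/negP => va.
  have [|del d0 dP] := @wave_crossing a _ Pa; first lra.
  pose z := Num.min (a + del / 2) z0.
  have [za1 za2 az'] : [/\ z <= a + del / 2, z <= z0 & a < z].
    by split; rewrite /z ?ge_min ?lexx ?orbT// lt_min az; lra.
  have [H _] := dP z; have := aP z az' za2.
  by rewrite ltNge ltW//; apply: H; lra.
have QB0 : Q (v b) < 0.
  by have := energy_decr vz0 (ltW az) zb; rewrite /energy Pa Pb va0 Q_0; lra.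
have Gpos z : z <= a -> - Q (v z) <= Phi z.
  by move=> /energy_nincr; rewrite /energy Pa va0 Q_0; lra.
have [[z' z'a vz']|nz] := pselect (exists2 z', z' <= a & v b <= v z').
  have ce z : z' <= z <= a -> {for z, continuous (fun z => v b - v z)}.
    by move=> _; apply: cvgB; [exact: cvg_cst|exact: v_cont].
  have [||z1 [/andP[_ z1a] vz1 z1P]] := last_zero ce z'a; [lra|by rewrite va0; lra|].
  have {}vz1 : v z1 = v b by lra.
  have P1 : 0 < Phi z1 by have := Gpos z1 (ltW z1a); rewrite vz1; lra.
  have [del d0 dP] := continuous_gt0 (@Phi_cont z1) P1.
  pose z := Num.min (z1 + del / 2) a.
  have [za1 za2 az'] : [/\ z <= z1 + del / 2, z <= a & z1 < z].
    by split; rewrite /z ?ge_min ?lexx ?orbT// lt_min z1a; lra.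
  have : v z1 <= v z.
    apply: wave_ndecr_on; [exact: ltW|move=> t tz; apply: ltW; apply: dP].
    by rewrite ltr_norml; lra.
  by have := z1P z az' za2; lra.
have vb1 : v b = 1.
  apply/eqP; rewrite eq_le (proj2 (andP (v01 b)))/= leNgt; apply/negP => vb.
  have [|A' AP] := @cvgNy_eps _ _ _ (1 - v b) v_ny; first lra.
  pose z := Num.min A' a.
  have [zA za] : z <= A' /\ z <= a by split; rewrite /z ge_min lexx ?orbT.
  by apply: nz; exists z => //; have := AP z zA; rewrite ltr_norml; lra.
have cQ : Q (v z) @[z --> -oo] --> Q 1.
  by apply: (cvg_comp _ _ v_ny); exact: (bounded_oriented_int_continuous q_meas q_bnd).
rewrite vb1 in QB0.
have [|A1 A1P] := @cvgNy_eps _ _ _ (- Q 1 / 2) cQ; first lra.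
have [|A2 A2P] := @cvgNy_eps _ _ _ (- Q 1 / 2) Phi_ny; first lra.
pose z := Num.min a (Num.min A1 A2).
have [za zA1 zA2] : [/\ z <= a, z <= A1 & z <= A2].
  by split; rewrite /z !ge_min lexx ?orbT.
by have := A1P z zA1; have := A2P z zA2; have := Gpos z za; rewrite !ltr_norml; lra.
Qed.

(** A zero of the flux would be preceded by points of positive flux. *)
Lemma wave_flux_lt0 z : 0 < v z < 1 -> Phi z < 0.
Proof.
move=> vz; rewrite lt_neqAle wave_flux_le0 andbT; apply/eqP => P0.
have [del d0 dP] := wave_crossing vz P0.
have [_ H] := dP (z - del / 2); have := wave_flux_le0 (z - del / 2).
by rewrite leNgt H//; lra.
Qed.

Lemma wave_nincr a b : a <= b -> v b <= v a.
Proof. by move=> ab; apply: wave_nincr_on => // z _; exact: wave_flux_le0. Qed.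

(** Otherwise v would have a plateau, on which the flux vanishes. *)
Lemma wave_decr a b : a < b -> 0 < v a < 1 -> v b < v a.
Proof.
move=> ab va; rewrite lt_neqAle wave_nincr ?ltW// andbT; apply/eqP => vab.
have vc z : a < z < b -> v z = v a.
  move=> /andP[/ltW az /ltW zb]; apply/eqP; rewrite eq_le wave_nincr//=.
  by rewrite -vab wave_nincr.
have := @wave_flux_lt0 ((a + b) / 2); rewrite vc; last lra.
by rewrite (v_const vc) ?ltxx; [move=> /(_ va)|lra].
Qed.

Lemma wave_inj a b : 0 < v a < 1 -> v a = v b -> a = b.
Proof.
move=> va vab; have [ab|ba|//] := ltgtP a b.
  by have := wave_decr ab va; rewrite vab ltxx.
by have := wave_decr ba; rewrite -vab ltxx => /(_ va).
Qed.

Lemma wave_surj x : 0 < x < 1 -> exists z, v z = x.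
Proof.
move=> x01; have [|A AP] := @cvgNy_eps _ _ _ (1 - x) v_ny; first lra.
have [|B BP] := @cvgy_eps _ _ _ x v_y; first lra.
pose B' := Num.max A B.
have [AB BB] : A <= B' /\ B <= B' by split; rewrite /B' le_max lexx ?orbT.
have vA := AP A (lexx A); have vB := BP B' BB.
move: vA vB; rewrite !ltr_norml => vA vB.
have cw : {within `[A, B'], continuous v}.
  by apply: continuous_subspaceT; exact: v_cont.
have [|z _ <-] := @IVT R v A B' x AB cw; last by exists z.
by rewrite ge_min le_max; apply/andP; split; apply/orP; [right|left]; lra.
Qed.

Definition zeta x : R := xget 0 [set z | v z = x].
Definition orbit x : R := - Phi (zeta x).

Lemma zetaK x : 0 < x < 1 -> v (zeta x) = x.
Proof. by move=> /wave_surj[z vz]; rewrite /zeta; case: xgetP => [t _ //|/(_ z)]. Qed.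

Lemma wave_zetaK z : 0 < v z < 1 -> zeta (v z) = z.
Proof. by move=> vz; apply/esym/wave_inj => //; rewrite zetaK. Qed.

Lemma orbit_gt0 x : 0 < x < 1 -> 0 < orbit x.
Proof. by move=> x01; rewrite oppr_gt0 wave_flux_lt0// zetaK. Qed.

Lemma zeta_continuous x : 0 < x < 1 -> {for x, continuous zeta}.
Proof.
move=> x01; apply/cvgrPdist_lt => e e0.
have vz : 0 < v (zeta x) < 1 by rewrite zetaK.
have lo : v (zeta x + e) < x.
  by rewrite -[ltRHS](zetaK x01); apply: wave_decr; [lra|].
have hi : x < v (zeta x - e).
  have := @wave_nincr (zeta x - e) (zeta x); rewrite zetaK// => H.
  rewrite lt_neqAle H ?andbT; last lra.
  apply/eqP => xe; have : zeta x - e = zeta x.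
    by apply: wave_inj; rewrite -?xe ?zetaK.
  by lra.
near=> t.
have t01 : 0 < t < 1.
  by apply/andP; split; near: t; [apply: lt_nbhsr|apply: lt_nbhsl]; lra.
have tlo : v (zeta x + e) < t by near: t; exact: lt_nbhsr.
have thi : t < v (zeta x - e) by near: t; exact: lt_nbhsl.
rewrite -(zetaK t01) in tlo thi; rewrite distrC ltr_norml; apply/andP; split.
  by rewrite ltrBrDr addrC ltNge; apply/negP => /wave_nincr; rewrite leNgt thi.
by rewrite ltrBlDr addrC ltNge; apply/negP => /wave_nincr; rewrite leNgt tlo.
Unshelve. all: by end_near. Qed.

Lemma orbit_continuous x : 0 < x < 1 -> {for x, continuous orbit}.
Proof.
move=> x01; apply: continuousN; apply: continuous_comp; first exact: zeta_continuous.
exact: Phi_cont.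
Qed.

Let w x := - (orbit x / d x) `^ (1 / (p - 1)).

Lemma wave_slope_lt0 x : 0 < x < 1 -> w x < 0.
Proof.
by move=> x01; rewrite oppr_lt0 powR_gt0// divr_gt0 ?orbit_gt0 ?diffusion_gt0.
Qed.

Lemma wave_derive x : 0 < x < 1 -> x \notin S -> is_derive (zeta x) 1 v (w x).
Proof.
move=> x01 xS; have := @v_flux (zeta x); rewrite zetaK// => /(_ x01 xS)[dv PE].
rewrite /w /orbit -(flux_speed p_gt1 PE) ?diffusion_gt0 ?wave_flux_le0//.
by rewrite derive1E; apply: derivableP.
Qed.

(** zeta is the inverse of v, whose slope is known from the flux. *)
Lemma zeta_derive x : 0 < x < 1 -> x \notin S -> is_derive x 1 zeta (w x)^-1.
Proof.
move=> x01 xS; rewrite -{1}(zetaK x01).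
apply: (@is_derive_inverse R v zeta (w x) (zeta x)).
- near=> t; apply: wave_zetaK; near: t.
  have [a [b [a0 ab b1 [del d0 dP]]]] := @wave_near (zeta x) ltac:(by rewrite zetaK).
  apply/nbhs_ballP; exists del => //= t; rewrite /ball/= distrC => /dP; lra.
- by near=> t; exact: v_cont.
- exact: wave_derive.
- by rewrite lt_eqF ?wave_slope_lt0.
Unshelve. all: by end_near. Qed.

(** By the integral law the flux has derivative - q(v) v' - h(v) in z; dividing by
    v' turns it into a derivative with respect to the value of v. *)
Lemma orbit_derive x : 0 < x < 1 -> x \notin S ->
  is_derive x 1 orbit (q x - kappa p d h x * orbit x `^ (- (1 / (p - 1)))).
Proof.
move=> x01 xS; set z := zeta x; have vz : v z = x by rewrite zetaK.
have dv := wave_derive x01 xS; rewrite -/z in dv.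
have dz := zeta_derive x01 xS.
have dQ : is_derive (v z) 1 Q (q x).
  by rewrite vz; apply: (bounded_oriented_int_derive q_meas q_bnd); exact: q_cont.
have dQv : is_derive z 1 (Q \o v) (q x * w x).
  exact: is_derive1_comp.
have dH : is_derive z 1 (oriented_int (h \o v) z) (h x).
  rewrite -vz; apply: (@oriented_int_derive _ _ (z - 1) (z + 1)); [exact: hv_int|lra|lra|].
  apply: continuous_comp; first exact: v_cont.
  by rewrite vz; exact: h_cont.
have dP : is_derive z 1 Phi (- (q x * w x) - h x).
  have -> : Phi = (fun t => Phi z + Q (v z) - (Q \o v) t - oriented_int (h \o v) z t).
    by apply/funext => t; have := law z t; rewrite /=; lra.
  by apply: is_derive_eq; ring.
have := is_deriveN (@is_derive1_comp R Phi zeta x _ _ dP dz).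
rewrite /orbit => H; apply: is_derive_eq H _.
have w0 : w x != 0 by rewrite lt_eqF ?wave_slope_lt0.
have -> : - ((- (q x * w x) - h x) * (w x)^-1) = q x + h x / w x by field.
congr (_ + _); rewrite /w invrN mulrN; congr (- _).
rewrite /kappa -/(orbit x) powRM ?invr_ge0 ?ltW ?orbit_gt0 ?diffusion_gt0//.
have op := powR_gt0 (1 / (p - 1)) (orbit_gt0 x01).
have dp := powR_gt0 (1 / (p - 1)) (diffusion_gt0 x01).
rewrite powRV ?ltW ?diffusion_gt0// powRN; field.
by rewrite !gt_eqF.
Unshelve. all: by end_near. Qed.

(** The value 0 may be reached at a finite point or only at +oo; either way the flux
    is small from some point on where v is still positive. *)
Lemma wave_flux_small_right (eps : R) : 0 < eps ->
  exists2 Z, 0 < v Z < 1 & forall z, Z <= z -> `|Phi z| < eps.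
Proof.
move=> e0; pose z1 := zeta (1 / 2).
have vz1 : v z1 = 1 / 2 by rewrite zetaK//; lra.
have [A AP] := cvgy_eps Phi_y e0.
pose B := Num.max A z1.
have [AB zB] : A <= B /\ z1 <= B by split; rewrite /B le_max lexx ?orbT.
have [vB|vB] := ltP 0 (v B).
  exists B; first by have := wave_nincr zB; lra.
  by move=> z Bz; have := AP z (le_trans AB Bz); rewrite subr0.
have [||b [/andP[z1b bB] vb bP]] := @first_zero R v z1 B _ zB _ vB.
- by move=> z _; exact: v_cont.
- by lra.
have Pb : Phi b = 0 by apply: Phi_end; left.
have [del d0 dP] := continuous_eps (@Phi_cont b) e0.
pose Z := Num.max z1 (b - del / 2).
have [zZ1 zZ2 Zb] : [/\ z1 <= Z, b - del / 2 <= Z & Z < b].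
  by split; rewrite /Z ?le_max ?lexx ?orbT// gt_max z1b; lra.
exists Z; first by have := wave_nincr zZ1; have := bP Z zZ1 Zb; lra.
move=> z Zz; have [zb|bz] := ltP z b.
  by have := dP z; rewrite Pb subr0; apply; rewrite ltr_norml; lra.
rewrite Phi_end ?normr0//; left.
by have := wave_nincr bz; have := v01 z; lra.
Qed.

Lemma wave_flux_small_left (eps : R) : 0 < eps ->
  exists2 Z, 0 < v Z < 1 & forall z, z <= Z -> `|Phi z| < eps.
Proof.
move=> e0; pose z1 := zeta (1 / 2).
have vz1 : v z1 = 1 / 2 by rewrite zetaK//; lra.
have [A AP] := cvgNy_eps Phi_ny e0.
pose B := Num.min A z1.
have [AB zB] : B <= A /\ B <= z1 by split; rewrite /B ge_min lexx ?orbT.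
have [vB|vB] := ltP (v B) 1.
  exists B; first by have := wave_nincr zB; lra.
  by move=> z Bz; have := AP z (le_trans Bz AB); rewrite subr0.
have [|||b [/andP[Bb bz1] vb bP]] := @last_zero R (fun z => 1 - v z) B z1 _ zB.
- by move=> z _; apply: cvgB; [exact: cvg_cst|exact: v_cont].
- by lra.
- by lra.
have Pb : Phi b = 0 by apply: Phi_end; right; lra.
have [del d0 dP] := continuous_eps (@Phi_cont b) e0.
pose Z := Num.min z1 (b + del / 2).
have [zZ1 zZ2 Zb] : [/\ Z <= z1, Z <= b + del / 2 & b < Z].
  by split; rewrite /Z ?ge_min ?lexx ?orbT// lt_min bz1; lra.
exists Z; first by have := wave_nincr zZ1; have := bP Z Zb zZ1; lra.
move=> z Zz; have [zb|bz] := ltP b z.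
  by have := dP z; rewrite Pb subr0; apply; rewrite ltr_norml; lra.
rewrite Phi_end ?normr0//; right.
by have := wave_nincr bz; have := v01 z; lra.
Qed.

Lemma orbit_lim0 : orbit x @[x --> 0^'+] --> (0 : R).
Proof.
apply/cvgrPdist_lt => e e0; have [Z vZ ZP] := wave_flux_small_right e0.
near=> t; rewrite sub0r normrN /orbit normrN; apply: ZP.
have t0 : 0 < t by near: t; exact: nbhs_right_gt.
have tv : t < v Z by near: t; apply: nbhs_right_lt; case/andP: vZ.
rewrite leNgt; apply/negP => /ltW/wave_nincr; rewrite zetaK; lra.
Unshelve. all: by end_near. Qed.

Lemma orbit_lim1 : orbit x @[x --> 1^'-] --> (0 : R).
Proof.
apply/cvgrPdist_lt => e e0; have [Z vZ ZP] := wave_flux_small_left e0.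
near=> t; rewrite sub0r normrN /orbit normrN; apply: ZP.
have t0 : t < 1 by near: t; exact: nbhs_left_lt.
have tv : v Z < t by near: t; apply: nbhs_left_gt; case/andP: vZ.
rewrite leNgt; apply/negP => /ltW/wave_nincr; rewrite zetaK; lra.
Unshelve. all: by end_near. Qed.

End Coefs.

(** * Orbits that cannot exist *)

Section NoOrbit.
Variable R : realType.
Implicit Types (p r m s A x : R) (S : seq R).

(** Young's inequality with exponents p and p' = p / (p - 1), for the two factors
    (p r)^(1/p) and (p' s)^(1/p') with s = (m / r)^(1/(p-1)): the right-hand side
    is r + s and the product does not depend on r. *)
Lemma young_min p r m : 1 < p -> 0 < r -> 0 <= m ->
  p / (p - 1) * (m * (p - 1)) `^ (1 / p) <= r + (m / r) `^ (1 / (p - 1)).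
Proof.
move=> p1 r0 m0; set s := _ `^ (1 / (p - 1)).
have s0 : 0 <= s by exact: powR_ge0.
have [p0 pm] : 0 < p /\ 0 < p - 1 by split; lra.
have pN0 : p != 0 by rewrite gt_eqF.
have pmN0 : p - 1 != 0 by rewrite gt_eqF.
pose p' := p / (p - 1).
have p'0 : 0 < p' by rewrite divr_gt0.
have conj : p^-1 + p'^-1 = 1 by rewrite /p'; field; apply/andP.
have pr0 : 0 <= p * r by rewrite mulr_ge0 ?ltW.
have ps0 : 0 <= p' * s by apply: mulr_ge0 => //; exact: ltW.
have := @conjugate_powR R ((p * r) `^ p^-1) ((p' * s) `^ p'^-1) p p'
  (powR_ge0 _ _) (powR_ge0 _ _) p0 p'0 conj.
rewrite -!powRrM !mulVf ?gt_eqF// !powRr1//.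
have -> : p * r / p + p' * s / p' = r + s by field; rewrite /p' mulf_neq0 ?invr_eq0.
apply: le_trans; rewrite le_eqVlt; apply/orP; left; apply/eqP.
have mr0 : 0 <= m / r by rewrite divr_ge0// ltW.
rewrite (powRM _ (ltW p0) (ltW r0)) (powRM _ (ltW p'0) s0) (powRM _ m0 (ltW pm)) -/p'.
have -> : s `^ p'^-1 = (m / r) `^ p^-1.
  by rewrite /s -powRrM; congr (_ `^ _); rewrite /p'; field; apply/andP.
have -> : p' `^ p'^-1 = p' / p' `^ p^-1.
  have -> : p'^-1 = 1 - p^-1 by rewrite -conj; ring.
  rewrite powRB ?powRr1 ?(ltW p'0)//; apply/implyP => _; exact: lt0r_neq0.
have powRdiv x z : 0 <= x -> 0 < z -> (x / z) `^ p^-1 = x `^ p^-1 / z `^ p^-1.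
  by move=> x0 z0; rewrite -(powRV _ (ltW z0)) powRM// invr_ge0 ltW.
have -> : (m / r) `^ p^-1 = m `^ p^-1 / r `^ p^-1 by exact: powRdiv.
have -> : p' `^ p^-1 = p `^ p^-1 / (p - 1) `^ p^-1.
  by apply: powRdiv => //; exact: ltW.
have H1 := powR_gt0 p^-1 r0; have H2 := powR_gt0 p^-1 p0; have H3 := powR_gt0 p^-1 pm.
rewrite div1r; field.
by rewrite !gt_eqF.
Qed.

(** This is the case of equality in [young_min] for m = s^(p-1): at the minimum the
    two summands are in the ratio 1 to p - 1. *)
Lemma young_min_attained p s : 1 < p -> 0 < s -> exists2 rho : R, 0 < rho &
  rho + s * rho `^ (- (1 / (p - 1))) =
  p / (p - 1) * (p - 1) `^ (1 / p) * s `^ (1 / (p / (p - 1))).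
Proof.
move=> p1 s0; have [p0 pm] : 0 < p /\ 0 < p - 1 by split; lra.
have pN0 : p != 0 by rewrite gt_eqF.
have pmN0 : p - 1 != 0 by rewrite gt_eqF.
pose sg := s / (p - 1); have sg0 : 0 < sg by rewrite divr_gt0.
have sE : s = (p - 1) * sg by rewrite /sg mulrC divfK.
have -> : 1 / (p / (p - 1)) = 1 - 1 / p by field; rewrite pN0.
exists (sg `^ (1 - 1 / p)); first exact: powR_gt0.
have -> : (sg `^ (1 - 1 / p)) `^ (- (1 / (p - 1))) = sg `^ (- (1 / p)).
  by rewrite -powRrM; congr (_ `^ _); field; rewrite pN0 pmN0.
have -> : s * sg `^ (- (1 / p)) = (p - 1) * sg `^ (1 - 1 / p).
  rewrite sE -mulrA powRD; last by apply/implyP => _; rewrite gt_eqF.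
  by rewrite powRr1// ltW.
rewrite sE (powRM _ (ltW pm) (ltW sg0)).
have pE : (p - 1) `^ (1 - 1 / p) = (p - 1) / (p - 1) `^ (1 / p).
  by rewrite powRB ?powRr1 ?ltW// pmN0 implybT.
rewrite pE; have pp := powR_gt0 (1 / p) pm.
by field; rewrite pmN0 gt_eqF.
Qed.

Lemma powRN_blowup p C : 1 < p -> exists2 del : R, 0 < del &
  forall y, 0 < y -> y <= del -> C <= y `^ (- (1 / (p - 1))).
Proof.
move=> p1; pose D := Num.max C 1.
have D0 : 0 < D by rewrite lt_max ltr01 orbT.
exists (D^-1 `^ (p - 1)); first by rewrite powR_gt0// invr_gt0.
move=> y y0 yD; apply: (@le_trans _ _ D); first by rewrite le_max lexx.
rewrite powRN -[D]invrK lef_pV2 ?posrE ?invr_gt0 ?powR_gt0//.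
rewrite -[leRHS](@powRK_p1 R p p1) ?invr_ge0 ?(ltW D0)//.
by rewrite ge0_ler_powR ?nnegrE ?powR_ge0 ?(ltW y0)// divr_ge0//; lra.
Qed.

(** The ratio y x / x is at most A because y' <= A and y vanishes at 0. On the other
    hand [young_min] gives it a slope at most - eps / x, where eps is the gap
    between A and the threshold, so that y x / x + eps ln x does not increase and
    y x / x is unbounded near 0. *)
Lemma no_orbit p (q k y : R -> R) S A m del : 1 < p -> 0 <= m -> 0 < del < 1 ->
  (forall x, 0 < x < del -> 0 < y x) ->
  (forall x, 0 < x < del -> {for x, continuous y}) ->
  (forall x, 0 < x < del -> x \notin S ->
     is_derive x 1 y (q x - k x * y x `^ (- (1 / (p - 1))))) ->
  y x @[x --> 0^'+] --> (0 : R) ->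
  A < p / (p - 1) * (m * (p - 1)) `^ (1 / p) ->
  (forall x, 0 < x < del -> q x <= A) ->
  (forall x, 0 < x < del -> 0 <= k x /\ m <= k x `^ (p - 1) / x) ->
  False.
Proof.
move=> p1 m0 del01 y0 cy dy ly AK qA kP.
have [d0 d1] : 0 < del /\ del < 1 by split; lra.
have yA x : 0 < x < del -> y x <= A * x.
  move=> xd; apply/ler_addgt0Pr => e e0.
  have : \forall t \near 0^'+, y t < e / 2.
    have e2 : 0 < e / 2 by lra.
    move/cvgrPdist_lt : ly => /(_ _ e2).
    by apply: filterS => t; rewrite sub0r normrN; apply: le_lt_trans; exact: ler_norm.
  move=> yt; near (0 : R)^'+ => t.
  have t0 : 0 < t by near: t; exact: nbhs_right_gt.
  have tx : t < x by near: t; apply: nbhs_right_lt; case/andP: xd.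
  have yte : y t < e / 2 by near: t.
  have At : (`|A| + 1) * t < e / 2.
    rewrite mulrC -ltr_pdivlMr; last by have := normr_ge0 A; lra.
    near: t; apply: nbhs_right_lt; rewrite divr_gt0//; have := normr_ge0 A; lra.
  have : y x - y t <= A * (x - t).
    apply: (@mvt_le_off R y t x A S) => //; first exact: ltW.
      by move=> z zt; apply: cy; lra.
    move=> z zt zS; have zd : 0 < z < del by lra.
    eexists; first exact: dy.
    have [k0 _] := kP z zd; have := qA z zd.
    by have := mulr_ge0 k0 (powR_ge0 (y z) (- (1 / (p - 1)))); lra.
  have : - A * t <= `|A| * t by rewrite ler_wpM2r ?(ltW t0)// -normrN ler_norm.
  by lra.
pose x := del / 2; have xd : 0 < x < del by rewrite /x; lra.
set K := p / (p - 1) * _ in AK.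
pose eps := K - A; have eps0 : 0 < eps by rewrite subr_gt0.
pose B := (A - y x / x) / eps + 1.
have x0 : 0 < x by lra.
have rxA : y x / x <= A by rewrite ler_pdivrMr//; exact: yA.
have B0 : 0 < B.
  by rewrite /B ltr_pwDr// divr_ge0// ?subr_ge0// ltW.
(* ln t = ln x - B, and eps * B exceeds what the bound by A leaves available *)
pose t := x * expR (- B).
have t0 : 0 < t by rewrite mulr_gt0// expR_gt0.
have tx : t < x by rewrite /t gtr_pMr// expR_lt1 oppr_lt0.
have rtA : y t / t <= A by rewrite ler_pdivrMr//; apply: yA; lra.
pose H z := y z / z + eps * ln z.
have : H x - H t <= 0 * (x - t).
  apply: (@mvt_le_off R H t x 0 S (ltW tx)).
    move=> z zt; apply: cvgD.
      apply: cvgM; first by apply: cy; lra.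
      by apply: cvgV; [rewrite gt_eqF//; lra|exact: cvg_id].
    apply: cvgM; first exact: cvg_cst.
    by apply: continuous_ln; lra.
  move=> z zt zS; have zd : 0 < z < del by lra.
  have z0 : 0 < z by lra.
  have zN0 : z != 0 by rewrite gt_eqF.
  have yz := y0 z zd.
  have dyz := dy z zd zS; set Y := q z - _ in dyz.
  exists ((Y - y z / z + eps) / z).
    have dV : is_derive z 1 (fun z : R => z^-1) (- z ^- 2).
      by have := @is_deriveV R id z 1 1 zN0 (is_derive_id _ _); rewrite /GRing.scale/= mulr1.
    have dln := is_derive1_ln z0.
    by apply: is_derive_eq; rewrite /GRing.scale/=; field.
  rewrite ler_pdivrMr// mul0r /Y.
  have [k0 km] := kP z zd.
  have r0 : 0 < y z / z by rewrite divr_gt0.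
  have := @young_min p (y z / z) m p1 r0 m0; rewrite -/K.
  have : (m / (y z / z)) `^ (1 / (p - 1)) <= k z * y z `^ (- (1 / (p - 1))).
    have -> : m / (y z / z) = (m * z) / y z by field; rewrite zN0 gt_eqF.
    have mz0 : 0 <= m * z by rewrite mulr_ge0// ltW.
    have yi0 : 0 <= (y z)^-1 by rewrite invr_ge0 ltW.
    rewrite (powRM _ mz0 yi0) (powRV _ (ltW yz)) powRN ler_wpM2r ?invr_ge0 ?powR_ge0//.
    rewrite -[leRHS](@powRK_p1 R p p1)// ge0_ler_powR ?nnegrE ?powR_ge0//.
      by rewrite divr_ge0//; lra.
    by rewrite -ler_pdivlMr.
  by have := qA z zd; rewrite /eps; lra.
have lnt : ln t = ln x - B.
  by rewrite /t lnM ?posrE ?expR_gt0// expRK.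
rewrite mul0r /H lnt => Hxt.
have : eps * B = A - y x / x + eps by rewrite /B mulrDr mulr1 mulrC divfK // gt_eqF.
by lra.
Unshelve. all: by end_near. Qed.

End NoOrbit.

(** * From an orbit to a wave *)

Lemma powR_div_le (R : realType) (a b c1 c2 r : R) : 0 <= r -> 0 <= a -> a <= b ->
  0 < c2 -> c2 <= c1 -> (a / c1) `^ r <= (b / c2) `^ r.
Proof.
move=> r0 a0 ab c20 c21; have c10 : 0 < c1 by exact: lt_le_trans c21.
have b0 := le_trans a0 ab.
apply: ge0_ler_powR => //; rewrite ?nnegrE ?divr_ge0 ?(ltW c10) ?(ltW c20)//.
by apply: ler_pM => //; rewrite ?invr_ge0 ?(ltW c10)// lef_pV2.
Qed.

Lemma notin_seq_near (R : realType) (S : seq R) (x : R) :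
  x \notin S -> \forall t \near x, t \notin S.
Proof.
elim: S => [|s S IH]; first by move=> _; near=> t; rewrite in_nil.
rewrite inE negb_or neq_lt => /andP[/orP[xs|sx] /IH xS]; near=> t.
  rewrite inE negb_or lt_eqF/=; first by near: t.
  by near: t; exact: lt_nbhsl.
rewrite inE negb_or gt_eqF/=; first by near: t.
by near: t; exact: lt_nbhsr.
Unshelve. all: by end_near. Qed.

Lemma notin_seq_dnbhs (R : realType) (S : seq R) (x : R) :
  \forall t \near x^', t \notin S.
Proof.
have := @notin_seq_near R [seq t <- S | t != x] x.
rewrite mem_filter /= eqxx => /(_ isT) H; near=> t.
have tx : t != x by near: t; exact: nbhs_dnbhs_neq.
have : t \notin [seq t <- S | t != x] by near: t; exact: (nbhs_dnbhs H).
by rewrite mem_filter /= tx.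
Unshelve. all: by end_near. Qed.

Section WaveOfOrbit.
Variable R : realType.
Notation mu := (@lebesgue_measure R).
Variables (p M : R) (q h d y : R -> R) (S : seq R).
Implicit Types x z t a b m l : R.
Hypothesis p_gt1 : 1 < p.
Hypothesis q_meas : measurable_fun setT q.
Hypothesis q_bnd : forall x, `|q x| <= M.
Hypothesis h_meas : measurable_fun setT h.
Hypothesis h_bnd : forall x, `|h x| <= M.
Hypothesis h_end : h 0 = 0 /\ h 1 = 0.
Hypothesis d_lb : forall a b, 0 < a -> a < b -> b < 1 ->
  exists2 m : R, 0 < m & forall x, a <= x <= b -> m <= d x.
Hypothesis d_ub : forall a b, 0 < a -> a < b -> b < 1 ->
  exists m : R, forall x, a <= x <= b -> d x <= m.
Hypothesis q_cont : forall x, 0 < x < 1 -> x \notin S -> {for x, continuous q}.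
Hypothesis h_cont : forall x, 0 < x < 1 -> x \notin S -> {for x, continuous h}.
Hypothesis d_cont : forall x, 0 < x < 1 -> x \notin S -> {for x, continuous d}.
(* as d has no removable discontinuity, its only possible limit at x is d x *)
Hypothesis d_nonrem : forall x l, 0 < x < 1 -> d t @[t --> x^'] --> l -> d x = l.
Hypothesis y_gt0 : forall x, 0 < x < 1 -> 0 < y x.
Hypothesis y_cont : forall x, 0 < x < 1 -> {for x, continuous y}.
Hypothesis y_der : forall x, 0 < x < 1 -> x \notin S ->
  is_derive x 1 y (q x - kappa p d h x * y x `^ (- (1 / (p - 1)))).
Hypothesis y_lim0 : y x @[x --> 0^'+] --> (0 : R).
Hypothesis y_lim1 : y x @[x --> 1^'-] --> (0 : R).

Let e := 1 / (p - 1).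
Let e_gt0 : 0 < e. Proof. by rewrite divr_gt0// subr_gt0. Qed.

Let dpos x : 0 < x < 1 -> 0 < d x.
Proof.
move=> x01; have [|||m m0 mP] := @d_lb (x / 2) x; [lra..|].
by apply: lt_le_trans m0 (mP _ _); lra.
Qed.

Lemma powR_continuous (f : R -> R) x r : {for x, continuous f} -> 0 < f x ->
  {for x, continuous (fun t => f t `^ r)}.
Proof.
move=> cf fx; apply: (@continuous_comp _ _ _ f (fun t => t `^ r)) => //.
apply: differentiable_continuous; apply/derivable1_diffP/derivable_powR.
by rewrite in_itv/= fx.
Qed.

Let k x := (d x / y x) `^ e.

Let k_gt0 x : 0 < x < 1 -> 0 < k x.
Proof. by move=> x01; rewrite powR_gt0// divr_gt0 ?dpos ?y_gt0. Qed.

Let k_cont x : 0 < x < 1 -> x \notin S -> {for x, continuous k}.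
Proof.
move=> x01 xS; apply: powR_continuous; last by rewrite divr_gt0 ?dpos ?y_gt0.
apply: continuousM; first exact: d_cont.
by apply: continuousV; [rewrite gt_eqF ?y_gt0|exact: y_cont].
Qed.

Let y_lb a b : 0 < a -> a <= b -> b < 1 ->
  exists2 m : R, 0 < m & forall x, a <= x <= b -> m <= y x.
Proof.
move=> a0 ab b1.
have [|c] := @EVT_min R y a b ab.
  apply: continuous_in_subspaceT => x; rewrite inE/= in_itv/= => xab.
  by apply: y_cont; lra.
rewrite in_itv/= => cab cP; exists (y c); first by apply: y_gt0; lra.
by move=> x xab; apply: cP; rewrite in_itv.
Qed.

Let y_ub a b : 0 < a -> a <= b -> b < 1 ->
  exists m : R, forall x, a <= x <= b -> y x <= m.
Proof.
move=> a0 ab b1.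
have [|c] := @EVT_max R y a b ab.
  apply: continuous_in_subspaceT => x; rewrite inE/= in_itv/= => xab.
  by apply: y_cont; lra.
rewrite in_itv/= => cab cP; exists (y c) => x xab; apply: cP; rewrite in_itv//.
Qed.

Let k_ub a b : 0 < a -> a < b -> b < 1 ->
  exists m : R, forall x, a <= x <= b -> k x <= m.
Proof.
move=> a0 ab b1; have [m1 m1P] := d_ub a0 ab b1.
have [m2 m20 m2P] := y_lb a0 (ltW ab) b1.
exists ((m1 / m2) `^ e) => x xab; have x01 : 0 < x < 1 by lra.
have dx := dpos x01; have yx := y_gt0 x01.
by apply: powR_div_le; rewrite ?m1P ?m2P// ltW.
Qed.

Let k_int a b : 0 < a -> a < b -> b < 1 -> mu.-integrable `[a, b] (EFin \o k).
Proof.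
move=> a0 ab b1; have [m mP] := k_ub a0 ab b1.
apply: (@bounded_integrable_itv _ _ _ _ m).
  have mk : measurable_fun (`]0, 1[ : set R) k by apply: (@measurable_off _ _ S); exact: k_cont.
  by apply: measurable_funS mk => //; apply: subset_itv; rewrite bnd_simp.
by move=> x xab; rewrite ger0_norm ?mP// ltW// k_gt0//; lra.
Qed.

(** The position at which the value x is taken, from dz = - (d / y)^e dx and the
    normalization that 1 / 2 is taken at the origin. *)
Definition travel_time x := - oriented_int k (1 / 2) x.

Let itv_around x : 0 < x < 1 -> exists a b, [/\ 0 < a, a < b, b < 1, a < x < b & a <= 1 / 2 <= b].
Proof.
move=> x01; exists (Num.min (x / 2) (1 / 2)), (Num.max ((x + 1) / 2) (1 / 2)).
by split; rewrite ?lt_min ?gt_max ?lt_max ?gt_min ?le_max ?ge_min ?lexx ?orbT//; try lra;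
  apply/andP; split; apply/orP; left; lra.
Qed.

Let time_cont x : 0 < x < 1 -> {for x, continuous travel_time}.
Proof.
move=> /itv_around[a [b [a0 ab b1 xab hab]]]; apply: continuousN.
exact: oriented_int_continuous (k_int a0 ab b1) hab xab.
Qed.

Let time_der x : 0 < x < 1 -> x \notin S -> is_derive x 1 travel_time (- k x).
Proof.
move=> x01 xS; have [a [b [a0 ab b1 xab hab]]] := itv_around x01.
apply: is_deriveN.
exact: oriented_int_derive (k_int a0 ab b1) hab xab (k_cont x01 xS).
Qed.

Let time_decr x1 x2 : 0 < x1 -> x1 < x2 -> x2 < 1 -> travel_time x2 < travel_time x1.
Proof.
move=> x10 x12 x21.
have [m1 m10 m1P] := d_lb x10 x12 x21; have [m2 m2P] := y_ub x10 (ltW x12) x21.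
have x101 : 0 < x1 < 1 by lra.
have m20 : 0 < m2 by apply: (lt_le_trans (y_gt0 x101)); apply: m2P; lra.
pose m := (m1 / m2) `^ e.
have m0 : 0 < m by rewrite powR_gt0// divr_gt0.
have : m * (x2 - x1) <= (- travel_time) x2 - (- travel_time) x1.
  apply: (@mvt_ge_off R (- travel_time) x1 x2 m S (ltW x12)) => x xx.
    by apply: continuousN; apply: time_cont; lra.
  have x01 : 0 < x < 1 by lra.
  move=> xS; exists (k x); first by rewrite -[k x]opprK; apply: is_deriveN; exact: time_der.
  have dx := dpos x01; have yx := y_gt0 x01.
  have xx' : x1 <= x <= x2 by lra.
  by apply: powR_div_le; rewrite ?m1P ?m2P// ltW.
have : 0 < m * (x2 - x1) by rewrite mulr_gt0// subr_gt0.
by rewrite !fctE; lra.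
Qed.

Let time_le x1 x2 : 0 < x1 < 1 -> 0 < x2 < 1 -> travel_time x1 <= travel_time x2 -> x2 <= x1.
Proof.
move=> x1P x2P; apply: contraTT; rewrite -!ltNge => x12; apply: time_decr => //; lra.
Qed.

Let A z : set R := [set x | x = 0 \/ (0 < x < 1 /\ z <= travel_time x)].

(** The inverse of the decreasing function [travel_time]. Written as a supremum, it
    takes by itself the values 1 and 0 beyond the ends of the range of
    [travel_time], when these are finite. *)
Definition profile_of_orbit z : R := sup (A z).
Local Notation v := profile_of_orbit.

Let A0 z : A z 0. Proof. by left. Qed.
Let Aub z : ubound (A z) 1. Proof. by move=> x [->//|[]]; lra. Qed.
Let Asup z : has_sup (A z). Proof. by split; [exists 0|exists 1]. Qed.

Let v01 z : 0 <= v z <= 1.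
Proof.
by apply/andP; split; [apply: ub_le_sup => //; exists 1|apply: ge_sup => //; exists 0].
Qed.

Let v_ge z x : 0 < x < 1 -> z <= travel_time x -> x <= v z.
Proof. by move=> x01 zx; apply: ub_le_sup; [exists 1|right]. Qed.

Let v_le z x : 0 < x < 1 -> travel_time x < z -> v z <= x.
Proof.
move=> x01 xz; apply: ge_sup; first by exists 0.
move=> t [->|[t01 zt]]; first lra.
by apply: time_le => //; apply: ltW; exact: lt_le_trans zt.
Qed.

Let v_lt z x : 0 < x < 1 -> x < v z -> z < travel_time x.
Proof.
move=> x01 xv; have xv0 : 0 < v z - x by rewrite subr_gt0.
have [t [t0|[t01 zt]] xt] := sup_adherent xv0 (Asup z).
  by rewrite t0 -/(v z) in xt; lra.
apply: le_lt_trans zt _; apply: time_decr; try lra.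
by rewrite -/(v z) in xt; lra.
Qed.

Let v_gt z x : 0 < x < 1 -> v z < x -> travel_time x < z.
Proof. by move=> x01; rewrite ltNge => vx; rewrite ltNge; apply: contra vx; exact: v_ge. Qed.

Let timeK x : 0 < x < 1 -> v (travel_time x) = x.
Proof.
move=> x01; apply/eqP; rewrite eq_le v_ge// andbT leNgt; apply/negP => xv.
by have := v_lt x01 xv; rewrite ltxx.
Qed.

Let vK z : 0 < v z < 1 -> travel_time (v z) = z.
Proof.
move=> vz; apply/eqP; rewrite eq_le; apply/andP; split; rewrite leNgt; apply/negP => H.
- have c : {for v z, continuous (fun x => travel_time x - z)}.
    by apply: cvgB; [exact: time_cont|exact: cvg_cst].
  have [|del d0 dP] := continuous_gt0 c; first lra.
  pose x := Num.min (v z + del / 2) ((v z + 1) / 2).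
  have [x1 x2 x3] : [/\ x <= v z + del / 2, x <= (v z + 1) / 2 & v z < x].
    by split; rewrite /x ?ge_min ?lexx ?orbT// lt_min; lra.
  have x01 : 0 < x < 1 by lra.
  have := v_gt x01 x3; have : 0 < travel_time x - z by apply: dP; rewrite ltr_norml; lra.
  by lra.
- have c : {for v z, continuous (fun x => z - travel_time x)}.
    by apply: cvgB; [exact: cvg_cst|exact: time_cont].
  have [|del d0 dP] := continuous_gt0 c; first lra.
  pose x := Num.max (v z - del / 2) (v z / 2).
  have [x1 x2 x3] : [/\ v z - del / 2 <= x, v z / 2 <= x & x < v z].
    by split; rewrite /x ?le_max ?lexx ?orbT// gt_max; lra.
  have x01 : 0 < x < 1 by lra.
  have := v_lt x01 x3; have : 0 < z - travel_time x by apply: dP; rewrite ltr_norml; lra.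
  by lra.
Qed.

Let v_cont : continuous v.
Proof.
move=> z; apply/cvgrPdist_lt => eps eps0.
have vz := v01 z.
have lo : \forall t \near z, v z - eps < v t.
  have [c|c] := ltP (v z - eps) 0.
    by near=> t; have := v01 t; lra.
  have x01 : 0 < v z - eps / 2 < 1 by lra.
  have tz : z < travel_time (v z - eps / 2) by apply: v_lt => //; lra.
  near=> t; have : t <= travel_time (v z - eps / 2).
    by apply: ltW; near: t; exact: lt_nbhsl.
  by move=> /(v_ge x01); lra.
have hi : \forall t \near z, v t < v z + eps.
  have [c|c] := ltP 1 (v z + eps).
    by near=> t; have := v01 t; lra.
  have x01 : 0 < v z + eps / 2 < 1 by lra.
  have tz : travel_time (v z + eps / 2) < z by apply: v_gt => //; lra.
  near=> t; have : travel_time (v z + eps / 2) < t by near: t; exact: lt_nbhsr.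
  by move=> /(v_le x01); lra.
near=> t; rewrite distrC ltr_norml; apply/andP; split.
  by rewrite ltrBrDr addrC; near: t.
by rewrite ltrBlDr addrC; near: t.
Unshelve. all: by end_near. Qed.

Let v_ny : v z @[z --> -oo] --> (1 : R).
Proof.
apply/cvgrPdist_lt => eps eps0; pose x := Num.max (1 - eps / 2) (1 / 2).
have [x1 x2 x3] : [/\ 1 - eps / 2 <= x, 1 / 2 <= x & x < 1].
  by split; rewrite /x ?le_max ?lexx ?orbT// gt_max; lra.
near=> z; have := v01 z.
have : x <= v z by apply: v_ge; [lra|near: z; apply: nbhs_ninfty_le; exact: num_real].
by rewrite ltr_norml; lra.
Unshelve. all: by end_near. Qed.

Let v_y : v z @[z --> +oo] --> (0 : R).
Proof.
apply/cvgrPdist_lt => eps eps0; pose x := Num.min (eps / 2) (1 / 2).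
have [x1 x2 x3] : [/\ x <= eps / 2, x <= 1 / 2 & 0 < x].
  by split; rewrite /x ?ge_min ?lexx ?orbT// lt_min; lra.
near=> z; have := v01 z.
have : v z <= x by apply: v_le; [lra|near: z; apply: nbhs_pinfty_gt; exact: num_real].
by rewrite ltr_norml; lra.
Unshelve. all: by end_near. Qed.


Let w x := - (y x / d x) `^ e.

Let w_cont x : 0 < x < 1 -> x \notin S -> {for x, continuous w}.
Proof.
move=> x01 xS; apply: continuousN.
apply: powR_continuous; last by rewrite divr_gt0 ?dpos ?y_gt0.
apply: continuousM; first exact: y_cont.
by apply: continuousV; [rewrite gt_eqF ?dpos|exact: d_cont].
Qed.

Let v_der z : 0 < v z < 1 -> v z \notin S -> is_derive z 1 v (w (v z)).
Proof.
move=> vz vS; rewrite -{1}(vK vz); set x := v z in vz vS *.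
have -> : w x = (- k x)^-1.
  rewrite invrN /w /k -powRV ?invf_div// divr_ge0// ltW ?dpos ?y_gt0//.
apply: (@is_derive_inverse R travel_time v (- k x) x).
- near=> t; apply: timeK.
  by apply/andP; split; near: t; [apply: lt_nbhsr|apply: lt_nbhsl]; case/andP: vz.
- near=> t; apply: time_cont.
  by apply/andP; split; near: t; [apply: lt_nbhsr|apply: lt_nbhsl]; case/andP: vz.
- exact: time_der.
- by rewrite oppr_eq0 gt_eqF ?k_gt0.
Unshelve. all: by end_near. Qed.

Let derive_v z : 0 < v z < 1 -> v z \notin S -> derive1 v z = w (v z).
Proof.
by move=> vz vS; rewrite derive1E; have dv := v_der vz vS; rewrite derive_val.
Qed.

Let near_v01 z : 0 < v z < 1 -> \forall t \near z, 0 < v t < 1.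
Proof.
move=> /andP[v0 v1]; near=> t; apply/andP; split; near: t.
  exact: (cvgr_gt _ (@v_cont z)).
exact: (cvgr_lt _ (@v_cont z)).
Unshelve. all: by end_near. Qed.

Let v_C1 z : 0 < v z < 1 -> v z \notin S ->
  derivable v z 1 /\ {for z, continuous (derive1 v)}.
Proof.
move=> vz vS; split; first by have dv := v_der vz vS; exact: ex_derive.
rewrite /prop_for/continuous_at derive_v//.
have nS : \forall t \near z, v t \notin S := @v_cont z _ (notin_seq_near vS).
have : (w \o v) t @[t --> z] --> w (v z).
  by apply: continuous_comp; [exact: v_cont|exact: w_cont].
apply: cvg_trans; apply: near_eq_cvg; near=> t; rewrite /= derive_v//.
  by near: t; exact: near_v01.
by near: t.
Unshelve. all: by end_near. Qed.

Let Y x := if 0 < x < 1 then y x else 0.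

Let Y_cont : continuous Y.
Proof.
move=> x; have [x01|] := boolP (0 < x < 1).
  rewrite /continuous_at {2}/Y x01; apply: cvg_trans (y_cont x01).
  apply: near_eq_cvg; near=> t; rewrite /Y ifT//.
  by apply/andP; split; near: t; [apply: lt_nbhsr|apply: lt_nbhsl]; case/andP: x01.
rewrite negb_and -!leNgt => x01.
have Yx : Y x = 0 by rewrite /Y ifF//; apply/negP; lra.
apply/cvgrPdist_lt => eps eps0; rewrite Yx.
suff : \forall t \near x, `|Y t| < eps.
  by apply: filterS => t; rewrite sub0r normrN.
have Y0 t : ~~ (0 < t < 1) -> `|Y t| < eps.
  by move=> t01; rewrite /Y (negbTE t01) normr0.
have [x0|x0|xe] := ltgtP x 0.
- near=> t; apply: Y0; rewrite negb_and -!leNgt; apply/orP; left; apply/ltW.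
  by near: t; exact: lt_nbhsl.
- have {x0}x1 : 1 <= x by lra.
  have [x1'|xe] : 1 < x \/ x = 1 by move: x1; rewrite le_eqVlt => /orP[/eqP|]; auto.
    near=> t; apply: Y0; rewrite negb_and -!leNgt; apply/orP; right; apply/ltW.
    by near: t; exact: lt_nbhsr.
  rewrite {x1 x01 Yx}xe.
  have : \forall t \near 1^'-, `|y t| < eps.
    move/cvgrPdist_lt : y_lim1 => /(_ _ eps0).
    by apply: filterS => t; rewrite sub0r normrN.
  rewrite /at_left near_withinE => H; near=> t.
  have [t1|t1] := ltP t 1; last by apply: Y0; lra.
  rewrite /Y; case: ifPn => _; last by rewrite normr0.
  by move: t1; near: t.
- rewrite {x01 Yx}xe.
  have : \forall t \near 0^'+, `|y t| < eps.
    move/cvgrPdist_lt : y_lim0 => /(_ _ eps0).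
    by apply: filterS => t; rewrite sub0r normrN.
  rewrite /at_right near_withinE => H; near=> t.
  have [t1|t1] := ltP 0 t; last by apply: Y0; lra.
  rewrite /Y; case: ifPn => _; last by rewrite normr0.
  by move: t1; near: t.
Unshelve. all: by end_near. Qed.

Let Phi z := - Y (v z).

Let Phi_cont : continuous Phi.
Proof.
move=> z; apply: (@continuousN _ _ _ (Y \o v)).
by apply: continuous_comp; [exact: v_cont|exact: Y_cont].
Qed.

Let Y0 : Y 0 = 0. Proof. by rewrite /Y ltxx. Qed.
Let Y1 : Y 1 = 0. Proof. by rewrite /Y ltxx andbF. Qed.

Let Phi_ny : Phi z @[z --> -oo] --> (0 : R).
Proof.
have : Phi z @[z --> -oo] --> - Y 1.
  by apply: cvgN; apply: (cvg_comp _ _ v_ny); exact: Y_cont.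
by rewrite Y1 oppr0.
Qed.

Let Phi_y : Phi z @[z --> +oo] --> (0 : R).
Proof.
have : Phi z @[z --> +oo] --> - Y 0.
  by apply: cvgN; apply: (cvg_comp _ _ v_y); exact: Y_cont.
by rewrite Y0 oppr0.
Qed.

Let Phi_end z : v z = 0 \/ v z = 1 -> Phi z = 0.
Proof. by rewrite /Phi => -[->|->]; rewrite ?Y0 ?Y1 oppr0. Qed.

(** At the values 0 and 1 the profile is extremal and has slope 0. At a value s in
    (0, 1) let L be the slope of the profile. As x tends to s, the slopes
    - (y x / d x)^e tend to L by continuity of the derivative, and L < 0 because d
    is bounded near s. Hence d has the limit y s / (- L)^(p-1) at s, and this
    limit must be d s. *)
Let flux_in a b : (forall z, a < z < b -> derivable v z 1 /\ {for z, continuous (derive1 v)}) ->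
  forall z, a < z < b -> Phi z = d (v z) * `|derive1 v z| `^ (p - 2) * derive1 v z.
Proof.
move=> vC1 z zab; have vz := v01 z.
have dv t : t \in `]a, b[%R -> derivable v t 1.
  by rewrite in_itv/= => /vC1[].
have ab : a <= b by lra.
have zin : z \in `]a, b[%R by rewrite in_itv.
have [v0|v0] := eqVneq (v z) 0.
  rewrite Phi_end; last by left.
  have dz := @derive1_at_min R v a b z ab dv zin.
  have {}dz : is_derive z 1 v 0 by apply: dz => t _; rewrite v0; case/andP: (v01 t).
  by rewrite derive1E derive_val mulr0.
have [v1|v1] := eqVneq (v z) 1.
  rewrite Phi_end; last by right.
  have dz := @derive1_at_max R v a b z ab dv zin.
  have {}dz : is_derive z 1 v 0 by apply: dz => t _; rewrite v1; case/andP: (v01 t).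
  by rewrite derive1E derive_val mulr0.
have {v0 v1 vz}vz : 0 < v z < 1 by rewrite !lt_neqAle eq_sym v0 v1.
set s := v z in vz *; set L := derive1 v z.
have yds : 0 < y s by exact: y_gt0.
have wL : w x @[x --> s^'] --> L.
  have : derive1 v t @[t --> travel_time s] --> L by rewrite vK//; exact: (vC1 z zab).2.
  move=> cL; have ct : travel_time x @[x --> s^'] --> travel_time s.
    by apply: cvg_within_filter; exact: time_cont.
  have := cvg_comp _ _ ct cL.
  apply: cvg_trans; apply: near_eq_cvg; near=> x.
  have x01 : 0 < x < 1.
    by near: x; apply: nbhs_dnbhs; near=> x;
      apply/andP; split; near: x; [apply: lt_nbhsr|apply: lt_nbhsl]; case/andP: vz.
  by rewrite /= derive_v ?timeK//; near: x; exact: notin_seq_dnbhs.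
pose a1 := s / 2; pose b1 := (s + 1) / 2.
have [a10 ab1 b11] : [/\ 0 < a1, a1 < b1 & b1 < 1] by rewrite /a1 /b1; split; lra.
have [m m0 mP] := y_lb a10 (ltW ab1) b11.
have [D DP] := d_ub a10 ab1 b11.
have D0 : 0 < D by apply: lt_le_trans (dpos vz) (DP _ _); rewrite /a1 /b1; lra.
have L0 : L < 0.
  apply: (@le_lt_trans _ _ (- (m / D) `^ e)); last by rewrite oppr_lt0 powR_gt0// divr_gt0.
  apply: (cvgr_to_le wL); near=> x.
  have xab : a1 <= x <= b1.
    by near: x; apply: nbhs_dnbhs; near=> x;
      apply/andP; split; apply: ltW; near: x; [apply: lt_nbhsr|apply: lt_nbhsl];
      rewrite /a1 /b1; lra.
  have x01 : 0 < x < 1 by lra.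
  by rewrite lerN2; apply: powR_div_le; rewrite ?mP ?DP ?dpos//; exact: ltW.
have LE : L = - (y s / d s) `^ e.
  have : d x @[x --> s^'] --> y s / (- L) `^ (p - 1).
    have cy : y x @[x --> s^'] --> y s by apply: cvg_within_filter; exact: y_cont.
    have cN : - w x @[x --> s^'] --> - L by exact: cvgN.
    have cp : (fun t => t `^ (p - 1)) t @[t --> - L] --> (- L) `^ (p - 1).
      by apply: (@powR_continuous id (- L)) => //=; lra.
    have cw := cvg_comp _ _ cN cp.
    have nL : 0 < - L by rewrite oppr_gt0.
    have cd : y x / (- w x) `^ (p - 1) @[x --> s^'] --> y s / (- L) `^ (p - 1).
      by apply: cvgM => //; apply: cvgV; rewrite ?gt_eqF ?powR_gt0.
    apply: cvg_trans cd; apply: near_eq_cvg; near=> x.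
    have x01 : 0 < x < 1.
      by near: x; apply: nbhs_dnbhs; near=> x;
        apply/andP; split; near: x; [apply: lt_nbhsr|apply: lt_nbhsl]; case/andP: vz.
    have yx := y_gt0 x01; have dx := dpos x01.
    rewrite /w opprK powRK_p1V//; last by rewrite divr_ge0// ltW.
    by field; rewrite !gt_eqF.
  move=> /(d_nonrem vz) ->.
  have L1 : 0 < (- L) `^ (p - 1) by rewrite powR_gt0//; lra.
  have -> : y s / (y s / (- L) `^ (p - 1)) = (- L) `^ (p - 1).
    by field; rewrite !gt_eqF.
  by rewrite powRK_p1 ?opprK//; lra.
rewrite LE /Phi /Y -/s vz; apply: flux_of_speed => //; [exact: dpos|exact: ltW].
Unshelve. all: by end_near. Qed.

Let v_noninc t1 t2 : t1 <= t2 -> v t2 <= v t1.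
Proof.
move=> t12; rewrite leNgt; apply/negP => vv.
have vt1 := v01 t1; have vt2 := v01 t2.
have x01 : 0 < (v t1 + v t2) / 2 < 1 by lra.
have := @v_lt t2 _ x01; have := @v_gt t1 _ x01; lra.
Qed.

Let hv_meas : measurable_fun setT (h \o v).
Proof. by apply: measurableT_comp => //; exact: continuous_measurable_fun. Qed.

Let hv_bnd z : `|(h \o v) z| <= M. Proof. exact: h_bnd. Qed.

(* the integral law says that E is constant *)
Let E z := Phi z + oriented_int q 0 (v z) + oriented_int (h \o v) 0 z.

Let E_cont : continuous E.
Proof.
move=> z; apply: cvgD; last exact: (bounded_oriented_int_continuous hv_meas hv_bnd).
apply: cvgD; first exact: Phi_cont.
by apply: (cvg_comp _ _ (@v_cont z)); exact: (bounded_oriented_int_continuous q_meas q_bnd).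
Qed.

Let H_der z : {for z, continuous (h \o v)} ->
  is_derive z 1 (oriented_int (h \o v) 0) (h (v z)).
Proof. exact: (bounded_oriented_int_derive hv_meas hv_bnd). Qed.

Let E_der_in z : 0 < v z < 1 -> v z \notin S -> is_derive z 1 E 0.
Proof.
move=> vz vS; have dv := v_der vz vS; set x := v z in vz vS dv *.
have dQ : is_derive z 1 (oriented_int q 0 \o v) (q x * w x).
  apply: is_derive1_comp; apply: (bounded_oriented_int_derive q_meas q_bnd).
  exact: q_cont.
have dH : is_derive z 1 (oriented_int (h \o v) 0) (h x).
  by apply: H_der; apply: continuous_comp; [exact: v_cont|exact: h_cont].
have dy := y_der vz vS; set D := q x - _ in dy.
have dP : is_derive z 1 Phi (- (D * w x)).
  have d1 : is_derive z 1 (- (y \o v)) (- (D * w x)).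
    by apply: is_deriveN; exact: is_derive1_comp.
  apply: near_eq_is_derive d1 => //; near=> t; rewrite /Phi /Y ifT//.
  by near: t; exact: near_v01.
have -> : 0 = - (D * w x) + q x * w x + h x.
  have yx := y_gt0 vz; have dx := dpos vz.
  have yp := powR_gt0 e yx; have dp := powR_gt0 e dx.
  rewrite /D /w /kappa -/e powRN.
  have -> : (y x / d x) `^ e = y x `^ e / d x `^ e.
    by rewrite -powRV ?(ltW dx)// powRM ?invr_ge0 ?(ltW dx) ?(ltW yx).
  by field; rewrite !gt_eqF.
exact: is_deriveD.
Unshelve. all: by end_near. Qed.

Let E_der_const z c : (c = 0 \/ c = 1) -> (\forall t \near z, v t = c) ->
  is_derive z 1 E 0.
Proof.
move=> cP vc; have hc : h c = 0 by case: cP => ->; case: h_end.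
have Yc : Y c = 0 by case: cP => ->; rewrite ?Y0 ?Y1.
have vz : v z = c by exact: nbhs_singleton vc.
have ch : {for z, continuous (h \o v)}.
  rewrite /prop_for/continuous_at/= vz hc.
  apply: cvg_near_cst; near=> t; rewrite /=.
  by have -> : v t = c by near: t.
have dH := H_der ch; rewrite vz hc in dH.
have d1 : is_derive z 1 (fun t => oriented_int q 0 c + oriented_int (h \o v) 0 t) 0.
  by have := is_deriveD (is_derive_cst (oriented_int q 0 c) z 1) dH; rewrite addr0.
apply: near_eq_is_derive d1 => //; near=> t.
have vt : v t = c by near: t.
by rewrite /E /Phi vt Yc oppr0 add0r.
Unshelve. all: by end_near. Qed.

(* the endpoints, when finite, of the set where the profile is 0 or 1 *)
Let zero_time := xget 0 [set z | v z = 0 /\ forall t, t < z -> v t <> 0].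
Let one_time := xget 0 [set z | v z = 1 /\ forall t, z < t -> v t <> 1].

Let E_der z : z \notin zero_time :: one_time :: map travel_time S -> is_derive z 1 E 0.
Proof.
rewrite !inE !negb_or => /and3P[z0 z1 zS]; have vz := v01 z.
have [v0|v0] := eqVneq (v z) 0.
  have [[t tz vt]|H] := pselect (exists2 t, t < z & v t = 0).
    apply: (@E_der_const z 0); first by left.
    near=> s; apply/eqP; rewrite eq_le (proj1 (andP (v01 s))) andbT -vt.
    by apply: v_noninc; apply: ltW; near: s; exact: lt_nbhsr.
  case/eqP: z0; rewrite /zero_time; case: xgetP => [b _ [vb bP]|/(_ z)].
    have [zb|bz|//] := ltgtP z b; first by have := bP z zb.
    by case: H; exists b.
  by case; split=> // t tz vt; apply: H; exists t.
have [v1|v1] := eqVneq (v z) 1.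
  have [[t tz vt]|H] := pselect (exists2 t, z < t & v t = 1).
    apply: (@E_der_const z 1); first by right.
    near=> s; apply/eqP; rewrite eq_le (proj2 (andP (v01 s))) -vt/=.
    by apply: v_noninc; apply: ltW; near: s; exact: lt_nbhsl.
  case/eqP: z1; rewrite /one_time; case: xgetP => [b _ [vb bP]|/(_ z)].
    have [zb|bz|//] := ltgtP z b; last by have := bP z bz.
    by case: H; exists b.
  by case; split=> // t tz vt; apply: H; exists t.
have {}vz : 0 < v z < 1 by rewrite !lt_neqAle eq_sym v0 v1.
apply: E_der_in => //; apply: contra zS => vS.
by apply/mapP; exists (v z); rewrite ?vK.
Unshelve. all: by end_near. Qed.

Let E_cst z1 z2 : E z1 = E z2.
Proof.
wlog z12 : z1 z2 / z1 <= z2.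
  by move=> H; have [|/ltW] := leP z1 z2; [exact: H|move=> /H].
have le0 : E z2 - E z1 <= 0 * (z2 - z1).
  apply: (@mvt_le_off R E z1 z2 0 _ z12) => z _; first exact: E_cont.
  by move=> /E_der dE; exists 0.
have ge0 : 0 * (z2 - z1) <= E z2 - E z1.
  apply: (@mvt_ge_off R E z1 z2 0 _ z12) => z _; first exact: E_cont.
  by move=> /E_der dE; exists 0.
by move: le0 ge0; rewrite mul0r; lra.
Qed.

Lemma wave_of_orbit : exists v Phi : R -> R,
  [/\ continuous v /\ (forall z, 0 <= v z <= 1),
      (forall z, 0 < v z < 1 -> v z \notin S ->
         derivable v z 1 /\ {for z, continuous (derive1 v)}),
      v z @[z --> -oo] --> (1 : R) /\ v z @[z --> +oo] --> (0 : R),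
      continuous Phi /\ (forall a b, (forall z, a < z < b ->
           derivable v z 1 /\ {for z, continuous (derive1 v)}) ->
         forall z, a < z < b ->
           Phi z = d (v z) * `|derive1 v z| `^ (p - 2) * derive1 v z)
    & [/\ Phi z @[z --> -oo] --> (0 : R), Phi z @[z --> +oo] --> (0 : R),
       (forall z, v z = 0 \/ v z = 1 -> Phi z = 0)
      & forall z1 z2, Phi z2 - Phi z1 + oriented_int q (v z1) (v z2)
         + oriented_int (h \o v) z1 z2 = 0]].
Proof.
exists v, Phi; split=> //; split=> // z1 z2.
have := E_cst z1 z2; rewrite /E.
have := oriented_intB q_meas q_bnd (v z1) (v z2); have := oriented_intB hv_meas hv_bnd z1 z2.
lra.
Qed.

End WaveOfOrbit.

(** * Solutions of the profile problem *)

Section Setting.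
Variable R : realType.
Notation mu := (@lebesgue_measure R).
Variables (p : R) (f g h d : R -> R) (c : R) (S : seq R) (M : R).
Implicit Types x z t a b m l : R.
Hypothesis p_gt1 : 1 < p.
Hypothesis H1 : [/\ Chat_closed f /\ bounded_coeff f,
            Chat_closed g /\ bounded_coeff g,
            Chat_closed h /\ bounded_coeff h
          & Chat_open d].
Hypothesis H2 : locally_pos d /\ locally_bnd_above d.
Hypothesis H3 : [/\ h 0 = 0, h 1 = 0 & locally_pos h].
Hypothesis H4 : lebesgue_measure.-integrable `]0, 1[ (EFin \o kappa p d h).
Hypothesis SE : forall x, Theta f g h d x <-> x \in S.
Hypothesis q0_bnd : forall x, 0 < x < 1 -> `|c * g x - f x| <= M.
Hypothesis h0_bnd : forall x, 0 < x < 1 -> `|h x| <= M.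

(* Truncated to (0, 1), the coefficients are bounded measurable functions on the
   whole line. Solutions do not notice: they take values in [0, 1], h vanishes at
   0 and 1, and integrals do not see the endpoints. *)
Let q0 x := c * g x - f x.
Let q := q0 \_ `]0, 1[.
Let h1 := h \_ `]0, 1[.
Let k := kappa p d h.
Let e := 1 / (p - 1).
Let e_gt0 : 0 < e. Proof. by rewrite divr_gt0// subr_gt0. Qed.

Let M_ge0 : 0 <= M.
Proof. by apply: le_trans (normr_ge0 (h 2^-1)) (h0_bnd _); lra. Qed.

Let qE x : 0 < x < 1 -> q x = q0 x. Proof. exact: patch_oo. Qed.
Let h1E x : 0 < x < 1 -> h1 x = h x. Proof. exact: patch_oo. Qed.

Let patch_out (F : R -> R) x : ~~ (0 < x < 1) -> (F \_ `]0, 1[) x = 0.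
Proof. by move=> x01; rewrite patchE memNset//= in_itv/=; exact/negP. Qed.

Let q_meas : measurable_fun setT q.
Proof.
have [[_ bf] [_ bg] _ _] := H1.
have -> : q = (fun x => c * (g \_ `]0, 1[) x - (f \_ `]0, 1[) x).
  apply/funext => x; have [x01|x01] := boolP (0 < x < 1).
    by rewrite qE// !patch_oo.
  by rewrite /q !patch_out// mulr0 subr0.
apply: measurable_funB; last exact: bounded_coeff_measurable.
by apply: measurable_funM => //; exact: bounded_coeff_measurable.
Qed.

Let q_bnd x : `|q x| <= M.
Proof.
have [x01|x01] := boolP (0 < x < 1); first by rewrite qE//; exact: q0_bnd.
by rewrite /q patch_out// normr0.
Qed.

Let h1_meas : measurable_fun setT h1.
Proof. by have [_ _ [_ bh] _] := H1; exact: bounded_coeff_measurable. Qed.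

Let h1_bnd x : `|h1 x| <= M.
Proof.
have [x01|x01] := boolP (0 < x < 1); first by rewrite h1E//; exact: h0_bnd.
by rewrite /h1 patch_out// normr0.
Qed.

Let h_gt0 x : 0 < x < 1 -> 0 < h x.
Proof. by have [_ _ H] := H3; exact: locally_pos_gt0. Qed.

Let h1_ge0 x : 0 <= h1 x.
Proof.
have [x01|x01] := boolP (0 < x < 1); first by rewrite h1E// ltW// h_gt0.
by rewrite /h1 patch_out.
Qed.

Let h_lb a b : 0 < a -> a < b -> b < 1 ->
  exists2 m : R, 0 < m & forall x, a <= x <= b -> m <= h x.
Proof. by have [_ _ H] := H3; exact: locally_posP. Qed.

Let h1_lb a b : 0 < a -> a < b -> b < 1 ->
  exists2 m : R, 0 < m & forall x, a <= x <= b -> m <= h1 x.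
Proof.
move=> a0 ab b1; have [m m0 mP] := h_lb a0 ab b1; exists m => // x xab.
by rewrite h1E ?mP//; lra.
Qed.

Let d_lb a b : 0 < a -> a < b -> b < 1 ->
  exists2 m : R, 0 < m & forall x, a <= x <= b -> m <= d x.
Proof. by have [H _] := H2; exact: locally_posP. Qed.

Let d_ub a b : 0 < a -> a < b -> b < 1 ->
  exists m : R, forall x, a <= x <= b -> d x <= m.
Proof. by have [_ H] := H2; exact: locally_bnd_aboveP. Qed.

Let dpos x : 0 < x < 1 -> 0 < d x.
Proof. by have [H _] := H2; exact: locally_pos_gt0. Qed.

Let cont_off (F : R -> R) x : discont F `<=` Theta f g h d -> 0 < x < 1 -> x \notin S ->
  {for x, continuous F}.
Proof.
move=> FT x01 xS; apply: contrapT => ncF.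
by move/negP : xS; apply; apply/SE; apply: FT.
Qed.

Let f_cont x : 0 < x < 1 -> x \notin S -> {for x, continuous f}.
Proof. by apply: cont_off => t ?; left; left; right. Qed.
Let g_cont x : 0 < x < 1 -> x \notin S -> {for x, continuous g}.
Proof. by apply: cont_off => t ?; left; right. Qed.
Let h_cont x : 0 < x < 1 -> x \notin S -> {for x, continuous h}.
Proof. by apply: cont_off => t ?; right. Qed.
Let d_cont x : 0 < x < 1 -> x \notin S -> {for x, continuous d}.
Proof. by apply: cont_off => t ?; left; left; left. Qed.

Let q_cont x : 0 < x < 1 -> x \notin S -> {for x, continuous q}.
Proof.
move=> x01 xS; apply: patch_oo_continuous => //.
apply: (@continuousB _ _ _ (fun x => c * g x) f); last exact: f_cont.
by apply: continuousM; [exact: cst_continuous|exact: g_cont].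
Qed.

Let h1_cont x : 0 < x < 1 -> x \notin S -> {for x, continuous h1}.
Proof. by move=> x01 xS; apply: patch_oo_continuous => //; exact: h_cont. Qed.

Let k_cont x : 0 < x < 1 -> x \notin S -> {for x, continuous k}.
Proof.
move=> x01 xS; apply: continuousM; last exact: h_cont.
by apply: powR_continuous; [exact: d_cont|exact: dpos].
Qed.

(* either d is continuous at x, or it has no limit there *)
Let d_nonrem x l : 0 < x < 1 -> d t @[t --> x^'] --> l -> d x = l.
Proof.
move=> x01 dl; have [_ _ _ [_ nr]] := H1.
have cd : {for x, continuous d}.
  by apply: contrapT => ncd; apply: (nr x); [split|exists l].
have dd : d t @[t --> x^'] --> d x by apply: cvg_within_filter; exact: cd.
exact: (cvg_unique _ dd dl).
Qed.

Let h1v (v : R -> R) z : 0 <= v z <= 1 -> h1 (v z) = h (v z).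
Proof.
have [h0 h1' _] := H3; move=> v01.
have [v0|v0] := eqVneq (v z) 0; first by rewrite v0 /h1 patch_out ?ltxx.
have [v1|v1] := eqVneq (v z) 1; first by rewrite v1 /h1 patch_out ?ltxx ?andbF.
by rewrite h1E// !lt_neqAle eq_sym v0 v1.
Qed.

Let q0_meas : measurable_fun (`]0, 1[ : set R) q0.
Proof.
apply: (@measurable_off _ _ S) => x x01 xS.
apply: (@continuousB _ _ _ (fun x => c * g x) f); last exact: f_cont.
by apply: continuousM; [exact: cst_continuous|exact: g_cont].
Qed.

Let oriented_q x y : 0 <= x <= 1 -> 0 <= y <= 1 ->
  oriented_int (fun xi => c * g xi - f xi) x y = oriented_int q x y.
Proof.
move=> x01 y01; apply: (@eq_oriented_int _ _ _ 0 1) => //.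
- exact: measurable_funS q_meas.
- by move=> t t01; rewrite qE.
Qed.

Lemma solution_wave (v : R -> R) : is_solution p f g h d c v ->
  exists Phi, wave p q h1 d S v Phi.
Proof.
move=> [cv [v01 [C1v vny vy [Phi [cPhi [flux [Pny Py] Pend law]]]]]].
exists Phi; split=> //; split.
- move=> z vz vS.
  have nz : \forall t \near z, 0 < v t < 1 /\ v t \notin S.
    have nS : \forall t \near z, v t \notin S := cv z _ (notin_seq_near vS).
    near=> t; split; last by near: t.
    apply/andP; split; near: t.
      by apply: (cvgr_gt _ (cv z)); case/andP: vz.
    by apply: (cvgr_lt _ (cv z)); case/andP: vz.
  have C1t t : 0 < v t < 1 /\ v t \notin S -> derivable v t 1 /\ {for t, continuous (derive1 v)}.
    move=> [vt tS]; apply: C1v => -[/SE|[vt0|vt1]]; first by apply/negP.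
      by move: vt; rewrite vt0 ltxx.
    by move: vt; rewrite vt1 ltxx andbF.
  split; first by have [] := C1t z (conj vz vS).
  move/nbhs_ballP : nz => [del /= d0 dP].
  apply: (flux (z - del) (z + del)).
    by move=> t; rewrite /= in_itv/= => tz; apply/C1t/dP; rewrite /ball/= ltr_norml; lra.
  by rewrite inE/= in_itv/=; lra.
- move=> a b l vl z zab.
  have nl t : a < t < b -> \forall s \near t, v s = l.
    move=> /andP[at_ tb]; near=> s; apply: vl; apply/andP; split; near: s.
      exact: lt_nbhsr.
    exact: lt_nbhsl.
  have dv t : a < t < b -> is_derive t 1 v 0.
    move=> tab; apply: near_eq_is_derive (is_derive_cst l t 1) => //.
    by apply: filterS (nl t tab) => s ->.
  have d0 t : a < t < b -> derive1 v t = 0.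
    by move=> tab; rewrite derive1E; have dvt := dv t tab; rewrite derive_val.
  rewrite (flux a b); last by rewrite inE/= in_itv.
    by rewrite d0// mulr0.
  move=> t; rewrite /= in_itv/= => tab; split; first by have dvt := dv t tab; exact: ex_derive.
  rewrite /prop_for/continuous_at d0//; apply: cvg_near_cst.
  move: tab => /andP[at_ tb]; near=> s; apply: d0.
  by apply/andP; split; near: s; [exact: lt_nbhsr|exact: lt_nbhsl].
- move=> z1 z2; have := law z1 z2; rewrite oriented_q//.
  by have -> : h1 \o v = (fun z => h (v z)) by apply/funext => z; exact: h1v.
Unshelve. all: by end_near. Qed.


Let field_of (y : R -> R) x := q x - k x * y x `^ (- e).

Lemma solution_profile (v : R -> R) : is_solution p f g h d c v ->
  exists Y Z : R -> R,
  [/\ [/\ (forall x, 0 < x < 1 -> 0 < Y x),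
          (forall x, 0 < x < 1 -> {for x, continuous Y})
        & (forall x, 0 < x < 1 -> x \notin S -> is_derive x 1 Y (field_of Y x))],
      Y x @[x --> 0^'+] --> (0 : R) /\ Y x @[x --> 1^'-] --> (0 : R),
      (forall x, 0 < x < 1 -> {for x, continuous Z}) /\
      (forall x, 0 < x < 1 -> x \notin S ->
         is_derive x 1 Z (- (Y x / d x) `^ e)^-1)
    & [/\ (forall x, 0 < x < 1 -> v (Z x) = x),
          (forall z, 0 < v z < 1 -> Z (v z) = z),
          (forall a b, a <= b -> v b <= v a)
        & (forall z, 0 <= v z <= 1)]].
Proof.
move=> /solution_wave[Phi vP].
exists (orbit v Phi), (zeta v); split; split.
- by move=> x x01;
  exact: (orbit_gt0 p_gt1 M_ge0 q_meas q_bnd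
    h1_meas h1_bnd h1_ge0 h1_lb d_lb vP x01).
- by move=> x x01;
  exact: (orbit_continuous p_gt1 M_ge0 q_meas q_bnd
    h1_meas h1_bnd h1_ge0 h1_lb d_lb vP x01).
- move=> x x01 xS; rewrite /field_of.
  have -> : k x = kappa p d h1 x by rewrite /k /kappa h1E.
  exact: (orbit_derive p_gt1 M_ge0 q_meas q_bnd
    h1_meas h1_bnd h1_ge0 h1_lb d_lb q_cont h1_cont vP x01 xS).
- exact: (orbit_lim0 p_gt1 M_ge0 q_meas q_bnd h1_meas h1_bnd h1_ge0 h1_lb d_lb vP).
- exact: (orbit_lim1 p_gt1 M_ge0 q_meas q_bnd h1_meas h1_bnd h1_ge0 h1_lb d_lb vP).
- by move=> x x01;
  exact: (zeta_continuous p_gt1 M_ge0 q_meas q_bnd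
    h1_meas h1_bnd h1_ge0 h1_lb d_lb vP x01).
- by move=> x x01 xS;
  exact: (zeta_derive p_gt1 M_ge0 q_meas q_bnd
    h1_meas h1_bnd h1_ge0 h1_lb d_lb vP x01 xS).
- by move=> x x01; exact: (zetaK vP x01).
- by move=> z vz;
  exact: (wave_zetaK p_gt1 M_ge0 q_meas q_bnd
    h1_meas h1_bnd h1_ge0 h1_lb d_lb vP vz).
- by move=> a b ab;
  exact: (wave_nincr p_gt1 M_ge0 q_meas q_bnd
    h1_meas h1_bnd h1_ge0 h1_lb d_lb vP ab).
- by move=> z; have [[]] := vP.
Qed.

(** The rate field increases with y, so a positive gap between y1 and y2 cannot
    shrink to the right, while y1 vanishes at 1. *)
Lemma orbit_le (y1 y2 : R -> R) :
  (forall x, 0 < x < 1 -> 0 < y1 x) -> (forall x, 0 < x < 1 -> 0 < y2 x) ->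
  (forall x, 0 < x < 1 -> {for x, continuous y1}) ->
  (forall x, 0 < x < 1 -> {for x, continuous y2}) ->
  (forall x, 0 < x < 1 -> x \notin S -> is_derive x 1 y1 (field_of y1 x)) ->
  (forall x, 0 < x < 1 -> x \notin S -> is_derive x 1 y2 (field_of y2 x)) ->
  y1 x @[x --> 1^'-] --> (0 : R) ->
  forall x, 0 < x < 1 -> y1 x <= y2 x.
Proof.
move=> p1 p2 c1 c2 d1 d2 l1 x x01; rewrite leNgt; apply/negP => y21.
have ndecr t : x <= t < 1 -> y1 x - y2 x <= y1 t - y2 t.
  move=> xt; apply: (@ndecr_while_pos R (fun t => y1 t - y2 t) x t S); [lra| | |lra].
    by move=> s sx; apply: cvgB; [apply: c1; lra|apply: c2; lra].
  move=> s sx sS es; have s01 : 0 < s < 1 by lra.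
  have ds1 := d1 s s01 sS; have ds2 := d2 s s01 sS.
  exists (field_of y1 s - field_of y2 s); first exact: is_deriveB.
  have ks : 0 <= k s by rewrite mulr_ge0 ?powR_ge0// ltW// h_gt0.
  have : y1 s `^ (- e) <= y2 s `^ (- e).
    rewrite !powRN lef_pV2 ?posrE ?powR_gt0 ?p1 ?p2//.
    by rewrite ge0_ler_powR ?nnegrE ?(ltW e_gt0) ?(ltW (p1 _ s01)) ?(ltW (p2 _ s01))//; lra.
  by move/(ler_wpM2l ks); rewrite /field_of; lra.
have eta0 : 0 < y1 x - y2 x by lra.
near (1 : R)^'- => t.
have t1 : t < 1 by near: t; exact: nbhs_left_lt.
have xt : x < t by near: t; apply: nbhs_left_gt; case/andP: x01.
have y1t : `|0 - y1 t| < y1 x - y2 x.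
  by near: t; move/cvgrPdist_lt : l1; exact.
have t01 : 0 < t < 1 by lra.
have := ndecr t; have := p2 t t01; move: y1t; rewrite sub0r normrN ltr_norml => H1' H2' H3'.
by have := H3' ltac:(lra); lra.
Unshelve. all: by end_near. Qed.

(** Two solutions have the same orbit by [orbit_le]. The derivative of the inverse
    of the profile depends on the orbit only, so the inverses of v and w differ by
    a constant z0. *)
Lemma solution_unique (v w : R -> R) : is_solution p f g h d c v ->
  is_solution p f g h d c w -> exists z0, forall z, w z = v (z + z0).
Proof.
move=> /solution_profile[Y1 [Z1 [[Y10 Y1c Y1d] [_ Y1l] [Z1c Z1d] [vZ Zv vn v01]]]].
move=> /solution_profile[Y2 [Z2 [[Y20 Y2c Y2d] [_ Y2l] [Z2c Z2d] [wZ Zw wn w01]]]].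
have Y12 x : 0 < x < 1 -> Y1 x = Y2 x.
  by move=> x01; apply/eqP; rewrite eq_le !orbit_le.
have half : 0 < (1 / 2 : R) < 1 by lra.
pose z0 := Z1 (1 / 2) - Z2 (1 / 2).
pose D x := Z1 x - Z2 x.
have Dc x : 0 < x < 1 -> {for x, continuous D}.
  by move=> x01; apply: cvgB; [exact: Z1c|exact: Z2c].
have Dd x : 0 < x < 1 -> x \notin S -> is_derive x 1 D 0.
  move=> x01 xS; have d1 := Z1d x x01 xS; have d2 := Z2d x x01 xS.
  have -> : 0 = (- (Y1 x / d x) `^ e)^-1 - (- (Y2 x / d x) `^ e)^-1.
    by rewrite Y12// subrr.
  exact: is_deriveB.
have Dcst a b : 0 < a -> a <= b -> b < 1 -> D a = D b.
  move=> a0 ab b1.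
  have l : D b - D a <= 0 * (b - a).
    apply: (@mvt_le_off R D a b 0 S ab) => x xab; first by apply: Dc; lra.
    by move=> xS; exists 0 => //; apply: Dd => //; lra.
  have r : 0 * (b - a) <= D b - D a.
    apply: (@mvt_ge_off R D a b 0 S ab) => x xab; first by apply: Dc; lra.
    by move=> xS; exists 0 => //; apply: Dd => //; lra.
  by move: l r; rewrite mul0r; lra.
have Z12 x : 0 < x < 1 -> Z1 x = Z2 x + z0.
  move=> x01; suff : D x = z0 by rewrite /D; lra.
  by have [xh|hx] := leP x (1 / 2); [|apply/esym]; apply: Dcst; lra.
exists z0 => z.
have [wz|wz] := boolP (0 < w z < 1).
  by rewrite -{2}(Zw z wz) -Z12// vZ.
have [vz|vz] := boolP (0 < v (z + z0) < 1).
  have := Zv _ vz; rewrite Z12// => /addIr zE.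
  by rewrite -{1}zE wZ.
have vh := vZ _ half; have wh := wZ _ half.
have ends (u : R -> R) t : 0 <= u t <= 1 -> ~~ (0 < u t < 1) -> u t = 0 \/ u t = 1.
  move=> /andP[u0 u1]; rewrite negb_and -!leNgt => /orP[?|?]; [left|right]; lra.
have [wE|wE] := ends _ _ (w01 z) wz; have [vE|vE] := ends _ _ (v01 (z + z0)) vz; rewrite wE vE//.
  have [zl|zl] := leP z (Z2 (1 / 2)); first by have := wn _ _ zl; lra.
  have : Z1 (1 / 2) <= z + z0 by rewrite Z12//; lra.
  by move=> /vn; lra.
have [zl|zl] := leP (Z2 (1 / 2)) z; first by have := wn _ _ zl; lra.
have : z + z0 <= Z1 (1 / 2) by rewrite Z12//; lra.
by move=> /vn; lra.
Qed.

Lemma no_solution A m : c * g 0 - f 0 < A -> 0 <= m ->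
  A < p / (p - 1) * (m * (p - 1)) `^ (1 / p) ->
  (\forall x \near 0^'+, m <= k x `^ (p - 1) / x) ->
  forall v, ~ is_solution p f g h d c v.
Proof.
move=> qA m0 AK km v /solution_profile[Y [Z [[Y0 Yc Yd] [Yl _] _ _]]].
have [[[_ f0 _] _] [[_ g0 _] _] _ _] := H1.
have ql : c * g x - f x @[x --> 0^'+] --> c * g 0 - f 0.
  by apply: cvgB => //; apply: cvgM => //; exact: cvg_cst.
have qA' : \forall x \near 0^'+, c * g x - f x <= A by exact: (cvgr_le _ ql).
have H : \forall x \near 0^'+, m <= k x `^ (p - 1) / x /\ c * g x - f x <= A.
  by near=> x; split; near: x.
have [del d0 dP] : exists2 del : R, 0 < del &
    forall x, 0 < x < del -> m <= k x `^ (p - 1) / x /\ c * g x - f x <= A.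
  move: H; rewrite /at_right near_withinE => /nbhs_ballP[del /= d0 dP].
  exists del => // x /andP[x0 xd]; apply: dP => //.
  by rewrite /ball/= sub0r normrN gtr0_norm.
pose del' := Num.min del (1 / 2).
have [d1 d2 d3] : [/\ del' <= del, del' <= 1 / 2 & 0 < del'].
  by split; rewrite /del' ?ge_min ?lexx ?orbT// lt_min d0; lra.
apply: (@no_orbit R p q k Y S A m del') => //.
- by lra.
- by move=> x ?; apply: Y0; lra.
- by move=> x ?; apply: Yc; lra.
- by move=> x ? ?; apply: Yd => //; lra.
- move=> x xd; rewrite qE; last lra.
  by have [|_] := dP x; [lra|].
- move=> x xd; have x01 : 0 < x < 1 by lra.
  split; first by rewrite mulr_ge0 ?powR_ge0// ltW// h_gt0.
  by have [|] := dP x; [lra|].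
Unshelve. all: by end_near. Qed.


Let k0 := k \_ `]0, 1[.

Let k0E x : 0 < x < 1 -> k0 x = k x. Proof. exact: patch_oo. Qed.

Let k_gt0 x : 0 < x < 1 -> 0 < k x.
Proof. by move=> x01; rewrite mulr_gt0 ?h_gt0// powR_gt0 ?dpos. Qed.

Let k0_ge0 x : 0 <= k0 x.
Proof.
have [x01|x01] := boolP (0 < x < 1); first by rewrite k0E// ltW// k_gt0.
by rewrite /k0 patch_out.
Qed.

Let k0_int a b : mu.-integrable `[a, b] (EFin \o k0).
Proof.
have kT : mu.-integrable setT (EFin \o k0).
  rewrite /k0 -restrict_EFin.
  by apply: (proj1 (@integrable_mkcond _ _ _ mu `]0, 1[ (EFin \o k) _)).
by apply: integrableS kT.
Qed.

Let k_lb a b : 0 < a -> a < b -> b < 1 ->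
  exists2 m : R, 0 < m & forall x, a <= x <= b -> m <= k x.
Proof.
move=> a0 ab b1; have [m1 m10 m1P] := d_lb a0 ab b1.
have [m2 m20 m2P] := h_lb a0 ab b1.
exists (m1 `^ e * m2); first by rewrite mulr_gt0// powR_gt0.
move=> x xab; have x01 : 0 < x < 1 by lra.
apply: ler_pM; rewrite ?powR_ge0 ?(ltW m20) ?m2P//.
by rewrite ge0_ler_powR ?nnegrE ?(ltW e_gt0) ?(ltW m10) ?(ltW (dpos x01)) ?m1P.
Qed.

Let k_ub a b : 0 < a -> a < b -> b < 1 ->
  exists C : R, forall x, a <= x <= b -> k x <= C.
Proof.
move=> a0 ab b1; have [D DP] := d_ub a0 ab b1.
exists (D `^ e * M) => x xab; have x01 : 0 < x < 1 by lra.
have dx := dpos x01; have Dx := DP x xab.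
apply: ler_pM; rewrite ?powR_ge0 ?(ltW (h_gt0 _))//.
  by rewrite ge0_ler_powR ?nnegrE ?(ltW e_gt0) ?(ltW dx)// ltW// (lt_le_trans dx).
exact: le_trans (ler_norm _) (h0_bnd x01).
Qed.

Let phi y := y `^ (- e).

Let phi_gt0 y : 0 < y -> 0 < phi y. Proof. exact: powR_gt0. Qed.

Let phi_nincr x y : 0 < x -> x <= y -> phi y <= phi x.
Proof.
move=> x0 xy; have y0 : 0 < y by exact: lt_le_trans xy.
rewrite /phi !powRN lef_pV2 ?posrE ?powR_gt0//.
by rewrite ge0_ler_powR ?nnegrE ?(ltW e_gt0) ?(ltW x0) ?(ltW y0).
Qed.

Let phi_cont y : 0 < y -> {for y, continuous phi}.
Proof. by move=> y0; apply: (@powR_continuous _ id). Qed.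

Let V x := oriented_int ((fun t => k t / t `^ e) \_ `]0, 1[) 0 x.

(** Perron's method gives an orbit except for its limit at 0, which follows from the
    competitor U = Q - rho^(- e) V. The choice of rho makes U x >= rho * x, hence
    rho^(- e) x^(- e) >= U^(- e) and U is indeed a competitor. Since U <= Q, the
    orbit lies between 0 and M * x. *)
Lemma orbit_exists s : 0 < s ->
  (forall b, 0 < b < 1 ->
     mu.-integrable `[0, b] (EFin \o (fun t => k t / t `^ e) \_ `]0, 1[)) ->
  (forall x, 0 < x < 1 -> V x <= s * x) ->
  (forall x, 0 < x < 1 ->
     p / (p - 1) * (p - 1) `^ (1 / p) * s `^ (1 / (p / (p - 1))) * x
     <= oriented_int q 0 x) ->
  exists y : R -> R,
  [/\ (forall x, 0 < x < 1 -> 0 < y x),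
      (forall x, 0 < x < 1 -> {for x, continuous y}),
      (forall x, 0 < x < 1 -> x \notin S -> is_derive x 1 y (field_of y x)),
      y x @[x --> 0^'+] --> (0 : R)
    & y x @[x --> 1^'-] --> (0 : R)].
Proof.
move=> s0 k2_int Vs Qs; have [rho rho0 rhoE] := young_min_attained p_gt1 s0.
set k2 := ((fun t => k t / t `^ e) \_ `]0, 1[) in k2_int.
have Kap_cont x : 0 < x < 1 -> {for x, continuous (oriented_int k0 0)}.
  by move=> x01; apply: (oriented_int_continuous (k0_int 0 1)); lra.
have Kap_der x : 0 < x < 1 -> x \notin S -> is_derive x 1 (oriented_int k0 0) (k x).
  move=> x01 xS; rewrite -(k0E x01); apply: (oriented_int_derive (k0_int 0 1)) => //; first lra.
  by apply: patch_oo_continuous => //; exact: k_cont.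
have Kap_le x : 0 < x < 1 -> oriented_int k0 0 x <= oriented_int k0 0 1.
  move=> x01; rewrite -subr_ge0.
  rewrite (oriented_int_chasles (k0_int 0 1) (_ : 0 <= 0 <= 1) (_ : 0 <= x <= 1)); [|lra..].
  rewrite addrC addKr; have := @oriented_int_ge R k0 x 1 0 (k0_int x 1).
  by rewrite mul0r; apply=> //; lra.
have Kap_lim : oriented_int k0 0 x @[x --> 1^'-] --> oriented_int k0 0 1.
  have := @parameterized_integral_cvg_at_left R 0 1 k0 ltr01 (k0_int 0 1).
  rewrite /parameterized_integral {2}/oriented_int ler01.
  apply: cvg_trans; apply: near_eq_cvg; near=> x.
  have x0 : 0 < x by near: x; exact: nbhs_left_gt.
  by rewrite /oriented_int (ltW x0).
have [y [y0 yc yd yl ymin]] := perron_orbit phi_gt0 phi_nincr phi_cont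
  (fun C => powRN_blowup C p_gt1) (fun x _ => q_bnd x) (fun x x01 => ltW (k_gt0 x01))
  k_lb k_ub q_cont k_cont Kap_cont Kap_der Kap_le Kap_lim.
exists y; split=> //.
pose U x := oriented_int q 0 x - phi rho * V x.
have V_cont x : 0 < x < 1 -> {for x, continuous V}.
  move=> x01; have b01 : 0 < (x + 1) / 2 < 1 by lra.
  by apply: (oriented_int_continuous (k2_int _ b01)); lra.
have V_der x : 0 < x < 1 -> x \notin S -> is_derive x 1 V (k x / x `^ e).
  move=> x01 xS; have b01 : 0 < (x + 1) / 2 < 1 by lra.
  have -> : k x / x `^ e = k2 x by rewrite /k2 patch_oo.
  apply: (oriented_int_derive (k2_int _ b01)); [lra|lra|].
  apply: patch_oo_continuous => //; apply: continuousM; first exact: k_cont.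
  have x0 : 0 < x by case/andP: x01.
  apply: continuousV; first by rewrite gt_eqF// powR_gt0.
  exact: (@powR_continuous _ id).
have U_ge x : 0 < x < 1 -> rho * x <= U x.
  move=> x01; have := Qs x x01; rewrite -rhoE.
  have := ler_wpM2l (ltW (phi_gt0 rho0)) (Vs x x01).
  by rewrite /U /phi -/e; lra.
have V_ge0 x : 0 < x < 1 -> 0 <= V x.
  move=> x01; have := @oriented_int_ge R k2 0 x 0 (k2_int x x01).
  rewrite mul0r; apply; first lra.
  move=> t tx; have [t01|t01] := boolP (0 < t < 1).
    by rewrite /k2 patch_oo// divr_ge0 ?powR_ge0// ltW// k_gt0.
  by rewrite /k2 patch_out.
have superU x0 : 0 < x0 < 1 -> upper_barrier q k phi x0 U.
  move=> x01; split.
  - move=> x x01'; apply: cvgB; first exact: (bounded_oriented_int_continuous q_meas q_bnd).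
    by apply: cvgM; [exact: cvg_cst|exact: V_cont].
  - move=> x xx; have x01' : 0 < x < 1 by lra.
    by apply: lt_le_trans (U_ge x x01'); rewrite mulr_gt0//; lra.
  - exists S => x xx xS; have x01' : 0 < x < 1 by lra.
    have dV := V_der x x01' xS.
    have dQ := bounded_oriented_int_derive q_meas q_bnd (q_cont x01' xS).
    exists (q x - phi rho * (k x / x `^ e)).
      by apply: is_derive_eq; rewrite /GRing.scale/=; ring.
    rewrite /rate_field lerB//.
    have x0' : 0 < x by lra.
    have -> : phi rho * (k x / x `^ e) = k x * phi (rho * x).
      rewrite /phi (powRM _ (ltW rho0) (ltW x0')) !powRN; ring.
    rewrite ler_wpM2l ?(ltW (k_gt0 x01'))// phi_nincr ?U_ge// mulr_gt0//.
apply/cvgrPdist_lt => eps eps0; near=> x.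
have x01 : 0 < x < 1.
  by apply/andP; split; near: x; [exact: nbhs_right_gt|apply: nbhs_right_lt; lra].
rewrite sub0r normrN (gtr0_norm (y0 x x01)).
apply: le_lt_trans (ymin U superU x x01) _.
have Vx := mulr_ge0 (ltW (phi_gt0 rho0)) (V_ge0 x x01).
have := oriented_int_lip q_meas q_bnd x 0; rewrite oriented_int_refl !subr0.
rewrite (gtr0_norm (proj1 (andP x01))) => Qx.
have xM : (M + 1) * x < eps.
  rewrite mulrC -ltr_pdivlMr; last by have := M_ge0; lra.
  by near: x; apply: nbhs_right_lt; rewrite divr_gt0//; have := M_ge0; lra.
have := ler_norm (oriented_int q 0 x); have := M_ge0; rewrite /U; lra.
Unshelve. all: by end_near. Qed.

Lemma solution_of_orbit (y : R -> R) :
  (forall x, 0 < x < 1 -> 0 < y x) ->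
  (forall x, 0 < x < 1 -> {for x, continuous y}) ->
  (forall x, 0 < x < 1 -> x \notin S -> is_derive x 1 y (field_of y x)) ->
  y x @[x --> 0^'+] --> (0 : R) -> y x @[x --> 1^'-] --> (0 : R) ->
  exists v, is_solution p f g h d c v.
Proof.
move=> y0 yc yd yl0 yl1.
have yd' x : 0 < x < 1 -> x \notin S ->
    is_derive x 1 y (q x - kappa p d h1 x * y x `^ (- (1 / (p - 1)))).
  by move=> x01 xS; rewrite {1}/kappa h1E//; exact: yd.
have h1_end : h1 0 = 0 /\ h1 1 = 0 by rewrite /h1 !patch_out ?ltxx ?andbF.
have [v [Phi [[cv v01] C1v [vny vy] [cPhi flux] [Pny Py Pend law]]]] :=
  wave_of_orbit p_gt1 q_meas q_bnd h1_meas h1_bnd h1_end d_lb d_ub q_cont h1_cont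
    d_cont d_nonrem y0 yc yd' yl0 yl1.
exists v; split=> //; split=> //; split=> //.
  move=> z vz; apply: C1v.
    have := v01 z; rewrite !le_eqVlt => /andP[/orP[/eqP v0|->]].
      by case: vz; right; left.
    by move=> /orP[/eqP v1|-> //]; case: vz; right; right.
  by apply/negP => /SE vS; apply: vz; left.
exists Phi; split=> //; split=> //.
  move=> a b C1 z; rewrite inE/= in_itv/=; apply: flux => t tab.
  by apply: C1; rewrite /= in_itv.
move=> z1 z2; have := law z1 z2; rewrite oriented_q//.
by have -> : h1 \o v = (fun z => h (v z)) by apply/funext => z; exact: h1v.
Qed.


Let rate t := k t / t `^ e.

Let rate_gt0 t : 0 < t < 1 -> 0 < rate t.
Proof. by move=> t01; rewrite divr_gt0 ?k_gt0 ?powR_gt0//; case/andP: t01. Qed.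

Let rate_meas : measurable_fun (`]0, 1[ : set R) rate.
Proof.
apply: (@measurable_off _ _ S) => x x01 xS; have x0 : 0 < x by case/andP: x01.
apply: continuousM; first exact: k_cont.
apply: continuousV; first by rewrite gt_eqF// powR_gt0.
exact: (@powR_continuous _ id).
Qed.

Let patch_integral (F : R -> R) x : measurable_fun (`]0, 1[ : set R) F ->
  0 < x < 1 -> oriented_int (F \_ `]0, 1[) 0 x = \int[mu]_(t in `]0, x[) F t.
Proof.
move=> mF x01; have x0 : 0 < x by case/andP: x01.
have sub : `]0, x[ `<=` (`]0, 1[ : set R) by apply: subset_itvl; rewrite bnd_simp; lra.
have FE : {in (`]0, x[ : set R), F \_ `]0, 1[ =1 F}.
  by move=> t; rewrite inE/= in_itv/= => tx; rewrite patch_oo//; lra.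
rewrite /oriented_int (ltW x0) /Rintegral; congr fine.
rewrite integral_itv_bndoo.
  by apply: eq_integral => t /FE /= ->.
apply/measurable_EFinP; apply: (eq_measurable_fun F) => [t /FE ->//|].
exact: measurable_funS mF.
Qed.

(** The hypothesis forces the supremum s to be finite, which yields the integrability
    of kappa t^(- e) up to any b < 1 and the bounds V x <= s * x and
    K * x <= Q x, K being the right-hand side of the hypothesis. *)
Lemma orbit_exists_mean (p' := p / (p - 1)) :
  (ereal_inf
     [set (1 / xi * \int[lebesgue_measure]_(tau in `]0%R, xi[)
             (c * g tau - f tau)%R)%R%:E | xi in `]0%R, 1%R[]
   > (p' * (p - 1) `^ (1 / p))%:E *
     ereal_sup
       [set (1 / xi)%:E * \int[lebesgue_measure]_(tau in `]0%R, xi[)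
             (kappa p d h tau / tau `^ (1 / (p - 1)))%:E
       | xi in `]0%R, 1%R[] `^ (1 / p'))%E ->
  exists y : R -> R,
  [/\ (forall x, 0 < x < 1 -> 0 < y x),
      (forall x, 0 < x < 1 -> {for x, continuous y}),
      (forall x, 0 < x < 1 -> x \notin S -> is_derive x 1 y (field_of y x)),
      y x @[x --> 0^'+] --> (0 : R)
    & y x @[x --> 1^'-] --> (0 : R)].
Proof.
set I := ereal_inf _; set B := ereal_sup _ => KI.
have IB x : 0 < x < 1 ->
    ((1 / x)%:E * \int[mu]_(t in `]0%R, x[) (rate t)%:E <= B)%E.
  by move=> x01; apply: ereal_sup_ubound; exists x => //=; rewrite in_itv.
have J0 x : 0 < x < 1 -> (0 <= \int[mu]_(t in `]0%R, x[) (rate t)%:E)%E.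
  move=> x01; apply: integral_ge0 => t; rewrite /= in_itv/= => tx.
  by rewrite lee_fin ltW// rate_gt0//; lra.
have half : 0 < (1 / 2 : R) < 1 by lra.
have B0 : (0 <= B)%E.
  by apply: le_trans (IB _ half); rewrite mule_ge0 ?J0// lee_fin; lra.
have [p0 pm] : 0 < p /\ 0 < p - 1 by have := p_gt1; split; lra.
have p'0 : 0 < p' by rewrite divr_gt0.
have C0 : 0 < p' * (p - 1) `^ (1 / p) by rewrite mulr_gt0// powR_gt0.
case BE : B B0 => [s| |] // B0; last first.
  move: KI; rewrite BE poweRyr; last by rewrite gt_eqF// divr_gt0.
  by rewrite gt0_muley ?lte_fin// ltNge leey.
rewrite lee_fin in B0.
have Jfin x : 0 < x < 1 -> (\int[mu]_(t in `]0%R, x[) (rate t)%:E)%E \is a fin_num /\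
    fine (\int[mu]_(t in `]0%R, x[) (rate t)%:E)%E <= s * x.
  move=> x01; have x0 : 0 < x by case/andP: x01.
  have := IB x x01; rewrite BE; have := J0 x x01.
  case: (\int[mu]_(t in `]0%R, x[) (rate t)%:E)%E => [r| |] // r0.
    by rewrite -EFinM lee_fin mul1r mulrC ler_pdivrMr//; split.
  by rewrite gt0_muley ?leye_eq// lte_fin divr_gt0.
have rate_int b : 0 < b < 1 -> mu.-integrable `]0, b[ (EFin \o rate).
  move=> b01; apply/integrableP; split.
    apply/measurable_EFinP; apply: measurable_funS rate_meas => //.
    by apply: subset_itvl; rewrite bnd_simp; lra.
  have [Jf _] := Jfin b b01.
  suff -> : (\int[mu]_(t in `]0%R, b[) `|(EFin \o rate) t| =
             \int[mu]_(t in `]0%R, b[) (rate t)%:E)%E by rewrite ltey_eq Jf.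
  apply: eq_integral => t; rewrite inE/= in_itv/= => tb.
  by rewrite gtr0_norm// rate_gt0//; lra.
have k2_int b : 0 < b < 1 -> mu.-integrable `[0, b] (EFin \o rate \_ `]0, 1[).
  move=> b01; pose b' := (b + 1) / 2; have b'01 : 0 < b' < 1 by rewrite /b'; lra.
  have iT : mu.-integrable setT (EFin \o (rate \_ `]0, b'[)).
    rewrite -restrict_EFin.
    apply: (proj1 (@integrable_mkcond _ _ _ mu `]0, b'[ (EFin \o rate) _)) => //.
    exact: rate_int.
  have iab : mu.-integrable `[0, b] (EFin \o (rate \_ `]0, b'[)) by apply: integrableS iT.
  apply: eq_integrable iab => // t; rewrite inE/= in_itv/= => tb.
  congr EFin; have [t01|t01] := boolP (0 < t < 1).
    by rewrite (patch_oo _ t01) patchE mem_set//= in_itv/= /b'; lra.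
  rewrite patch_out// patchE memNset//= in_itv/=.
  by apply/negP; apply: contra t01; rewrite /b'; lra.
have VE x : 0 < x < 1 -> V x = fine (\int[mu]_(t in `]0%R, x[) (rate t)%:E)%E.
  by move=> x01; rewrite /V (patch_integral rate_meas).
have V_le x : 0 < x < 1 -> V x <= s * x.
  by move=> x01; rewrite VE//; have [] := Jfin x x01.
(* kappa is bounded below by m > 0 on [1/4, 1/2], hence so is its weighted mean *)
have s0 : 0 < s.
  have [m m0 mP] : exists2 m : R, 0 < m & forall x, 1 / 4 <= x <= 1 / 2 -> m <= k x.
    by apply: k_lb; lra.
  have iV := k2_int _ half.
  have : m * (1 / 2 - 1 / 4) <= oriented_int (rate \_ `]0, 1[) (1 / 4) (1 / 2).
    apply: oriented_int_ge; [|lra|].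
      by apply: integrableS iV => //; apply: subset_itvr; rewrite bnd_simp; lra.
    move=> t t12; rewrite patch_oo; last lra.
    apply: le_trans (mP t t12) _; rewrite ler_pdivlMr; last by rewrite powR_gt0//; lra.
    rewrite ler_piMr ?(ltW (k_gt0 _))//; first lra.
    have := @ge0_ler_powR R e (ltW e_gt0) t 1.
    by rewrite powR1 !nnegrE; apply; lra.
  have : 0 <= V (1 / 4) by rewrite VE ?fine_ge0 ?J0//; lra.
  have := V_le _ half.
  have -> : V (1 / 2) = V (1 / 4) + oriented_int (rate \_ `]0, 1[) (1 / 4) (1 / 2).
    by apply: (oriented_int_chasles iV); lra.
  by lra.
apply: (orbit_exists s0 k2_int V_le) => x x01; have x0 : 0 < x by case/andP: x01.
have : (I <= (1 / x * \int[mu]_(t in `]0%R, x[) (c * g t - f t)%R)%R%:E)%E.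
  by apply: ereal_inf_lbound; exists x => //=; rewrite in_itv.
rewrite -(patch_integral q0_meas x01) -/q => /(lt_le_trans KI).
rewrite BE poweR_EFin -EFinM lte_fin [1 / x * _]mulrC mulrA mulr1.
by rewrite ltr_pdivlMr// => /ltW.
Qed.

End Setting.

(** * Reading the growth of the reaction term at 0 *)

Section Ell.
Variables (R : realType) (p : R) (d h : R -> R).
Implicit Types m A K : R.

Lemma ell_inf_ge0 : (0 <= ell_inf p d h)%E.
Proof.
rewrite /ell_inf limf_einfE.
pose F x := (kappa p d h x `^ (p - 1) / x)%:E.
apply: (@le_trans _ _ (ereal_inf (F @` [set x | 0 < x]))).
  apply: le_ereal_inf_tmp => _ [x /= x0 <-].
  by rewrite lee_fin divr_ge0 ?powR_ge0// ltW.
apply: ereal_sup_ubound; exists [set x | 0 < x] => //.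
exact: nbhs_right_gt.
Qed.

Lemma ell_inf_near m : (m%:E < ell_inf p d h)%E ->
  \forall x \near 0^'+, m <= kappa p d h x `^ (p - 1) / x.
Proof.
rewrite /ell_inf limf_einfE => /ereal_sup_gt[_ [W W0 <-] mW].
apply: filterS W0 => x Wx; rewrite -lee_fin; apply: le_trans (ltW mW) _.
by apply: ereal_inf_lbound; exists x.
Qed.

(** The threshold p' (m (p - 1))^(1/p) is an increasing bijection of the half-line of
    nonnegative m. If it is positive for m = ell, some m < ell still has a
    threshold above q0; if it is 0, then m = 0 serves. This also covers an infinite
    ell, where every threshold is exceeded. *)
Lemma ell_level (q0 : R) : 1 < p ->
  (q0%:E < (p / (p - 1))%:E * (ell_inf p d h * (p - 1)%:E) `^ (1 / p))%E ->
  exists A m, [/\ q0 < A, 0 <= m, A < p / (p - 1) * (m * (p - 1)) `^ (1 / p)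
    & m = 0 \/ (m%:E < ell_inf p d h)%E].
Proof.
move=> p1 H; have [p0 pm] : 0 < p /\ 0 < p - 1 by split; lra.
have pp : 0 < p / (p - 1) by rewrite divr_gt0.
have r0 : 0 < 1 / p by rewrite divr_gt0.
have level K : 0 < K ->
    exists2 m, 0 <= m & p / (p - 1) * (m * (p - 1)) `^ (1 / p) = K.
  move=> K0; exists ((K / (p / (p - 1))) `^ p / (p - 1)).
    by rewrite divr_ge0 ?powR_ge0// ltW.
  rewrite divfK ?gt_eqF// -powRrM div1r mulfV ?gt_eqF// powRr1; last first.
    by rewrite divr_ge0// ltW.
  by rewrite mulrC divfK// gt_eqF.
have pick K : q0 < K -> 0 < K ->
    (forall m, 0 <= m -> p / (p - 1) * (m * (p - 1)) `^ (1 / p) = K ->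
       (m%:E < ell_inf p d h)%E) ->
    exists A m, [/\ q0 < A, 0 <= m, A < p / (p - 1) * (m * (p - 1)) `^ (1 / p)
    & m = 0 \/ (m%:E < ell_inf p d h)%E].
  move=> qK K0 Km; have [m m0 mK] := level K K0.
  exists ((q0 + K) / 2), m; split=> //; [lra|rewrite mK; lra|].
  by right; exact: Km.
have := ell_inf_ge0; case EL : ell_inf H pick => [L| |] // H pick L0; last first.
  apply: (pick (`|q0| + 1)) => [| |m m0 _]; last exact: ltry.
    by have := ler_norm q0; lra.
  by have := normr_ge0 q0; lra.
move: H; rewrite -(EFinM L) poweR_EFin -EFinM lte_fin; rewrite lee_fin in L0.
set K := p / (p - 1) * _ => qK.
have K0 : 0 <= K by rewrite mulr_ge0 ?powR_ge0// ltW.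
have [KE|KN] := eqVneq K 0.
  exists (q0 / 2), 0; split=> //; [lra| |by left].
  rewrite mul0r powR0 ?gt_eqF// mulr0; lra.
have {K0}K0 : 0 < K by rewrite lt_neqAle eq_sym KN.
pose K' := Num.max ((q0 + K) / 2) (K / 2).
have [K1 K2 K3] : [/\ (q0 + K) / 2 <= K', K / 2 <= K' & K' < K].
  by split; rewrite /K' ?le_max ?lexx ?orbT// gt_max; lra.
apply: (pick K') => [| |m m0 mK]; [lra|lra|].
rewrite lte_fin ltNge; apply/negP => Lm; move: K3; rewrite ltNge -mK.
rewrite /K ler_pM2l// ge0_ler_powR ?nnegrE ?(ltW r0) ?mulr_ge0 ?(ltW pm)//.
by rewrite ler_wpM2r ?(ltW pm).
Qed.

End Ell.

Theorem theorem19 (R : realType) (p : R) (f g h d : R -> R)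
  (p_gt1 : 1 < p)
  (H1 : [/\ Chat_closed f /\ bounded_coeff f,
            Chat_closed g /\ bounded_coeff g,
            Chat_closed h /\ bounded_coeff h
          & Chat_open d])
  (H2 : locally_pos d /\ locally_bnd_above d)
  (H3 : [/\ h 0 = 0, h 1 = 0 & locally_pos h])
  (H4 : lebesgue_measure.-integrable `]0, 1[ (EFin \o kappa p d h)) :
  let p' : R := p / (p - 1) in
  [/\ (* (1) *)
      ell_inf p d h = +oo%E ->
      forall c : R, ~ exists u, is_tws p f g h d c u,
      (* (2) *)
      (ell_inf p d h < +oo)%E ->
      forall c : R,
      ((c * g 0 - f 0)%:E
         < p'%:E * (ell_inf p d h * (p - 1)%:E) `^ (1 / p))%E ->
      ~ exists u, is_tws p f g h d c u
    & (* (3) *)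
      (ell_sup p d h < +oo)%E ->
      forall c : R,
      (ereal_inf
         [set (1 / xi * \int[lebesgue_measure]_(tau in `]0%R, xi[)
                 (c * g tau - f tau)%R)%R%:E | xi in `]0%R, 1%R[]
       > (p' * (p - 1) `^ (1 / p))%:E *
         ereal_sup
           [set (1 / xi)%:E * \int[lebesgue_measure]_(tau in `]0%R, xi[)
                 (kappa p d h tau / tau `^ (1 / (p - 1)))%:E
           | xi in `]0%R, 1%R[] `^ (1 / p'))%E ->
      (exists u, is_tws p f g h d c u) /\
      (forall v w, is_solution p f g h d c v -> is_solution p f g h d c w ->
         exists z0 : R, forall z, w z = v (z + z0))].
Proof.
move=> p'.
have [p0 pm] : 0 < p /\ 0 < p - 1 by split; lra.
have [[cf bf] [cg bg] [ch bh] cd] := H1.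
have [[cof _ _] [cog _ _] [coh _ _]] := And3 cf cg ch.
have [Sf SfE] := discont_seq cof.
have [Sg SgE] := discont_seq cog.
have [Sh ShE] := discont_seq coh.
have [Sd SdE] := discont_seq cd.
pose S := Sd ++ Sf ++ Sg ++ Sh.
have SE x : Theta f g h d x <-> x \in S.
  rewrite /Theta /S !mem_cat; split.
    by move=> [[[/SdE|/SfE]|/SgE]|/ShE] ->; rewrite ?orbT.
  by move=> /or4P[/SdE|/SfE|/SgE|/ShE]; [left; left; left|left; left; right|left; right|right].
have [Mf MfP] := bounded_coeff_le cf bf.
have [Mg MgP] := bounded_coeff_le cg bg.
have [Mh MhP] := bounded_coeff_le ch bh.
have half : 0 < (2^-1 : R) < 1 by lra.
pose M (c : R) : R := `|c| * Mg + Mf + Mh.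
have qM c (x : R) : 0 < x < 1 -> `|c * g x - f x| <= M c.
  move=> x01; apply: le_trans (ler_normB _ _) _; rewrite normrM.
  have : `|c| * `|g x| <= `|c| * Mg by rewrite ler_wpM2l// MgP.
  by have := MfP x x01; have := le_trans (normr_ge0 _) (MhP _ half); rewrite /M; lra.
have hM c (x : R) : 0 < x < 1 -> `|h x| <= M c.
  move=> x01; have := le_trans (normr_ge0 _) (MgP _ half).
  have := le_trans (normr_ge0 _) (MfP _ half); have := MhP x x01.
  by move=> ? ? Mg0; have := mulr_ge0 (normr_ge0 c) Mg0; rewrite /M; lra.
have none c : ((c * g 0 - f 0)%:E
         < p'%:E * (ell_inf p d h * (p - 1)%:E) `^ (1 / p))%E ->
    ~ exists u, is_tws p f g h d c u.
  move=> /(ell_level p_gt1)[A [m [qA m0 AK mE]]] [u [v [sv _]]].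
  apply: (no_solution p_gt1 H1 H2 H3 SE (qM c) (hM c) qA m0 AK _ sv).
  case: mE => [->|]; last exact: ell_inf_near.
  near=> x; have x0 : 0 < x by near: x; exact: nbhs_right_gt.
  by rewrite divr_ge0 ?powR_ge0// ltW.
split.
- move=> ellE c; apply: none; rewrite ellE.
  rewrite gt0_mulye ?lte_fin// poweRyr; last by rewrite gt_eqF// divr_gt0.
  by rewrite gt0_muley ?ltry// lte_fin divr_gt0.
- by move=> _ c; exact: none.
- move=> _ c KI; split.
    have [y [y0 yc yd yl0 yl1]] :=
      orbit_exists_mean p_gt1 H1 H2 H3 H4 SE (qM c) (hM c) KI.
    have [v sv] := solution_of_orbit p_gt1 H1 H2 H3 SE (qM c) (hM c) y0 yc yd yl0 yl1.
    by exists (fun x t => v (x - c * t)), v.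
  by move=> v w; exact: (solution_unique p_gt1 H1 H2 H3 SE (qM c) (hM c)).
Unshelve. all: by end_near. Qed.
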